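(* Let $\mathbb{F}$ be an algebraically closed field of characteristic $0$, $G$ an abelian group and $n\geq 1$. If a $G$-grading of Type I on the Lie superalgebra $A(n,n)$ is odd, then it is isomorphic to some $\Gamma_A(T,\beta,\gamma)$. Two such gradings, $\Gamma_A(T,\beta,\gamma)$ and $\Gamma_A(T',\beta',\gamma')$, are isomorphic if, and only if, $T=T'$, and there are $\delta\in\{\pm1\}$ and $g\in G$ such that $\beta^\delta=\beta'$ and $g\,\Xi(\gamma^\delta)=\Xi(\gamma')$.
   Context: $M(r,r)$ is the associative superalgebra $M_{2r}(\mathbb{F})=\mathrm{End}(\mathbb{F}^r\oplus\mathbb{F}^r)$ whose even (odd) part consists of the block-diagonal (block-off-diagonal) matrices. $\mathfrak{gl}(r|r)$ is the same superspace with the supercommutator $[a,b]=ab-(-1)^{|a||b|}ba$, $\mathfrak{sl}(r|r)$ is its derived superalgebra (matrices with zero supertrace), and $A(n,n)=\mathfrak{psl}(n+1|n+1)=\mathfrak{sl}(n+1|n+1)/\mathbb{F}I_{2n+2}$. A $G$-grading on a (Lie or associative) superalgebra is an algebra grading $A=\bigoplus_{g\in G}A_g$ whose components are $\mathbb{Z}_2$-graded subspaces. Two $G$-gradings on $A$ are isomorphic if some superalgebra automorphism of $A$ maps each component of the first onto the component of the second of the same degree. Type I. Any $G$-grading on $M(n+1,n+1)$ is a grading on $\mathfrak{gl}(n+1|n+1)$, restricts to $\mathfrak{sl}(n+1|n+1)$ and induces a grading on $\mathfrak{psl}(n+1|n+1)$; the gradings on $A(n,n)$ obtained in this way are said to be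 of Type I. A $G$-grading corresponds to the action of $\widehat{G}=\mathrm{Hom}(G,\mathbb{F}^\times)$ by $\chi\cdot x=\chi(g)x$ for $x$ of degree $g$. A Type I grading on $A(n,n)$ is even if $\widehat{G}$ acts by automorphisms belonging to $\mathcal{E}$, the group of automorphisms of $A(n,n)$ induced by conjugations by invertible even (i.e. block-diagonal) matrices of $M(n+1,n+1)$; otherwise it is odd. The grading $\Gamma_A(T,\beta,\gamma)$. Put $G^\#=G\times\mathbb{Z}_2$, let $p:G^\#\to\mathbb{Z}_2$ be the projection, and identify $G$ with $G\times\{\bar 0\}$. Let $T\subseteq G^\#$ be a finite subgroup not contained in $G$ and $\beta:T\times T\to\mathbb{F}^\times$ a nondegenerate alternating bicharacter. Let $D$ be the $G^\#$-graded division algebra (every nonzero homogeneous element invertible) with support $T$, one-dimensional components $\mathbb{F}X_t$ and $X_uX_v=\beta(u,v)X_vX_u$ (unique up to isomorphism). Let $\gamma=(g_1,\dots,g_k)$ be a tuple of elements of $G=G\times\{\bar 0\}$ with $k\sqrt{|T|}=2(n+1)$. The algebra $M_k(\mathbb{F})\otimes D$ is $G^\#$-graded by $\deg(E_{ij}\otimes d)=g_i(\deg d)g_j^{-1}$ and becomes a superalgebra via $p$, isomorphic to $M(n+1,n+1)$; $\Gamma(T,\beta,\gamma)$ is the corresponding $G$-grading on $M(n+1,n+1)$ (defined up to isomorphism), and $\Gamma_A(T,\beta,\gamma)$ is the induced grading on $A(n,n)$. $\gamma^\delta=(g_1^\delta,\dots,g_k^\delta)$, and $\Xi(\gamma)$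 is the multiset of cosets $g_1T,\dots,g_kT$ in $G^\#/T\cong G/(T\cap G)$ counted with multiplicity; $G$ acts on such multisets by multiplication. *)

(* Defs.v *)
From HB Require Import structures.
From mathcomp Require Import all_boot all_algebra falgebra finmap.

Set Implicit Arguments.
Unset Strict Implicit.
Unset Printing Implicit Defensive.

Import GRing.Theory.
Local Open Scope ring_scope.
Local Open Scope quotient_scope.

(* ring_quotient only provides the additive structure of a quotient; [vquot W]
   is the quotient vector space V / W. *)
Section VectorQuotient.
Variables (F : fieldType) (V : vectType F) (W : {vspace V}).

Definition vquot : Type := Quotient.quot W.

HB.instance Definition _ := GRing.Zmodule.on vquot.

Definition vquot_pi (x : V) : vquot := \pi x.

Lemma vquot_piB : zmod_morphism vquot_pi.
Proof. by move=> x y; rewrite /vquot_pi raddfB. Qed.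

HB.instance Definition _ := GRing.isZmodMorphism.Build V vquot vquot_pi vquot_piB.

Lemma vquot_piP x y : (vquot_pi x == vquot_pi y) = (x - y \in W).
Proof. by rewrite Quotient.idealrBE. Qed.

Lemma vquot_pi_eq0 x : (vquot_pi x == 0) = (x \in W).
Proof. by rewrite -(raddf0 vquot_pi) vquot_piP subr0. Qed.

Lemma vquot_reprK (q : vquot) : vquot_pi (repr q) = q.
Proof. exact: reprK. Qed.

Definition vquot_scale (a : F) (q : vquot) : vquot := vquot_pi (a *: repr q).

Lemma vquot_scale_pi a x : vquot_scale a (vquot_pi x) = vquot_pi (a *: x).
Proof.
apply/eqP; rewrite /vquot_scale vquot_piP -scalerBr memvZ //.
by rewrite -vquot_piP vquot_reprK.
Qed.

Lemma vquot_scaleA a b q :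
  vquot_scale a (vquot_scale b q) = vquot_scale (a * b) q.
Proof. by rewrite -[q]vquot_reprK !vquot_scale_pi scalerA. Qed.

Lemma vquot_scale1 : left_id 1 vquot_scale.
Proof. by move=> q; rewrite -[q]vquot_reprK vquot_scale_pi scale1r. Qed.

Lemma vquot_scaleDr : right_distributive vquot_scale +%R.
Proof.
move=> a q s; rewrite -[q]vquot_reprK -[s]vquot_reprK.
by rewrite -raddfD !vquot_scale_pi scalerDr raddfD.
Qed.

Lemma vquot_scaleDl q : {morph vquot_scale^~ q : a b / a + b}.
Proof.
move=> a b; rewrite -[q]vquot_reprK.
by rewrite !vquot_scale_pi scalerDl raddfD.
Qed.

HB.instance Definition _ := GRing.Zmodule_isLmodule.Build F vquot
  vquot_scaleA vquot_scale1 vquot_scaleDr vquot_scaleDl.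

Lemma vquot_piZ : scalable vquot_pi.
Proof. by move=> a x; rewrite -vquot_scale_pi. Qed.

HB.instance Definition _ := GRing.isScalable.Build F V vquot _ vquot_pi vquot_piZ.

Let comp (x : V) : V := x - projv W x.

Let compB x y : comp (x - y) = comp x - comp y.
Proof. by rewrite /comp linearB !opprD !opprK addrACA. Qed.

Let comp_repr x : comp (repr (vquot_pi x)) = comp x.
Proof.
apply/eqP; rewrite -subr_eq0 -compB /comp subr_eq0 projv_id //.
by rewrite -vquot_piP vquot_reprK.
Qed.

Let pi_comp x : vquot_pi (comp x) = vquot_pi x.
Proof.
by apply/eqP; rewrite vquot_piP /comp addrAC subrr add0r rpredN memv_proj.
Qed.

Let comp_id x : x \in (W^C)%VS -> comp x = x.
Proof.
move=> Wx; suff /eqP p0 : projv W x == 0 by rewrite /comp p0 subr0.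
by rewrite -memv_ker lker_proj.
Qed.

Fact vquot_vect_iso : Vector.axiom (\dim W^C) vquot.
Proof.
exists (fun q => \row_i coord (vbasis W^C) i (comp (repr q))).
  move=> a q s; apply/rowP=> i; rewrite !mxE -linearP; congr (coord _ _ _).
  rewrite -[q in LHS]vquot_reprK -[s in LHS]vquot_reprK -linearP comp_repr.
  by rewrite /comp linearP scalerBr opprD addrACA.
exists (fun u : 'rV_(\dim W^C) =>
          vquot_pi (\sum_i u 0 i *: (vbasis W^C)`_i)).
  move=> q /=; rewrite -[RHS]vquot_reprK -[RHS]pi_comp; congr (vquot_pi _).
  rewrite [RHS](coord_vbasis (memv_projC W (repr q))).
  by apply: eq_bigr => i _; rewrite mxE.
move=> u; apply/rowP=> i; rewrite mxE comp_repr comp_id.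
  by rewrite coord_sum_free ?(basis_free (vbasisP _)).
by apply: rpred_sum => j _; rewrite rpredZ ?vbasis_mem ?memt_nth.
Qed.

HB.instance Definition _ := Lmodule_hasFinDim.Build F vquot vquot_vect_iso.

End VectorQuotient.

(* Gradings by an abelian group [H], written additively.  A superalgebra is
   given by a space [A], a product [mul] and its even and odd parts [par]. *)
Section Gradings.
Variables (F : fieldType) (A : vectType F).
Variables (mul : A -> A -> A) (par : 'Z_2 -> {vspace A}).

Definition is_grading (H : zmodType) (Gr : H -> {vspace A}) : Prop :=
  (exists s : seq H,
     [/\ uniq s,
         forall h, h \notin s -> Gr h = 0%VS,
         (\sum_(h <- s) Gr h)%VS = fullv
       & directv (\sum_(h <- s) Gr h)])
  /\ (forall h k x y, x \in Gr h -> y \in Gr k -> mul x y \in Gr (h + k)).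

Definition super_grading (H : zmodType) (Gr : H -> {vspace A}) : Prop :=
  is_grading Gr /\ (forall h, Gr h = (Gr h :&: par 0%R + Gr h :&: par 1%R)%VS).

Definition super_aut (f : 'End(A)) : Prop :=
  [/\ lker f = 0%VS,
      forall x y, f (mul x y) = mul (f x) (f y)
    & forall i, (f @: par i)%VS = par i].

Definition grading_iso (H : zmodType) (Gr Gr' : H -> {vspace A}) : Prop :=
  exists f : 'End(A), super_aut f /\ (forall h, (f @: Gr h)%VS = Gr' h).

End Gradings.

Section MatrixSuperalgebra.
Variables (F : fieldType) (r : nat).
Local Notation M := 'M[F]_(r + r).

Definition mx_part (i : 'Z_2) (x : M) : M :=
  if i == 0 then block_mx (ulsubmx x) 0 0 (drsubmx x)
  else block_mx 0 (ursubmx x) (dlsubmx x) 0.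

Lemma mx_part_linear i : linear (mx_part i).
Proof.
move=> a x y; rewrite /mx_part; case: eqP => _;
  rewrite scale_block_mx add_block_mx !scaler0 !addr0;
  by congr block_mx; apply/matrixP=> ? ?; rewrite !mxE.
Qed.

HB.instance Definition _ i :=
  GRing.isLinear.Build F M M _ (mx_part i) (mx_part_linear i).

Definition mx_par (i : 'Z_2) : {vspace M} := fixedSpace (linfun (mx_part i)).

Lemma mx_parP i x : reflect (mx_part i x = x) (x \in mx_par i).
Proof. by apply: (iffP fixedSpaceP); rewrite lfunE. Qed.

(* [a,b] = ab - (-1)^(|a||b|) ba for homogeneous a, b, extended bilinearly. *)
Definition scomm (a b : M) : M :=
  \sum_(i : 'Z_2) \sum_(j : 'Z_2)
    (mx_part i a *m mx_part j b
     - (-1) ^+ (i * j)%N *: (mx_part j b *m mx_part i a)).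

Definition str (x : M) : F^o := \tr (ulsubmx x) - \tr (drsubmx x).

Lemma str_linear : linear str.
Proof.
move=> a x y; rewrite /str /mxtrace scalerBr !scaler_sumr addrACA -opprD.
rewrite -!big_split /=.
by congr (_ - _); apply: eq_bigr => i _; rewrite !mxE.
Qed.

HB.instance Definition _ := GRing.isLinear.Build F M F^o _ str str_linear.

(* By [scomm_sl] and [sl_derived] below, this is the derived superalgebra of
   gl(r|r). *)
Definition sl : {vspace M} := lker (linfun str).

Lemma slP x : reflect (str x = 0) (x \in sl).
Proof. by rewrite memv_ker lfunE; apply: eqP. Qed.

Lemma scomm_block a b :
  let a1 := ulsubmx a in let a2 := ursubmx a in
  let a3 := dlsubmx a in let a4 := drsubmx a in
  let b1 := ulsubmx b in let b2 := ursubmx b in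
  let b3 := dlsubmx b in let b4 := drsubmx b in
  scomm a b = block_mx
    (a1 *m b1 - b1 *m a1 + (a2 *m b3 + b2 *m a3))
    (a1 *m b2 - b2 *m a4 + (a2 *m b4 - b1 *m a2))
    (a4 *m b3 - b3 *m a1 + (a3 *m b1 - b4 *m a3))
    (a4 *m b4 - b4 *m a4 + (a3 *m b2 + b3 *m a2)).
Proof.
move=> a1 a2 a3 a4 b1 b2 b3 b4.
rewrite /scomm !big_ord_recl !big_ord0 /mx_part /= !addr0 expr0 expr1 !scale1r.
rewrite scaleN1r opprK !mulmx_block !(mul0mx, mulmx0, addr0, add0r).
rewrite !(opp_block_mx, add_block_mx) !(oppr0, addr0, add0r).
rewrite -/a1 -/a2 -/a3 -/a4 -/b1 -/b2 -/b3 -/b4.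
by congr block_mx; rewrite addrC.
Qed.

Lemma scomm_sl a b : scomm a b \in sl.
Proof.
apply/slP; rewrite /str scomm_block block_mxKul block_mxKdr !raddfD /= !raddfN /=.
rewrite ![\tr (dlsubmx _ *m _)]mxtrace_mulC.
rewrite ![\tr (ulsubmx b *m _)]mxtrace_mulC ![\tr (drsubmx b *m _)]mxtrace_mulC.
by rewrite !subrr !add0r -opprD [X in _ - X]addrC subrr.
Qed.

Lemma scomm_linearl b : linear (scomm^~ b).
Proof.
move=> c a a'; rewrite /scomm scaler_sumr -big_split; apply: eq_bigr => i _ /=.
rewrite scaler_sumr -big_split; apply: eq_bigr => j _ /=.
rewrite linearP mulmxDl mulmxDr -scalemxAl -scalemxAr scalerDr scalerBr.
by rewrite opprD addrACA !scalerA mulrC.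
Qed.

Lemma scomm_linearr a : linear (scomm a).
Proof.
move=> c b b'; rewrite /scomm scaler_sumr -big_split; apply: eq_bigr => i _ /=.
rewrite scaler_sumr -big_split; apply: eq_bigr => j _ /=.
rewrite linearP mulmxDl mulmxDr -scalemxAl -scalemxAr scalerDr scalerBr.
by rewrite opprD addrACA !scalerA mulrC.
Qed.

Lemma sl_derived (U : {vspace M}) :
  (forall a b, scomm a b \in U) -> (sl <= U)%VS.
Proof.
move=> commU; apply/subvP=> x /slP; rewrite /str -[x in _ -> x \in U]submxK.
move: (ulsubmx x) (ursubmx x) (dlsubmx x) (drsubmx x) => x1 x2 x3 x4 str0.
have odd a b : block_mx (a *m b) 0 0 (b *m a) \in U.
  have := commU (block_mx 0 a 0 0) (block_mx 0 0 b 0).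
  rewrite scomm_block !(block_mxKul, block_mxKur, block_mxKdl, block_mxKdr).
  by rewrite !(mul0mx, mulmx0, subrr, addr0, add0r, oppr0).
have -> : block_mx x1 x2 x3 x4
    = scomm (block_mx 1%:M 0 0 0) (block_mx 0 x2 (- x3) 0)
    + block_mx (x1 *m 1%:M) 0 0 (1%:M *m x1) + block_mx 0 0 0 (x4 - x1).
  rewrite scomm_block !(block_mxKul, block_mxKur, block_mxKdl, block_mxKdr).
  rewrite !(mul0mx, mulmx0, mul1mx, mulmx1, subrr, addr0, add0r, subr0).
  by rewrite opprK !add_block_mx !(addr0, add0r) addrC subrK.
rewrite !rpredD //; move: (x4 - x1) (raddfB (@mxtrace F r) x4 x1).
rewrite -opprB str0 oppr0 {x1 x2 x3 x4 str0} => y.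
case: (pickP 'I_r) => [o _ try0 | r0 _]; last first.
  suff -> : y = 0 by rewrite block_mx0 mem0v.
  by apply/matrixP=> i; have := r0 i.
pose e i j : 'M[F]_r := delta_mx i j.
suff -> : block_mx 0 0 0 y = \sum_i \sum_j y i j *:
    (block_mx (e o j *m e i o) 0 0 (e i o *m e o j)
     - (i == j)%:R *: block_mx (e o o *m e o o) 0 0 (e o o *m e o o)).
  by apply: rpred_sum => i _; apply: rpred_sum => j _; rewrite rpredZ ?rpredB ?rpredZ.
under eq_bigr => i _ do under eq_bigr => j _ do
  rewrite !mul_delta_mx_cond eqxx !mulr1n scale_block_mx opp_block_mx
    add_block_mx scale_block_mx !(scaler0, oppr0, addr0) scaler_nat
    [j == i]eq_sym subrr scaler0.
have blk (z : 'I_r -> 'M[F]_r) :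
  \sum_i block_mx 0 0 0 (z i) = block_mx 0 0 0 (\sum_i z i) :> M.
  elim/big_ind2: _ => // [|? ? ? ? -> ->]; first by rewrite block_mx0.
  by rewrite add_block_mx !addr0.
under eq_bigr => i _ do rewrite blk.
rewrite blk; congr block_mx.
under eq_bigr => i _ do under eq_bigr => j _ do rewrite scalerBr.
under eq_bigr => i _ do rewrite sumrB.
rewrite sumrB -matrix_sum_delta -[LHS]subr0; congr (_ - _).
rewrite -[LHS](scale0r (delta_mx o o)) -try0 /mxtrace scaler_suml.
apply: eq_bigr => i _; rewrite (bigD1 i) //= eqxx mulr1n big1 ?addr0 // => j.
by rewrite eq_sym => /negPf->; rewrite mulr0n scaler0.
Qed.

Lemma sl1 : 1%:M \in sl.
Proof.
apply/slP; rewrite /str scalar_mx_block.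
by rewrite block_mxKul block_mxKdr subrr.
Qed.

Definition psl := vquot <[vsproj sl 1%:M]>%VS.

HB.instance Definition _ := Vector.on psl.

(* [vsproj sl] retracts the matrix space onto [sl]; hence on [sl] the map
   [psl_pi] is the canonical surjection sl -> psl. *)
Definition psl_pi : 'Hom(M, psl) := linfun (vquot_pi _ \o vsproj sl).

Definition psl_mul (x y : psl) : psl :=
  psl_pi (scomm (vsval (repr x)) (vsval (repr y))).

Definition psl_par (i : 'Z_2) : {vspace psl} := (psl_pi @: (sl :&: mx_par i))%VS.

Lemma psl_pi_eq0 x : x \in sl -> (psl_pi x == 0) = (x \in <[1%:M : M]>%VS).
Proof.
move=> sx; rewrite lfunE /= vquot_pi_eq0; apply/vlineP/vlineP => -[a xE]; exists a.
  by rewrite -(vsprojK sx) xE linearZ /= vsprojK ?sl1.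
by rewrite xE linearZ.
Qed.

Lemma psl_piK (x : psl) : psl_pi (vsval (repr x)) = x.
Proof. by rewrite lfunE /= vsvalK vquot_reprK. Qed.

Lemma psl_mulE : {in sl &, {morph psl_pi : x y / scomm x y >-> psl_mul x y}}.
Proof.
have scomm1l b : scomm 1%:M b = 0.
  rewrite scomm_block scalar_mx_block block_mxKul block_mxKur block_mxKdl.
  rewrite block_mxKdr !(mul1mx, mulmx1, mul0mx, mulmx0) !(subrr, subr0, addr0).
  exact: block_mx0.
have scomm1r a : scomm a 1%:M = 0.
  rewrite scomm_block scalar_mx_block block_mxKul block_mxKur block_mxKdl.
  rewrite block_mxKdr !(mul1mx, mulmx1, mul0mx, mulmx0) !(subrr, subr0, addr0).
  exact: block_mx0.
have rep x : x \in sl -> exists c, x = vsval (repr (psl_pi x)) + c *: 1%:M.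
  move=> sx; set y := vsval _.
  have sy : y \in sl by apply: subvsP.
  have : x - y \in <[1%:M]>%VS.
    by rewrite -psl_pi_eq0 ?rpredB // linearB /= psl_piK subrr.
  by case/vlineP=> c xyE; exists c; rewrite -xyE addrC subrK.
move=> x y /rep[c xE] /rep[d yE]; rewrite /psl_mul [in LHS]xE [in LHS]yE.
by rewrite addrC scomm_linearl scomm1l scaler0 add0r addrC scomm_linearr
  scomm1r scaler0 add0r.
Qed.

End MatrixSuperalgebra.

Section TypeI.
Variables (F : fieldType) (G : zmodType) (r : nat).
Local Notation M := 'M[F]_(r + r).

Definition M_grading (Gr : G -> {vspace M}) : Prop :=
  super_grading (@mulmx F _ _ _) (@mx_par F r) Gr.

Definition psl_grading (Gr : G -> {vspace psl F r}) : Prop :=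
  super_grading (@psl_mul F r) (@psl_par F r) Gr.

Definition psl_grading_iso (Gr Gr' : G -> {vspace psl F r}) : Prop :=
  grading_iso (@psl_mul F r) (@psl_par F r) Gr Gr'.

Definition induced (Gr : G -> {vspace M}) (g : G) : {vspace psl F r} :=
  (@psl_pi F r @: (Gr g :&: sl F r))%VS.

Definition type_I (Gr : G -> {vspace psl F r}) : Prop :=
  exists Gr0 : G -> {vspace M}, M_grading Gr0 /\ Gr =1 induced Gr0.

Definition is_character (chi : G -> F) : Prop :=
  (forall g, chi g != 0) /\ (forall g h, chi (g + h) = chi g * chi h).

Definition acts_by (Gr : G -> {vspace psl F r}) (chi : G -> F)
    (f : 'End(psl F r)) : Prop :=
  forall g x, x \in Gr g -> f x = chi g *: x.

Definition inner_even (f : 'End(psl F r)) : Prop :=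
  exists P : M, [/\ P \in unitmx, P \in mx_par F r 0 &
    forall x, x \in sl F r -> f (psl_pi F r x) = psl_pi F r (P *m x *m invmx P)].

Definition even_type_I (Gr : G -> {vspace psl F r}) : Prop :=
  type_I Gr /\
  forall chi, is_character chi -> exists f, acts_by Gr chi f /\ inner_even f.

Definition odd_type_I (Gr : G -> {vspace psl F r}) : Prop :=
  type_I Gr /\ ~ even_type_I Gr.

End TypeI.

Section Gamma.
Variables (F : fieldType) (G : zmodType).

(* G^# = G x Z_2 ; the second projection is p. *)
Local Notation Gs := (G * 'Z_2)%type.

Record bicharacter_datum (T : {fset Gs}) (beta : Gs -> Gs -> F) : Prop := {
  bd_group : 0 \in T /\ (forall u v, u \in T -> v \in T -> u - v \in T);
  bd_odd : exists2 t, t \in T & t.2 != 0;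
  bd_neq0 : {in T &, forall u v, beta u v != 0};
  bd_mull : {in T & &, forall u v w, beta (u + v) w = beta u w * beta v w};
  bd_mulr : {in T & &, forall u v w, beta u (v + w) = beta u v * beta u w};
  bd_alternating : {in T, forall u, beta u u = 1};
  bd_nondegenerate :
    {in T, forall u, {in T, forall v, beta u v = 1} -> u = 0} }.

(* A model of the graded division algebra D; [Dc h] is its component of
   degree [h]. *)
Record graded_division (T : {fset Gs}) (beta : Gs -> Gs -> F)
    (D : falgType F) (Dc : Gs -> {vspace D}) : Prop := {
  gd_grading : is_grading *%R Dc;
  gd_unit : forall h x, x \in Dc h -> x != 0 -> x \is a GRing.unit;
  gd_support : forall h, (Dc h != 0%VS) = (h \in T);
  gd_dim1 : {in T, forall t, \dim (Dc t) = 1%N};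
  gd_comm : {in T &, forall u v x y, x \in Dc u -> y \in Dc v ->
    x * y = beta u v *: (y * x)} }.

(* [Gr] is (a representative of the isomorphism class of) Gamma(T,beta,gamma):
   phi identifies the algebra M_k(F) (x) D = M_k(D) with M(r,r), sending
   E_ij (x) d, of degree g_i (deg d) g_j^-1 in G^#, into the component of that
   degree.  Both sides being G^#-gradings, components then correspond
   bijectively. *)
Definition is_Gamma (r : nat) (T : {fset Gs}) (beta : Gs -> Gs -> F)
    (k : nat) (gamma : k.-tuple G) (Gr : G -> {vspace 'M[F]_(r + r)}) : Prop :=
  M_grading Gr /\
  exists (D : falgType F) (Dc : Gs -> {vspace D})
         (phi : 'M[D]_k -> 'M[F]_(r + r)),
    graded_division T beta Dc /\
    [/\ bijective phi,
        forall (a : F) A B, phi (map_mx ( *:%R a) A + B) = a *: phi A + phi B,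
        forall A B, phi (A *m B) = phi A *m phi B
      & forall i j t d, d \in Dc t ->
          phi (d *: delta_mx i j)
            \in (Gr (tnth gamma i + t.1 - tnth gamma j)
                  :&: mx_par F r t.2)%VS].

(* The induced grading on A(n,n) = psl(n+1|n+1). *)
Definition is_Gamma_A (n : nat) (T : {fset Gs}) (beta : Gs -> Gs -> F)
    (k : nat) (gamma : k.-tuple G) (Gr : G -> {vspace psl F n.+1}) : Prop :=
  exists2 Gr0 : G -> {vspace 'M[F]_(n.+1 + n.+1)},
    is_Gamma T beta gamma Gr0 & Gr =1 induced Gr0.

(* k sqrt(|T|) = 2(n+1), with l = sqrt(|T|). *)
Definition size_condition (n : nat) (T : {fset Gs}) (k : nat) : Prop :=
  exists2 l : nat, (l ^ 2 = #|` T|)%N & (k * l = 2 * n.+1)%N.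

Definition translate (g : G) (C : {fset Gs}) : {fset Gs} :=
  [fset ((g, 0) + x)%R | x in C]%fset.

(* Multisets of cosets are represented by sequences up to [perm_eq]. *)
Definition Xi (T : {fset Gs}) (gamma : seq G) : seq {fset Gs} :=
  [seq translate g T | g <- gamma].

End Gamma.

(* Main.v *)
(* Existence.  In a grading of the matrix algebra by G x Z_2, a homogeneous
   element of minimal rank yields a homogeneous idempotent e whose corner D is a
   graded division algebra; completing e to a full frame of homogeneous matrix
   units identifies the matrix algebra with M_k(D).  If the support T of D were
   inside G, every character of G would act by conjugation with an even matrix;
   so an odd grading has an odd element in T, which serves to move the degrees
   of the frame into G.

   Isomorphism.  An isomorphism of the induced gradings is an automorphism F of
   the bracket on the traceless part L of sl.  Rank one nilpotent even elements
   are characterized by brackets, so that, up to conjugations by even or odd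
   matrices and the supertranspose, F is the identity on the even part; its odd
   part is then given by scalars, except that for r = 2 the two odd modules may
   mix.  Conjugation by S = diag(1, -1), which is homogeneous for both gradings,
   separates the two contributions, and one obtains an automorphism or
   antiautomorphism of the matrix superalgebra matching the two M_k(D)-gradings
   themselves.  There T, beta and the multiset of cosets are read off from the
   homogeneous elements between the corners of two matrix units E_ii and E'_ll.
   Antiautomorphisms replace (beta, gamma) by their inverses. *)

Require Import Defs.
From HB Require Import structures.
From mathcomp Require Import all_boot all_algebra falgebra finmap perm ssrAC ring.
From Stdlib Require Import Classical_Prop.

Set Implicit Arguments.
Unset Strict Implicit.
Unset Printing Implicit Defensive.

Import GRing.Theory.
Local Open Scope ring_scope.

(** An isomorphism of the induced gradings carries no information about the degrees of 1, which
    vanishes in psl, or of S = diag(1, -1), which lies outside sl. The identity has degree 0 in any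
    case; for S the two degrees must be shown equal. Some basis element [E i j *m U t] is even with
    zero trace and supertrace, because n >= 1, and S times it again lies in L; as both are fixed by
    the normalized map, comparing their degrees in the two gradings compares the degrees of S.
    Homogeneity is expressed through coefficients on the basis [E i j *m U t], that is, by the
    vanishing of linear functionals. A boolean [e] treats automorphisms and antiautomorphisms
    together: the opposite of a superalgebra antiautomorphism preserves the supercommutator, and e =
    true corresponds to delta = -1. For the converse, two models with the same T and beta are
    conjugate; the conjugating matrix comes from a common eigenvector of commuting operators. *)

Record graded_proj (F : fieldType) (A : vectType F) (H : zmodType)
    (Gr : H -> {vspace A}) (s : seq H) (p : H -> 'End(A)) : Prop := {
  gp_uniq : uniq s;
  gp_notin : forall h, h \notin s -> Gr h = 0%VS;
  gp_in : forall h x, p h x \in Gr h;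
  gp_id : forall h x, x \in Gr h -> p h x = x;
  gp_0 : forall h k x, x \in Gr h -> h != k -> p k x = 0;
  gp_sum : forall x, \sum_(h <- s) p h x = x }.

(** * Projections onto the components of a grading *)

Section GradedProj.
Variables (F : fieldType) (A : vectType F) (H : zmodType).
Variables (Gr : H -> {vspace A}).

Lemma directv_seqE (s : seq H) :
  directv (\sum_(h <- s) Gr h) =
  directv (\sum_(i < size s) Gr (nth 0%R s i)).
Proof.
rewrite [LHS]directvE [RHS]directvE /=.
by rewrite [in LHS](big_nth 0%R) [X in _ == X](big_nth 0%R) !big_mkord.
Qed.

(** Replaces the direct sum by linear projections indexed by all of H, so that later arguments take
    homogeneous parts instead of appealing to directness. *)
Lemma is_grading_proj (mul : A -> A -> A) :
  is_grading mul Gr -> exists s p, graded_proj Gr s p.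
Proof.
case=> [[s [us s0 sT dirs]] _].
have [p pin psum] : exists2 p : H -> 'End(A), forall h x, p h x \in Gr h
    & forall x, \sum_(h <- s) p h x = x.
  exists (sumv_pi_for (esym sT)) => [h x|x]; first exact: memv_sum_pi.
  by rewrite sumv_pi_uniq_sum ?memvf // filter_predT.
exists s, p.
have zer h x : h \notin s -> x \in Gr h -> x = 0.
  by move=> /s0->; rewrite memv0 => /eqP.
have uni h x : x \in Gr h -> forall k, p k x = (if k == h then x else 0).
  move=> xh k; have [ks|kNs] := boolP (k \in s); last first.
    rewrite (zer k (p k x)) //.
    by case: eqP => // kh; rewrite (zer k x) // kh.
  have [hs|hNs] := boolP (h \in s); last first.
    by rewrite (zer h x) // linear0 if_same.
  move: dirs; rewrite directv_seqE => /directv_sum_unique dirs.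
  (* Two decompositions of x are compared: the one given by the projections, and x alone in position
     h. *)
  have := dirs (fun i => p (nth 0 s i) x)
     (fun i => if nth 0 s i == h then x else 0).
  rewrite -(big_mkord xpredT (fun i => p (nth 0 s i) x)).
  rewrite -(big_mkord xpredT (fun i => if nth 0 s i == h then x else 0)).
  rewrite -(big_nth 0 xpredT (fun h => p h x)).
  rewrite -(big_nth 0 xpredT (fun k => if k == h then x else 0)) psum.
  rewrite -big_mkcond /= -big_filter (@filter_pred1_uniq _ s h) // big_seq1.
  rewrite eqxx => dirs1.
  have lt_ks : (index k s < size s)%N by rewrite index_mem.
  have /esym/forallP/(_ (Ordinal lt_ks)) := dirs1 (fun _ _ => pin _ _)
    (fun i _ => ltac:(by case: eqP => [->|_]; rewrite ?mem0v)).
  by rewrite /= nth_index // => /eqP.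
split=> //.
  by move=> h x xh; rewrite (uni h) // eqxx.
by move=> h k x xh hk; rewrite (uni h) // eq_sym (negPf hk).
Qed.

Lemma graded_proj_is_grading (mul : A -> A -> A) s p :
  graded_proj Gr s p ->
  (forall h k x y, x \in Gr h -> y \in Gr k -> mul x y \in Gr (h + k)) ->
  is_grading mul Gr.
Proof.
case=> us s0 pin pid p0 psum mulH; split=> //; exists s; split=> //.
  apply/vspaceP=> x; rewrite memvf -(psum x).
  elim/big_rec2: _ => [|h y V _ yV]; first exact: mem0v.
  by apply: memv_add => //; apply: pin.
rewrite directv_seqE; apply/directv_sum_independent => u uin u0 i _.
have := congr1 (p (nth 0 s i)) u0; rewrite linear_sum linear0 (bigD1 i) //=.
rewrite (pid _ _ (uin i isT)) big1 ?addr0 // => j ji.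
rewrite (p0 _ _ _ (uin j isT)) // nth_uniq //.
Qed.

Section Theory.
Variables (s : seq H) (p : H -> 'End(A)) (gp : graded_proj Gr s p).

Lemma gproj_neq0 x : x != 0 -> exists h, p h x != 0.
Proof.
move=> x0; have [/hasP[h _ ?]|/hasPn p0] := boolP (has (fun h => p h x != 0) s).
  by exists h.
case/eqP: x0; rewrite -(gp_sum gp x) big_seq big1 // => h /p0.
by rewrite negbK => /eqP.
Qed.

Variables (mul : A -> A -> A).
Hypothesis mulH :
  forall h k x y, x \in Gr h -> y \in Gr k -> mul x y \in Gr (h + k).

(** Multiplication by a homogeneous element shifts homogeneous parts. This is what allows
    homogeneous solutions to be extracted from solutions of linear equations. *)
Lemma gproj_mull h k x y : linear (mul x) -> x \in Gr h ->
  p (h + k) (mul x y) = mul x (p k y).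
Proof.
move=> lin xh; pose L := GRing.isLinear.Build F A A _ (mul x) lin.
pose f : {linear A -> A} := HB.pack (mul x) L.
rewrite -[mul x y]/(f y) -[mul x _]/(f _) -{1}(gp_sum gp y) !linear_sum /=.
have [ks|ks] := boolP (k \in s).
  rewrite (bigD1_seq k) ?(gp_uniq gp) //= (gp_id gp); last first.
    by apply: mulH => //; apply: (gp_in gp).
  rewrite big1 ?addr0 // => j jk; apply: (gp_0 gp (h := h + j)).
    by apply: mulH => //; apply: (gp_in gp).
  by rewrite (inj_eq (addrI h)).
have /eqP-> : p k y == 0 by rewrite -memv0 -(gp_notin gp ks) (gp_in gp).
rewrite -[mul x 0]/(f 0) linear0 big_seq big1 // => j js; apply: (gp_0 gp (h := h + j)).
  by apply: mulH => //; apply: (gp_in gp).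
by rewrite (inj_eq (addrI h)); apply: contra ks => /eqP<-.
Qed.

End Theory.

End GradedProj.

Lemma gproj_mulr (F : fieldType) (A : vectType F) (H : zmodType)
  (Gr : H -> {vspace A}) s p (gp : graded_proj Gr s p) (mul : A -> A -> A) :
  (forall h k x y, x \in Gr h -> y \in Gr k -> mul x y \in Gr (h + k)) ->
  forall h k x y, linear (mul^~ x) -> x \in Gr h ->
  p (k + h) (mul y x) = mul (p k y) x.
Proof.
move=> mulH h k x y lin xh; rewrite addrC.
apply: (gproj_mull gp (mul := fun a b => mul b a)) => //.
by move=> ? ? ? ? ? ?; rewrite addrC; apply: mulH.
Qed.

Lemma Z2P (i : 'Z_2) : i = 0 \/ i = 1.
Proof. by case: i => -[|[|//]] lt_i2; [left|right]; apply: val_inj. Qed.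

(** * Parity in the matrix superalgebra *)

Section Parity.
Variables (F : fieldType) (r : nat).
Local Notation M := 'M[F]_(r + r).
Local Notation par := (@mx_par F r).

Lemma mx_part_par i (x : M) : mx_part i x \in par i.
Proof.
apply/mx_parP; rewrite /mx_part; case: eqP => _.
  by rewrite block_mxKul block_mxKdr.
by rewrite block_mxKur block_mxKdl.
Qed.

Lemma mx_part_neq i j (x : M) : x \in par i -> j != i -> mx_part j x = 0.
Proof.
move/mx_parP <-; rewrite /mx_part.
case: (Z2P i) => ->; case: (Z2P j) => -> //= _.
  by rewrite block_mxKur block_mxKdl block_mx0.
by rewrite block_mxKul block_mxKdr block_mx0.
Qed.

Lemma mx_part_sum (x : M) : mx_part 0 x + mx_part 1 x = x.
Proof. by rewrite /mx_part /= add_block_mx !(addr0, add0r) submxK. Qed.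

Lemma mx_par0P (x : M) :
  reflect (exists X Y, x = block_mx X 0 0 Y) (x \in par 0).
Proof.
apply: (iffP (mx_parP _ _)) => [<-|[X [Y ->]]]; rewrite /mx_part /=.
  by exists (ulsubmx x), (drsubmx x).
by rewrite block_mxKul block_mxKdr.
Qed.

Lemma mx_par1P (x : M) :
  reflect (exists B C, x = block_mx 0 B C 0) (x \in par 1).
Proof.
apply: (iffP (mx_parP _ _)) => [<-|[B [C ->]]]; rewrite /mx_part /=.
  by exists (ursubmx x), (dlsubmx x).
by rewrite block_mxKur block_mxKdl.
Qed.

Lemma mx_parM i j (x y : M) :
  x \in par i -> y \in par j -> x *m y \in par (i + j).
Proof.
case: (Z2P i) => ->; case: (Z2P j) => ->.
- move/mx_par0P=> [X [Y ->]] /mx_par0P[X' [Y' ->]]; rewrite mulmx_block.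
  apply/mx_par0P; exists (X *m X'), (Y *m Y').
  by rewrite !(mul0mx, mulmx0, addr0, add0r).
- move/mx_par0P=> [X [Y ->]] /mx_par1P[X' [Y' ->]]; rewrite mulmx_block.
  apply/mx_par1P; exists (X *m X'), (Y *m Y').
  by rewrite !(mul0mx, mulmx0, addr0, add0r).
- move/mx_par1P=> [X [Y ->]] /mx_par0P[X' [Y' ->]]; rewrite mulmx_block.
  apply/mx_par1P; exists (X *m Y'), (Y *m X').
  by rewrite !(mul0mx, mulmx0, addr0, add0r).
- move/mx_par1P=> [X [Y ->]] /mx_par1P[X' [Y' ->]]; rewrite mulmx_block.
  have -> : 1 + 1 = 0 :> 'Z_2 by apply: val_inj.
  apply/mx_par0P; exists (X *m Y'), (Y *m X').
  by rewrite !(mul0mx, mulmx0, addr0, add0r).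
Qed.

Variable G : zmodType.
Local Notation Gs := (G * 'Z_2)%type.

(** Absorbs the parity into the group: a superalgebra grading by G becomes an ordinary algebra
    grading by G x Z_2. *)
Definition sharp (Gr : G -> {vspace M}) (h : Gs) : {vspace M} :=
  (Gr h.1 :&: par h.2)%VS.

Lemma sharp_mul (Gr : G -> {vspace M}) : M_grading Gr ->
  forall h k x y, x \in sharp Gr h -> y \in sharp Gr k ->
    x *m y \in sharp Gr (h + k).
Proof.
case=> -[_ mulG] _ h k x y /memv_capP[xh xp] /memv_capP[yh yp].
by apply/memv_capP; split; [apply: mulG|apply: mx_parM].
Qed.

Lemma sharp_proj (Gr : G -> {vspace M}) : M_grading Gr ->
  exists s p, graded_proj (sharp Gr) s p.
Proof.
case=> gr sup; have [s [p gp]] := is_grading_proj gr.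
(* The superalgebra condition on a grading enters here: components contain the even and odd parts of
   their elements. *)
have partG i g x : x \in Gr g -> mx_part i x \in Gr g.
  rewrite [in X in X -> _]sup => /memv_addP[a /memv_capP[ag a0] [b /memv_capP[bg b1] ->]].
  have/mx_parP Ea := a0; have /mx_parP Eb := b1.
  rewrite linearD /=; case: (Z2P i) => ->.
    by rewrite (mx_part_neq b1) // addr0 Ea.
  by rewrite (mx_part_neq a0) // add0r Eb.
exists [seq (g, i) | g <- s, i <- [:: 0; 1 : 'Z_2]].
exists (fun h => (linfun (@mx_part F r h.2) \o p h.1)%VF).
split.
- by rewrite allpairs_uniq ?(gp_uniq gp) // => -[? ?] [? ?] _ _ [-> ->].
- move=> [g i] /= sN; suff -> : sharp Gr (g, i) = (0 :&: par i)%VS.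
    by rewrite cap0v.
  rewrite /sharp /= (gp_notin gp) //; apply: contra sN => gs.
  apply/flatten_mapP; exists g; rewrite // !inE.
  by case: (Z2P i) => ->; rewrite eqxx ?orbT.
- move=> [g i] x; rewrite comp_lfunE lfunE /=; apply/memv_capP; split.
    by apply: partG; apply: (gp_in gp).
  exact: mx_part_par.
- move=> [g i] x /memv_capP[/= xg /mx_parP xi].
  by rewrite comp_lfunE lfunE /= (gp_id gp).
- move=> [g i] [k j] x /memv_capP[/= xg xi] gk.
  rewrite comp_lfunE lfunE /=; have [Egk|ngk] := eqVneq g k.
    rewrite -Egk (gp_id gp) // (mx_part_neq xi) //.
    by apply: contra gk => /eqP->; rewrite Egk.
  by rewrite (gp_0 gp xg ngk) linear0.
move=> x; rewrite big_allpairs_dep /= -[RHS](gp_sum gp); apply: eq_bigr => g _.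
by rewrite !big_cons big_nil addr0 !comp_lfunE !lfunE /= mx_part_sum.
Qed.

End Parity.

Section MatrixMisc.
Variable F : fieldType.

Lemma mx_neq0 m n (A : 'M[F]_(m, n)) : A != 0 -> exists i j, A i j != 0.
Proof.
move=> A0; have [/existsP[i /existsP[j Aij]]|] := boolP [exists i, exists j, A i j != 0].
  by exists i, j.
rewrite negb_exists => /forallP A0'; case/eqP: A0; apply/matrixP=> i j.
rewrite mxE; have := A0' i; rewrite negb_exists => /forallP/(_ j).
by rewrite negbK => /eqP.
Qed.

(** Primeness of the matrix algebra. It provides nonzero elements between any two corners. *)
Lemma mx_sandwich m n p q (A : 'M[F]_(m, n)) (B : 'M[F]_(p, q)) :
  A != 0 -> B != 0 -> exists X : 'M[F]_(n, p), A *m X *m B != 0.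
Proof.
case/mx_neq0=> i [j Aij] /mx_neq0[k [l Bkl]]; exists (delta_mx j k).
apply/eqP=> /matrixP/(_ i l)/eqP; rewrite mxE (bigD1 k) //= big1 => [|k' k'k].
  rewrite addr0 mxE (bigD1 j) //= big1 => [|j' j'j].
    by rewrite addr0 mxE !eqxx mulr1 [X in _ == X]mxE mulf_eq0 (negPf Aij) (negPf Bkl).
  by rewrite mxE (negPf j'j) mulr0.
rewrite mxE big1 ?mul0r // => j' _.
by rewrite mxE (negPf k'k) andbF mulr0.
Qed.

Lemma mx_scalar_cent n (A : 'M[F]_n) :
  (forall B, A *m B = B *m A) -> exists a, A = a%:M.
Proof.
case: n A => [|n] A cA; first by exists 0; apply/matrixP=> -[].
exists (A ord0 ord0); apply/matrixP=> i j.
have /matrixP/(_ i ord0) := cA (delta_mx j ord0).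
rewrite !mxE (bigD1 j) //= big1 => [|k kj]; last by rewrite !mxE (negPf kj) mulr0.
rewrite addr0 mxE !eqxx mulr1 => ->.
have [<-|ij] := eqVneq i j; rewrite ?mulr1n ?mulr0n.
  rewrite (bigD1 ord0) //= big1 => [|k k0]; last by rewrite !mxE (negPf k0) andbF mul0r.
  by rewrite mxE !eqxx mul1r addr0.
by rewrite big1 // => k _; rewrite mxE (negPf ij) mul0r.
Qed.

Lemma mx_pinv m n (A : 'M[F]_(m, n)) : exists X, A *m X *m A = A.
Proof. by exists (pinvmx A); rewrite mulmxKpV ?submx_refl. Qed.

End MatrixMisc.

(** The only consequence of algebraic closedness used from the study of the even part onwards;
    square roots are derived from it as well. *)
Definition has_eigen (F : fieldType) : Prop :=
  forall n (A : 'M[F]_n), (0 < n)%N ->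
  exists a (w : 'rV_n), w *m A = a *: w /\ w != 0.

Lemma eigen_exists (F : closedFieldType) n (A : 'M[F]_n) : (0 < n)%N ->
  exists a (w : 'rV_n), w *m A = a *: w /\ w != 0.
Proof.
case: n A => // n A _; have /closed_rootP[a] : size (char_poly A) != 1.
  by rewrite size_char_poly.
by rewrite -eigenvalue_root_char => /eigenvalueP[w ? ?]; exists a, w.
Qed.

Lemma closed_has_eigen (F : closedFieldType) : has_eigen F.
Proof. exact: eigen_exists. Qed.

From Stdlib Require Import Classical_Prop.

(** * Graded matrix algebras *)

Lemma idempotent_factor (F : fieldType) n m (C : 'M[F]_(n, m)) (R : 'M_(m, n)) :
  row_full C -> row_free R -> (C *m R) *m (C *m R) = C *m R -> R *m C = 1%:M.
Proof.
move=> /row_fullP[C' CV] /row_freeP[R' RV] /(congr1 (fun X => C' *m X *m R')).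
by rewrite /= !mulmxA CV !mul1mx -mulmxA RV mulmx1.
Qed.

Section GradedMatrix.
Variables (F : closedFieldType) (N : nat) (H : zmodType).
Variables (Gr : H -> {vspace 'M[F]_N}) (s : seq H) (p : H -> 'End('M[F]_N)).
Hypothesis gp : graded_proj Gr s p.
Hypothesis mulH :
  forall h k x y, x \in Gr h -> y \in Gr k -> x *m y \in Gr (h + k).

Let mulmx_lin (x : 'M[F]_N) : linear (fun y : 'M[F]_N => x *m y).
Proof. by move=> a y z; rewrite mulmxDr scalemxAr. Qed.

Let mulmxr_lin (x : 'M[F]_N) : linear (fun y : 'M[F]_N => y *m x).
Proof. by move=> a y z; rewrite mulmxDl scalemxAl. Qed.

Lemma proj_mull h k x y : x \in Gr h -> p (h + k) (x *m y) = x *m p k y.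
Proof. by move=> xh; apply: (gproj_mull gp mulH). Qed.

Lemma proj_mulr h k x y : x \in Gr h -> p (k + h) (y *m x) = p k y *m x.
Proof. by move=> xh; apply: (gproj_mulr gp mulH). Qed.

(** By [proj_mull], each homogeneous part of 1 is unchanged when multiplied on the right by the
    degree 0 part of 1. Summing shows that this part is 1. *)
Lemma grade1 : 1%:M \in Gr 0.
Proof.
suff <- : p 0 1%:M = 1%:M by apply: (gp_in gp).
rewrite -[LHS]mul1mx -{1}(gp_sum gp 1%:M) mulmx_suml -[RHS](gp_sum gp 1%:M).
apply: eq_bigr => h _; have ph := gp_in gp h 1%:M.
by rewrite -(proj_mull _ _ ph) addr0 mulmx1 (gp_id gp ph).
Qed.

(** The equation x X x = x is linear in X, and its component of degree h involves only the part of X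
    of degree -h. *)
Lemma hom_pinv h x : x \in Gr h -> exists2 q, q \in Gr (- h) & x *m q *m x = x.
Proof.
move=> xh; have [X xX] := mx_pinv x; exists (p (- h) X); first exact: (gp_in gp).
rewrite -(proj_mull _ _ xh) -(proj_mulr _ _ xh) xX subrr add0r.
exact: (gp_id gp).
Qed.

Lemma hom_min_rank : (0 < N)%N ->
  exists h x, [/\ x \in Gr h, x != 0 &
    forall k y, y \in Gr k -> y != 0 -> (\rank x <= \rank y)%N].
Proof.
move=> N0; have [h [x [xh x0]]] : exists h x, x \in Gr h /\ x != 0.
  have [|h ph] := gproj_neq0 gp (x := 1%:M); last first.
    by exists h, (p h 1%:M); split=> //; apply: (gp_in gp).
  by rewrite -mxrank_eq0 mxrank1 -lt0n.
have [n le_xn] := ubnP (\rank x); elim: n => // n IHn in h x xh x0 le_xn *.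
have [[k [y [yk y0 lt_yx]]]|noy] := classic (exists k y,
  [/\ y \in Gr k, y != 0 & (\rank y < \rank x)%N]).
  by apply: (IHn k y) => //; apply: leq_trans lt_yx _.
exists h, x; split=> // k y yk y0; rewrite leqNgt; apply/negP=> lt_yx.
by case: noy; exists k, y.
Qed.

(* The idempotent comes from a homogeneous element of minimal rank, multiplied
   by a homogeneous pseudo-inverse. *)
Lemma hom_idempotent : (0 < N)%N ->
  exists m (C : 'M_(N, m.+1)) (R : 'M_(m.+1, N)),
    [/\ R *m C = 1%:M, C *m R \in Gr 0 &
        forall k y, y \in Gr k -> y != 0 -> (m.+1 <= \rank y)%N].
Proof.
move=> N0; have [h [x [xh x0 xmin]]] := hom_min_rank N0.
have [q qh xqx] := hom_pinv xh; pose e := x *m q.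
have e0 : e \in Gr 0 by rewrite -(subrr h) mulH.
have ee : e *m e = e by rewrite /e mulmxA xqx.
have re : \rank e = \rank x.
  apply/eqP; rewrite eqn_leq mxrankM_maxl /=.
  by rewrite -{1}xqx mxrankM_maxl.
have RC : row_base e *m col_base e = 1%:M.
  apply: idempotent_factor; rewrite ?col_base_full ?row_base_free //.
  by rewrite mulmx_base.
move: (col_base e) (row_base e) RC (mulmx_base e) re.
case: (\rank e) => [|m] C R RC CR re.
  by case/eqP: x0; apply/eqP; rewrite -mxrank_eq0 -re.
by exists m, C, R; split; rewrite ?CR // => k y; rewrite re; apply: xmin.
Qed.

Section Corner.
Variables (m : nat) (C : 'M[F]_(N, m.+1)) (R : 'M[F]_(m.+1, N)).
Hypothesis RC : R *m C = 1%:M.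
Hypothesis CR0 : C *m R \in Gr 0.
Hypothesis minr : forall k y, y \in Gr k -> y != 0 -> (m.+1 <= \rank y)%N.
Local Notation D := 'M[F]_m.+1.

Let corner (d : D) : 'M[F]_N := C *m d *m R.
Let corner_linear : linear corner.
Proof.
by move=> a d d'; rewrite /corner mulmxDr mulmxDl -scalemxAr -scalemxAl.
Qed.
HB.instance Definition _ := GRing.isLinear.Build F D 'M[F]_N _ corner corner_linear.

(* Minimality of the rank of [C *m R] makes its corner a graded division
   algebra. *)
Definition corner_gr (h : H) : {vspace D} := (linfun corner @^-1: Gr h)%VS.

Lemma corner_grP h d : (d \in corner_gr h) = (C *m d *m R \in Gr h).
Proof. by rewrite -memv_preim lfunE. Qed.

Lemma cornerK (d : D) : R *m (C *m d *m R) *m C = d.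
Proof. by rewrite !mulmxA RC mul1mx -mulmxA RC mulmx1. Qed.

Lemma corner_mul (d d' : D) :
  (C *m d *m R) *m (C *m d' *m R) = C *m (d * d') *m R.
Proof. by rewrite !mulmxA -(mulmxA _ R) RC mulmx1. Qed.

Lemma corner_grM h k (d d' : D) :
  d \in corner_gr h -> d' \in corner_gr k -> d * d' \in corner_gr (h + k).
Proof. by rewrite !corner_grP => dh dk; rewrite -corner_mul mulH. Qed.

Lemma corner_gr1 : (1 : D) \in corner_gr 0.
Proof. by rewrite corner_grP -[1]/(1%:M) mulmx1. Qed.

(** Since [C *m R] has degree 0, the projections commute with compression to the corner and restrict
    to it. *)
Lemma corner_proj : exists q, graded_proj corner_gr s q.
Proof.
pose f h (d : D) := R *m (p h (C *m d *m R)) *m C.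
have flin h : linear (f h).
  move=> a d d'; rewrite /f -[X in p h X]/(corner _) linearP linearP.
  by rewrite mulmxDr mulmxDl -scalemxAr -scalemxAl.
pose L h := GRing.isLinear.Build F D D _ (f h) (flin h).
pose fl h : {linear D -> D} := HB.pack (f h) (L h).
have CRe (d : D) : (C *m R) *m (C *m d *m R) *m (C *m R) = C *m d *m R.
  by rewrite !mulmxA -(mulmxA C) RC mulmx1 -(mulmxA _ R) RC mulmx1.
have fin h d : C *m f h d *m R = p h (C *m d *m R).
  rewrite /f !mulmxA -(mulmxA _ C R) -(proj_mull _ _ CR0) -(proj_mulr _ _ CR0).
  by rewrite add0r addr0 CRe.
exists (fun h => linfun (fl h)); split.
- exact: (gp_uniq gp).
- move=> h hs; apply/eqP; rewrite -subv0; apply/subvP=> d.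
  rewrite corner_grP (gp_notin gp hs) !memv0 => /eqP d0.
  by rewrite -(cornerK d) d0 mulmx0 mul0mx.
- by move=> h d; rewrite lfunE corner_grP /= fin (gp_in gp).
- move=> h d; rewrite corner_grP lfunE => dh /=; rewrite /f (gp_id gp) //.
  exact: cornerK.
- move=> h k d; rewrite corner_grP lfunE => dh hk /=; rewrite /f (gp_0 gp dh) //.
  by rewrite mulmx0 mul0mx.
move=> d; rewrite -[RHS]cornerK -[X in _ = _ *m X *m _](gp_sum gp).
rewrite mulmx_sumr mulmx_suml; apply: eq_bigr => h _.
by rewrite lfunE.
Qed.

Lemma corner_unit h (d : D) : d \in corner_gr h -> d != 0 -> d \in unitmx.
Proof.
rewrite corner_grP => dh d0; rewrite -row_free_unit -row_leq_rank.
have : (m.+1 <= \rank (C *m d *m R))%N.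
  apply: minr dh _; apply: contra d0 => /eqP d0.
  by rewrite -(cornerK d) d0 mulmx0 mul0mx.
move/leq_trans; apply; apply: leq_trans (mxrankM_maxl _ _) _.
exact: mxrankM_maxr.
Qed.

Lemma corner_inv h (d : D) :
  d \in corner_gr h -> d != 0 -> d^-1 \in corner_gr (- h).
Proof.
move=> dh d0; have du := corner_unit dh d0; have [q gq] := corner_proj.
suff <- : q (- h) d^-1 = d^-1 by apply: (gp_in gq).
apply: (mulrI (x := d)) => //; rewrite divrr //.
have := gproj_mull gq corner_grM (- h) d^-1 _ dh; rewrite subrr divrr //= => <-.
  by rewrite (gp_id gq) // corner_gr1.
by move=> a x y; rewrite mulrDr scalerAr.
Qed.

(** If a is an eigenvalue of d^-1 d', then d' - a d is homogeneous and singular, hence zero by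
    [corner_unit]. *)
Lemma corner_line h (d : D) : d \in corner_gr h -> d != 0 ->
  corner_gr h = <[d]>%VS.
Proof.
move=> dh d0; apply/eqP; rewrite eqEsubv -[(<[d]> <= _)%VS]memvE dh andbT.
apply/subvP=> d' d'h; apply/vlineP.
have [a [w [wE w0]]] := eigen_exists (invmx d *m d') (ltn0Sn m).
exists a; apply/eqP; rewrite -subr_eq0; apply: contraR w0 => n0.
have du := corner_unit dh d0.
have nu : d' - a *: d \in unitmx.
  by apply: (corner_unit (h := h)) => //; rewrite rpredB ?rpredZ.
have : w *m invmx d *m (d' - a *: d) = 0.
  by rewrite mulmxBr -mulmxA wE -scalemxAr mulmxKV // subrr.
move/(congr1 (mulmx^~ (invmx (d' - a *: d) *m d))); rewrite mul0mx mulmxA mulmxK //.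
by rewrite mulmxKV // => ->.
Qed.

(** [V i *m W i] will be the i-th diagonal matrix unit, while [V i *m R] and [C *m W i] connect it
    to the corner of [C *m R]. Indexing by [nat] lets a frame be extended by changing values at k;
    only indices below k matter. *)
Definition hom_frame k (V : nat -> 'M[F]_(N, m.+1)) (W : nat -> 'M[F]_(m.+1, N))
    (g : nat -> H) : Prop :=
  [/\ forall i j, (i < k)%N -> (j < k)%N -> W i *m V j = if i == j then 1%:M else 0,
      forall i, (i < k)%N -> V i *m R \in Gr (g i)
    & forall i, (i < k)%N -> C *m W i \in Gr (- g i)].

Lemma hom_frame_le k V W g : hom_frame k V W g -> (k <= N)%N.
Proof.
case=> WV _ _; pose A := \matrix_(i < k, j < N) W i ord0 j.
pose B := \matrix_(j < N, i < k) V i j ord0.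
apply: (@mulmx1_min _ _ _ A B); apply/matrixP=> i j.
have /matrixP/(_ ord0 ord0) := WV i j (ltn_ord i) (ltn_ord j).
move=> E; rewrite [RHS]mxE -val_eqE /=; transitivity ((W i *m V j) ord0 ord0).
  by rewrite !mxE; apply: eq_bigr => l _; rewrite !mxE.
by rewrite E; case: eqP => _; rewrite !mxE ?eqxx.
Qed.

(** The idempotent 1 - f has degree 0 and is nonzero, so primeness yields a nonzero homogeneous
    [v *m R] with v in its image. Minimality of the rank gives v full column rank, and a homogeneous
    pseudo-inverse provides a left inverse; multiplying that by 1 - f makes it orthogonal to the old
    V j. *)
Lemma hom_frame_ext k V W g : hom_frame k V W g ->
  \sum_(i < k) V i *m W i != 1%:M ->
  exists V' W' g', hom_frame k.+1 V' W' g'.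
Proof.
case=> WV Vg Wg f1; pose f := \sum_(i < k) V i *m W i.
have fV j : (j < k)%N -> f *m V j = V j.
  move=> jk; rewrite mulmx_suml (bigD1 (Ordinal jk)) //= -mulmxA WV // eqxx.
  rewrite mulmx1 big1 ?addr0 // => i /negPf ij; rewrite -mulmxA WV //.
  by rewrite -[j]/(val (Ordinal jk)) val_eqE ij mulmx0.
have Wf j : (j < k)%N -> W j *m f = W j.
  move=> jk; rewrite mulmx_sumr (bigD1 (Ordinal jk)) //= mulmxA WV // eqxx.
  rewrite mul1mx big1 ?addr0 // => i /negPf ij; rewrite mulmxA WV //.
  by rewrite -[j]/(val (Ordinal jk)) val_eqE eq_sym ij mul0mx.
have ff : f *m f = f.
  rewrite {2}/f mulmx_sumr; apply: eq_bigr => i _; by rewrite mulmxA fV.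
have f0 : 1%:M - f \in Gr 0.
  rewrite rpredB ?grade1 // rpred_sum // => i _.
  have -> : V i *m W i = (V i *m R) *m (C *m W i).
    by rewrite !mulmxA -(mulmxA _ R) RC mulmx1.
  by rewrite -(subrr (g i)) mulH // ?Vg ?Wg.
have CRn0 : C *m R != 0.
  apply/eqP=> CR; have := cornerK 1; rewrite -[1]/(1%:M) mulmx1 CR mulmx0 mul0mx.
  by move/eqP; rewrite eq_sym oner_eq0.
have [|X X0] := mx_sandwich _ CRn0 (A := 1%:M - f).
  by rewrite subr_eq0 eq_sym.
have [h Xh0] : exists h, (1%:M - f) *m p h X *m (C *m R) != 0.
  have [h] := gproj_neq0 gp X0; rewrite -{1}[h]addr0 proj_mulr //.
  by rewrite -{1}[h]add0r proj_mull //; exists h.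
pose v := (1%:M - f) *m p h X *m C.
have vh : v *m R \in Gr h.
  rewrite -[h]addr0 -[h]add0r /v -mulmxA; apply: mulH => //.
  by apply: mulH => //; apply: (gp_in gp).
have [q qh vqv] := hom_pinv vh.
have rv : row_full v.
  rewrite -col_leq_rank; apply: leq_trans (mxrankM_maxl v R).
  by apply: minr vh _; rewrite /v -mulmxA.
have Rqv : R *m q *m v = 1%:M.
  have : v *m (R *m q *m v) = v.
    move: vqv => /(congr1 (mulmx^~ C)); rewrite !mulmxA.
    by rewrite -(mulmxA _ R C) -[in RHS]mulmxA RC !mulmx1.
  move/(congr1 (mulmx (pinvmx v))).
  by rewrite mulmxA mulVpmx // mul1mx.
have gg : (1%:M - f) *m (1%:M - f) = 1%:M - f.
  by rewrite mulmxBr mulmx1 mulmxBl mul1mx ff subrr subr0.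
have fv : (1%:M - f) *m v = v by rewrite /v !mulmxA gg.
pose w := R *m q *m (1%:M - f).
exists (fun i => if i == k then v else V i), (fun i => if i == k then w else W i),
  (fun i => if i == k then h else g i).
have ltk i : (i < k.+1)%N -> i != k -> (i < k)%N.
  by move=> ik ni; rewrite ltn_neqAle ni.
split.
- move=> i j /ltk ik /ltk jk.
  have [Ei|/ik{}ik] := eqVneq i k; have [Ej|/jk{}jk] := eqVneq j k.
  + by rewrite Ei Ej eqxx /w -mulmxA fv Rqv.
  + rewrite /w -mulmxA mulmxBl mul1mx fV // subrr mulmx0.
    by rewrite Ei eq_sym (ltn_eqF jk).
  + by rewrite -fv mulmxA mulmxBr mulmx1 Wf // subrr mul0mx Ej (ltn_eqF ik).
  + exact: WV.
- by move=> i /ltk ik; case: eqVneq => // /ik; apply: Vg.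
move=> i /ltk ik; case: eqVneq => [_|/ik]; last exact: Wg.
by rewrite /w !mulmxA -[- h]addr0 mulH // -[- h]add0r mulH.
Qed.

Lemma hom_frame_full : exists k V W g,
  hom_frame k V W g /\ \sum_(i < k) V i *m W i = 1%:M.
Proof.
suff ext n k V W g : hom_frame k V W g -> (N <= k + n)%N ->
    exists k V W g, hom_frame k V W g /\ \sum_(i < k) V i *m W i = 1%:M.
  by apply: (ext N 0 (fun=> 0) (fun=> 0) (fun=> 0)) => //; split.
elim: n k V W g => [|n IHn] k V W g fr leN.
  exists k, V, W, g; split=> //; apply/eqP/negPn/negP=> /(hom_frame_ext fr).
  case=> V' [W' [g' /hom_frame_le]]; rewrite ltnNge => /negP[].
  by move: leN; rewrite addn0.
have [f1|/eqP/(hom_frame_ext fr)[V' [W' [g' fr']]]] := classic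
    (\sum_(i < k) V i *m W i = 1%:M).
  by exists k, V, W, g.
by apply: IHn fr' _; rewrite addSnnS.
Qed.

End Corner.

End GradedMatrix.

Section Conj.
Variables (F : fieldType) (N : nat) (P Q : 'M[F]_N).

Definition mxconj (x : 'M[F]_N) : 'M[F]_N := P *m x *m Q.

Lemma mxconj_linear : linear mxconj.
Proof. by move=> a x y; rewrite /mxconj mulmxDr mulmxDl -scalemxAr -scalemxAl. Qed.

HB.instance Definition _ :=
  GRing.isLinear.Build F 'M[F]_N 'M[F]_N _ mxconj mxconj_linear.

Definition lconj : 'End('M[F]_N) := linfun mxconj.

Lemma lconjE x : lconj x = P *m x *m Q.
Proof. by rewrite lfunE. Qed.

End Conj.

Lemma lconjK (F : fieldType) N (P Q : 'M[F]_N) : P *m Q = 1%:M -> cancel (lconj P Q) (lconj Q P).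
Proof.
by move=> /mulmx1C QP x; rewrite !lconjE !mulmxA QP mul1mx -mulmxA QP mulmx1.
Qed.

(** * Morphisms for the supercommutator and their descent to psl *)

Section LieMorphisms.
Variables (F : fieldType) (r : nat).
Local Notation M := 'M[F]_(r + r).
Local Notation par := (@mx_par F r).
Local Notation sl := (sl F r).
Local Notation psl_pi := (psl_pi F r).

Lemma scomm_hom i j (a b : M) : a \in par i -> b \in par j ->
  scomm a b = a *m b - (-1) ^+ (i * j)%N *: (b *m a).
Proof.
move=> ai bj; have /mx_parP Ea := ai; have /mx_parP Eb := bj.
rewrite /scomm (bigD1 i) //= [X in _ + X]big1 ?addr0 => [|i' ni]; last first.
  by rewrite big1 // => j' _; rewrite (mx_part_neq ai) // mul0mx mulmx0 scaler0 subrr.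
rewrite (bigD1 j) //= big1 ?addr0 => [|j' nj]; last first.
  by rewrite (mx_part_neq bj) // mul0mx mulmx0 scaler0 subrr.
by rewrite Ea Eb.
Qed.

(* For [e = true], [Phi] is the opposite of a superalgebra antimorphism; in
   both cases it is a morphism for the supercommutator. *)
Definition lie_type (e : bool) (Phi : 'End(M)) : Prop :=
  (forall i x, x \in par i -> Phi x \in par i) /\
  (forall i j x y, x \in par i -> y \in par j ->
     Phi (x *m y) = if e then - (-1) ^+ (i * j)%N *: (Phi y *m Phi x)
                    else Phi x *m Phi y).

Lemma par_bilin (V : lmodType F) (f g : M -> M -> V) :
  (forall x, linear (f x)) -> (forall y, linear (f^~ y)) ->
  (forall x, linear (g x)) -> (forall y, linear (g^~ y)) ->
  (forall i j x y, x \in par i -> y \in par j -> f x y = g x y) ->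
  forall x y, f x y = g x y.
Proof.
move=> fr fl gr gl fg x y.
have addl (h : M -> M -> V) (hl : forall y, linear (h^~ y)) a b c :
    h (a + b) c = h a c + h b c :> V.
  by have := hl c 1 a b; rewrite !scale1r.
have addr (h : M -> M -> V) (hr : forall x, linear (h x)) a b c :
    h a (b + c) = h a b + h a c :> V.
  by have := hr a 1 b c; rewrite !scale1r.
rewrite -(mx_part_sum x) -(mx_part_sum y) !(addl _ fl, addr _ fr) !(addl _ gl, addr _ gr).
have pp i z := mx_part_par i z : mx_part i z \in par i.
by do !congr (_ + _); apply: fg; apply: pp.
Qed.

Lemma lie_type_scomm e Phi : lie_type e Phi ->
  forall a b, Phi (scomm a b) = scomm (Phi a) (Phi b).
Proof.
case=> Ppar Pmul; apply: par_bilin.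
- by move=> x c y z; rewrite scomm_linearr linearP.
- by move=> x c y z; rewrite scomm_linearl linearP.
- by move=> x c y z; rewrite linearP scomm_linearr.
- by move=> x c y z; rewrite linearP scomm_linearl.
move=> i j x y xi yj; rewrite (scomm_hom xi yj).
rewrite (scomm_hom (Ppar _ _ xi) (Ppar _ _ yj)) linearB linearZ /=.
rewrite (Pmul _ _ _ _ xi yj) (Pmul _ _ _ _ yj xi) [(j * i)%N]mulnC.
case: e {Pmul} => //; rewrite !scaleNr scalerN opprK scalerA -expr2 sqrr_sign.
by rewrite scale1r addrC.
Qed.

(** The preimage of sl contains all supercommutators, and these span sl by [sl_derived]. *)
Lemma scomm_morph_sl (Phi : 'End(M)) :
  (forall a b, Phi (scomm a b) = scomm (Phi a) (Phi b)) ->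
  forall x, x \in sl -> Phi x \in sl.
Proof.
move=> Pc x; suff /subvP sub : (sl <= Phi @^-1: sl)%VS by move/sub; rewrite -memv_preim.
by apply: sl_derived => a b; rewrite -memv_preim Pc scomm_sl.
Qed.

Lemma psl_piE x y : x \in sl -> y \in sl ->
  psl_pi x = psl_pi y -> exists a, x = y + a *: 1%:M.
Proof.
move=> xs ys Exy; have : psl_pi (x - y) == 0 by rewrite linearB /= Exy subrr.
have sxy : x - y \in sl by rewrite rpredB.
rewrite psl_pi_eq0 // => /vlineP[a xyE]; exists a.
by rewrite -xyE addrC subrK.
Qed.

Lemma psl_pi1 a : psl_pi (a *: 1%:M) = 0.
Proof.
by apply/eqP; rewrite psl_pi_eq0 ?rpredZ ?sl1 // memv_line.
Qed.

Lemma psl_lift (Phi : 'End(M)) :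
  (forall x, x \in sl -> Phi x \in sl) -> (exists a, Phi 1%:M = a *: 1%:M) ->
  exists f : 'End(psl F r), forall x, x \in sl -> f (psl_pi x) = psl_pi (Phi x).
Proof.
move=> Psl [c P1]; have rs (x : psl F r) : vsval (repr x) \in sl by apply: subvsP.
have key x y : x \in sl -> y \in sl -> psl_pi x = psl_pi y ->
    psl_pi (Phi x) = psl_pi (Phi y).
  move=> xs ys /(psl_piE xs ys)[a ->]; rewrite linearD linearZ /= P1 linearD /=.
  by rewrite scalerA psl_pi1 addr0.
pose f (x : psl F r) := psl_pi (Phi (vsval (repr x))).
have flin : linear f.
  move=> a x y; rewrite /f -!linearP; apply: key.
  - exact: rs.
  - by rewrite rpredD ?rpredZ ?rs.
  - by rewrite [RHS]linearP /= !psl_piK.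
pose L := GRing.isLinear.Build F (psl F r) (psl F r) _ f flin.
pose fl : {linear psl F r -> psl F r} := HB.pack f L.
exists (linfun fl) => x xs; rewrite lfunE /= /f; apply: key => //.
by rewrite psl_piK.
Qed.

Lemma lconj_lie_type (P Q : M) : P \in par 0 -> Q \in par 0 -> Q *m P = 1%:M ->
  lie_type false (lconj P Q).
Proof.
move=> P0 Q0 QP; split=> [i x xi|i j x y xi yj]; rewrite !lconjE.
  by have := mx_parM (mx_parM P0 xi) Q0; rewrite add0r addr0.
by rewrite !mulmxA -(mulmxA _ Q) QP mulmx1.
Qed.

Lemma psl_conj (P Q : M) : P \in par 0 -> Q \in par 0 -> P *m Q = 1%:M ->
  exists f : 'End(psl F r), forall x, x \in sl -> f (psl_pi x) = psl_pi (P *m x *m Q).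
Proof.
move=> P0 Q0 PQ; have lt := lconj_lie_type P0 Q0 (mulmx1C PQ).
have [|f fE] := psl_lift (scomm_morph_sl (lie_type_scomm lt)).
  by exists 1; rewrite lconjE mulmx1 PQ scale1r.
by exists f => x xs; rewrite fE // lconjE.
Qed.

End LieMorphisms.

(** The data on T without the odd element and over any group: the corner yields it before the parity
    of T is known. *)
Record bichar (F : fieldType) (H : zmodType) (T : {fset H}) (beta : H -> H -> F)
  : Prop := {
  bc_group : 0 \in T /\ (forall u v, u \in T -> v \in T -> u - v \in T);
  bc_neq0 : {in T &, forall u v, beta u v != 0};
  bc_mull : {in T & &, forall u v w, beta (u + v) w = beta u w * beta v w};
  bc_mulr : {in T & &, forall u v w, beta u (v + w) = beta u v * beta u w};
  bc_alt : {in T, forall u, beta u u = 1};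
  bc_nondeg : {in T, forall u, {in T, forall v, beta u v = 1} -> u = 0} }.

(** * Characters of T and nondegenerate bicharacters *)

Section Bicharacter.
Variables (F : fieldType) (H : zmodType) (T : {fset H}) (beta : H -> H -> F).
Hypothesis charF0 : [pchar F] =i pred0.
Hypothesis bc : bichar T beta.

Lemma bc0 : 0 \in T. Proof. by have [] := bc_group bc. Qed.

Lemma bcB u v : u \in T -> v \in T -> u - v \in T.
Proof. by have [_] := bc_group bc; apply. Qed.

Lemma bcN u : u \in T -> - u \in T.
Proof. by move=> uT; rewrite -[- u]add0r bcB ?bc0. Qed.

Lemma bcD u v : u \in T -> v \in T -> u + v \in T.
Proof. by move=> uT vT; rewrite -[v]opprK bcB ?bcN. Qed.

Lemma bc_0r u : u \in T -> beta u 0 = 1.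
Proof.
move=> uT; have := bc_mulr bc uT bc0 bc0; rewrite addr0 => /eqP.
rewrite -{1}[beta u 0]mulr1 (inj_eq (mulfI _)) ?(bc_neq0 bc) ?bc0 //.
by rewrite eq_sym => /eqP.
Qed.

Lemma bc_swap u v : u \in T -> v \in T -> beta u v * beta v u = 1.
Proof.
move=> uT vT; have := bc_alt bc (bcD uT vT).
rewrite (bc_mull bc) ?bcD // !(bc_mulr bc) // !(bc_alt bc) //.
by rewrite mul1r mulr1.
Qed.

(** Translation by v0 permutes T and multiplies the sum by chi v0, which is not 1. *)
Lemma char_sum0 (chi : H -> F) :
  {in T &, forall u v, chi (u + v) = chi u * chi v} ->
  (exists2 v, v \in T & chi v != 1) -> \sum_(v <- T) chi v = 0.
Proof.
move=> chiM [v0 v0T chi1]; have pT : perm_eq T [seq v + v0 | v <- T].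
  apply: uniq_perm; rewrite ?fset_uniq ?map_inj_uniq ?fset_uniq //.
    exact: addIr.
  move=> v; apply/idP/mapP => [vT|[w wT ->]]; last by rewrite bcD.
  by exists (v - v0); rewrite ?bcB ?subrK.
have : (\sum_(v <- T) chi v) * chi v0 = \sum_(v <- T) chi v.
  rewrite [RHS](perm_big _ pT) big_map mulr_suml.
  by apply: eq_big_seq => v vT; rewrite chiM.
move/eqP; rewrite -[X in _ == X]mulr1 -subr_eq0 -mulrBr mulf_eq0 subr_eq0.
by rewrite (negPf chi1) orbF => /eqP.
Qed.

Lemma natF_eq0 k : (k%:R == 0 :> F) = (k == 0)%N.
Proof. by have [char0 _] := pcharf0P F; apply: char0. Qed.

(** Otherwise every character chi / beta u is nontrivial and has sum 0. Summing over u and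
    exchanging the sums, nondegeneracy leaves only the term v = 0, which is |T| times a nonzero
    scalar: a contradiction in characteristic 0. *)
Lemma char_bichar (chi : H -> F) : {in T, forall u, chi u != 0} ->
  {in T &, forall u v, chi (u + v) = chi u * chi v} ->
  exists2 u, u \in T & {in T, forall v, chi v = beta u v}.
Proof.
move=> chi0 chiM.
have [/hasP[u uT /allP uP]|/hasPn noT] :=
    boolP (has (fun u => all (fun v => chi v == beta u v) T) T).
  by exists u => // v /uP/eqP.
have s0 u : u \in T -> \sum_(v <- T) chi v * (beta u v)^-1 = 0.
  move=> uT; apply: char_sum0 => [v w vT wT|].
    by rewrite chiM // (bc_mulr bc) // invfM mulrACA.
  have /allPn[v vT nv] := noT u uT; exists v => //; apply: contra nv => /eqP E.
  apply/eqP; rewrite -[LHS]mulr1 -(mulVf (bc_neq0 bc uT vT)) mulrA E.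
  by rewrite mul1r.
have : \sum_(u <- T) \sum_(v <- T) chi v * (beta u v)^-1 = 0.
  by rewrite big_seq big1.
rewrite exchange_big /= (bigD1_seq 0) ?fset_uniq ?bc0 //= [X in _ + X]big1_seq.
  rewrite addr0 -mulr_sumr => /eqP; rewrite mulf_eq0 (negPf (chi0 _ bc0)) /=.
  under eq_big_seq => u uT do rewrite bc_0r // invr1.
  rewrite big_const_seq count_predT iter_addr addr0 natF_eq0 size_eq0 => /eqP T0.
  by have : 0 \in (T : seq H) := bc0; rewrite T0.
move=> v /andP[v0 vT]; rewrite -mulr_sumr char_sum0 ?mulr0 //.
  by move=> u w uT wT; rewrite (bc_mull bc) // invfM.
have [/hasP[w wT w1]|/hasPn n1] := boolP (has (fun w => beta w v != 1) T).
  by exists w => //; rewrite invr_eq1.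
case/eqP: v0; apply: (bc_nondeg bc vT) => w wT.
by have := bc_swap vT wT; have /eqP-> := negbNE (n1 w wT); rewrite mulr1.
Qed.

End Bicharacter.

Section CornerDatum.
Variables (F : closedFieldType) (N : nat) (H : zmodType).
Variables (Gr : H -> {vspace 'M[F]_N}) (s : seq H) (p : H -> 'End('M[F]_N)).
Hypothesis gp : graded_proj Gr s p.
Hypothesis mulH :
  forall h k x y, x \in Gr h -> y \in Gr k -> x *m y \in Gr (h + k).
Variables (m : nat) (C : 'M[F]_(N, m.+1)) (R : 'M[F]_(m.+1, N)).
Hypothesis RC : R *m C = 1%:M.
Hypothesis CR0 : C *m R \in Gr 0.
Hypothesis minr : forall k y, y \in Gr k -> y != 0 -> (m.+1 <= \rank y)%N.
Local Notation D := (corner_gr Gr C R).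

Definition corner_supp : {fset H} := [fset h in [seq h <- s | D h != 0%VS]]%fset.

Lemma corner_suppP h : (D h != 0%VS) = (h \in corner_supp).
Proof.
have [q gq] := corner_proj gp mulH RC CR0.
rewrite in_fset /= mem_filter; case: eqP => //= nz; apply/esym.
by apply: contra_notT nz; apply: (gp_notin gq).
Qed.

Let X h : 'M[F]_m.+1 := vpick (D h).

Let X_in h : X h \in D h. Proof. exact: memv_pick. Qed.
Let X_neq0 h : (X h != 0) = (h \in corner_supp).
Proof. by rewrite vpick0 corner_suppP. Qed.

Let D_unit h x : x \in D h -> x != 0 -> x \is a GRing.unit.
Proof. exact: (corner_unit RC minr). Qed.

Lemma corner_suppI h x : x \in D h -> x != 0 -> h \in corner_supp.
Proof.
move=> xh; apply: contraR; rewrite -corner_suppP negbK => /eqP D0.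
by move: xh; rewrite D0 memv0.
Qed.

(** For u and v in the support, both products lie in the line of degree u + v, so their quotient is
    a scalar matrix and any diagonal entry gives the scalar. *)
Definition corner_beta u v : F := ((X v * X u)^-1 * (X u * X v)) ord0 ord0.

Let D_mul_neq0 u v x y : x \in D u -> y \in D v -> x != 0 -> y != 0 -> x * y != 0.
Proof.
move=> xu yv x0 y0; apply/eqP=> /(congr1 (fun z => x^-1 * z)).
by rewrite mulKr ?mulr0 ?(D_unit xu) // => /eqP; apply/negP.
Qed.

Lemma corner_comm u v x y : x \in D u -> y \in D v ->
  x * y = corner_beta u v *: (y * x).
Proof.
move=> xu yv; have [->|x0] := eqVneq x 0; first by rewrite mul0r mulr0 scaler0.
have [->|y0] := eqVneq y 0; first by rewrite mul0r mulr0 scaler0.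
have Xu0 : X u != 0 by rewrite X_neq0 (corner_suppI xu).
have Xv0 : X v != 0 by rewrite X_neq0 (corner_suppI yv).
have [c cE] : exists c, X u * X v = c *: (X v * X u).
  apply/vlineP; rewrite -(corner_line RC minr (h := u + v)).
  - exact: (corner_grM mulH).
  - by rewrite addrC (corner_grM mulH).
  - exact: (D_mul_neq0 (X_in v) (X_in u)).
have -> : corner_beta u v = c.
  rewrite /corner_beta cE -scalerAr mulVr ?(D_unit (h := v + u)) //.
  - by rewrite -[1]/(1%:M) mxE mxE eqxx mulr1.
  - exact: (corner_grM mulH).
  - exact: (D_mul_neq0 (X_in v) (X_in u)).
have /vlineP[a ->] : x \in <[X u]>%VS by rewrite -(corner_line RC minr (h := u)).
have /vlineP[b ->] : y \in <[X v]>%VS by rewrite -(corner_line RC minr (h := v)).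
rewrite -!scalerAr -!scalerAl cE !scalerA; congr (_ *: _).
by rewrite mulrC mulrA [c * _]mulrC mulrAC [c * _]mulrC.
Qed.

Lemma corner_betaE u v x y c : x \in D u -> y \in D v -> x != 0 -> y != 0 ->
  x * y = c *: (y * x) -> corner_beta u v = c.
Proof.
move=> xu yv x0 y0; rewrite (corner_comm xu yv) => /eqP.
rewrite -subr_eq0 -scalerBl scaler_eq0 subr_eq0.
by rewrite (negPf (D_mul_neq0 yv xu y0 x0)) orbF => /eqP.
Qed.

Lemma corner_beta_neq0 u v :
  u \in corner_supp -> v \in corner_supp -> corner_beta u v != 0.
Proof.
rewrite -!X_neq0 => Xu Xv; apply: contraTneq (D_mul_neq0 (X_in u) (X_in v) Xu Xv).
by move=> b0; rewrite (corner_comm (X_in u) (X_in v)) b0 scale0r eqxx.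
Qed.

Lemma corner_bichar : bichar corner_supp corner_beta.
Proof.
have D1 := corner_gr1 CR0; have n1 := oner_neq0 ('M[F]_m.+1 : nzRingType).
have XD u v : u \in corner_supp -> v \in corner_supp -> X u * X v != 0.
  by rewrite -!X_neq0; apply: D_mul_neq0; apply: X_in.
split.
- split; first exact: (corner_suppI D1 n1).
  move=> u v; rewrite -(X_neq0 u) -(X_neq0 v) => Xu Xv.
  apply: (@corner_suppI (u - v) (X u * (X v)^-1)).
    by rewrite (corner_grM mulH) ?(corner_inv gp mulH RC CR0 minr).
  have iv := corner_inv gp mulH RC CR0 minr (X_in v) Xv.
  by apply: (D_mul_neq0 (X_in u) iv); rewrite // invr_eq0.
- exact: corner_beta_neq0.
- move=> u v w uT vT wT; apply: (corner_betaE (x := X u * X v) (y := X w)).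
  + exact: (corner_grM mulH).
  + exact: X_in.
  + exact: XD.
  + by rewrite X_neq0.
  rewrite -mulrA (corner_comm (X_in v) (X_in w)) -scalerAr mulrA.
  by rewrite (corner_comm (X_in u) (X_in w)) -scalerAl scalerA mulrC mulrA.
- move=> u v w uT vT wT; apply: (corner_betaE (x := X u) (y := X v * X w)).
  + exact: X_in.
  + exact: (corner_grM mulH).
  + by rewrite X_neq0.
  + exact: XD.
  rewrite mulrA (corner_comm (X_in u) (X_in v)) -scalerAl -mulrA.
  by rewrite (corner_comm (X_in u) (X_in w)) -scalerAr scalerA mulrA.
- move=> u uT; apply: (corner_betaE (X_in u) (X_in u)); rewrite ?X_neq0 //.
  by rewrite scale1r.
(* Nondegeneracy: if X u commutes with all components, it is central in the full matrix algebra D,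
   hence scalar, hence of degree 0. *)
move=> u uT u1; have [q gq] := corner_proj gp mulH RC CR0.
have [B|a Xa] := @mx_scalar_cent _ _ (X u).
  rewrite -[X u *m B]/(X u * B) -[B *m X u]/(B * X u) -(gp_sum gq B).
  rewrite mulr_sumr mulr_suml; apply: eq_bigr => h _.
  have [->|qn0] := eqVneq (q h B) 0; first by rewrite mulr0 mul0r.
  rewrite (corner_comm (X_in u) (gp_in gq h B)) u1 ?scale1r //.
  exact: corner_suppI (gp_in gq h B) qn0.
have X0 : X u \in D 0 by rewrite Xa -scalemx1 rpredZ.
apply/eqP/negPn/negP; rewrite eq_sym => u0.
have := uT; rewrite -X_neq0 -(gp_id gq (X_in u)) (gp_0 gq X0 u0).
by rewrite eqxx.
Qed.

Lemma corner_graded_division : is_grading *%R D /\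
  [/\ forall h x, x \in D h -> x != 0 -> x \is a GRing.unit,
      forall h, (D h != 0%VS) = (h \in corner_supp)
    & {in corner_supp, forall t, \dim (D t) = 1%N}].
Proof.
have [q gq] := corner_proj gp mulH RC CR0; split.
  by apply: (graded_proj_is_grading gq); apply: (corner_grM mulH RC).
split; [exact: D_unit|exact: corner_suppP|move=> t; rewrite -X_neq0 => Xt].
by rewrite (corner_line RC minr (X_in t) Xt) dim_vline Xt.
Qed.

(** The components are lines, and they sum to the full algebra of matrices of size m + 1. *)
Lemma corner_supp_card : #|` corner_supp| = (m.+1 ^ 2)%N.
Proof.
have [[[s' [us' s'0 s'T dirs']] _] [_ _ dim1]] := corner_graded_division.
have : \dim (\sum_(h <- s') D h) = (m.+1 ^ 2)%N.
  by rewrite s'T dimvf dim_matrix; apply: mulnn.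
move: dirs'; rewrite directv_seqE => /directvP /= dE.
rewrite (big_nth 0%R) big_mkord dE.
rewrite -(big_mkord xpredT (fun i => \dim (D (nth 0 s' i)))).
rewrite -(big_nth 0%R xpredT (fun h => \dim (D h))) => <-.
have pT : perm_eq corner_supp [seq h <- s' | D h != 0%VS].
  apply: uniq_perm; rewrite ?fset_uniq ?filter_uniq // => h.
  rewrite mem_filter -corner_suppP; case: eqP => //= h0.
  by apply/esym; apply: contra_notT h0 => /s'0.
rewrite (perm_size pT) size_filter -sum1_count [RHS](bigID (fun h => D h != 0%VS)) /=.
rewrite [X in (_ + X)%N]big1 ?addn0 => [|h]; last by rewrite negbK => /eqP->; rewrite dimv0.
by apply: eq_bigr => h; rewrite corner_suppP => /dim1.
Qed.

End CornerDatum.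

Section FrameIso.
Variables (F : fieldType) (N m k : nat).
Variables (V : 'I_k -> 'M[F]_(N, m.+1)) (W : 'I_k -> 'M[F]_(m.+1, N)).
Hypothesis WV : forall i j, W i *m V j = if i == j then 1%:M else 0.
Hypothesis VW : \sum_i V i *m W i = 1%:M.
Local Notation D := 'M[F]_m.+1.

Definition frame_iso (B : 'M[D]_k) : 'M[F]_N :=
  \sum_i \sum_j V i *m B i j *m W j.

Lemma frame_isoE i j B : W i *m frame_iso B *m V j = B i j.
Proof.
rewrite mulmx_sumr mulmx_suml (bigD1 i) //= [X in _ + X]big1 ?addr0 => [|l li].
  rewrite mulmx_sumr mulmx_suml (bigD1 j) //= [X in _ + X]big1 ?addr0 => [|l lj].
    by rewrite !mulmxA WV eqxx mul1mx -mulmxA WV eqxx mulmx1.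
  by rewrite !mulmxA -mulmxA (WV l j) (negPf lj) mulmx0.
rewrite mulmx_sumr mulmx_suml big1 // => j' _.
by rewrite !mulmxA WV eq_sym (negPf li) !mul0mx.
Qed.

Lemma frame_isoK a : frame_iso (\matrix_(i, j) (W i *m a *m V j)) = a.
Proof.
rewrite /frame_iso -[RHS]mulmx1 -[RHS]mul1mx -{1}VW mulmx_suml.
apply: eq_bigr => i _; rewrite -VW !mulmx_sumr.
by apply: eq_bigr => j _; rewrite mxE !mulmxA.
Qed.

Lemma frame_iso_bij : bijective frame_iso.
Proof.
exists (fun a => \matrix_(i, j) (W i *m a *m V j)) => [B|]; last exact: frame_isoK.
by apply/matrixP=> i j; rewrite mxE frame_isoE.
Qed.

Lemma frame_iso_linear (a : F) A B :
  frame_iso (map_mx ( *:%R a) A + B) = a *: frame_iso A + frame_iso B.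
Proof.
rewrite /frame_iso scaler_sumr -big_split; apply: eq_bigr => i _ /=.
rewrite scaler_sumr -big_split; apply: eq_bigr => j _ /=.
by rewrite !mxE mulmxDr mulmxDl -scalemxAr -scalemxAl.
Qed.

Lemma frame_isoM A B : frame_iso (A *m B) = frame_iso A *m frame_iso B.
Proof.
rewrite -[RHS]frame_isoK; congr frame_iso; apply/matrixP=> i j; rewrite !mxE.
have E a b : W i *m (a *m b) *m V j = \sum_l (W i *m a *m V l) *m (W l *m b *m V j).
  rewrite -{1}[a]mulmx1 -VW !(mulmx_sumr, mulmx_suml).
  by apply: eq_bigr => l _; rewrite !mulmxA.
by rewrite E; apply: eq_bigr => l _; rewrite !frame_isoE.
Qed.

Lemma frame_iso_delta i j (d : D) : frame_iso (d *: delta_mx i j) = V i *m d *m W j.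
Proof.
rewrite /frame_iso (bigD1 i) //= [X in _ + X]big1 ?addr0 => [|l li].
  rewrite (bigD1 j) //= [X in _ + X]big1 ?addr0 => [|l lj].
    by rewrite !mxE !eqxx mulr1.
  by rewrite !mxE (negPf lj) andbF mulr0 mulmx0 mul0mx.
by rewrite big1 // => l' _; rewrite !mxE (negPf li) mulr0 mulmx0 mul0mx.
Qed.

(** Each [V i *m W i] has trace m + 1 by cyclicity; characteristic 0 turns the equality of traces
    into one of integers. *)
Lemma frame_size : [pchar F] =i pred0 -> (k * m.+1 = N)%N.
Proof.
move=> charF0; have [char0 _] := pcharf0P F.
have inj a b : a%:R = b%:R :> F -> a = b.
  wlog le_ab : a b / (a <= b)%N => [wl|/eqP].
    by case/orP: (leq_total a b) => le E; [|apply/esym]; apply: wl.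
  rewrite eq_sym -subr_eq0 -natrB // (char0 charF0) subn_eq0 => le_ba.
  by apply/eqP; rewrite eqn_leq le_ab.
apply: inj; rewrite -[RHS]mxtrace1 -VW raddf_sum /=.
under eq_bigr => i _ do rewrite mxtrace_mulC WV eqxx mxtrace1.
by rewrite sumr_const card_ord natrM mulr_natl.
Qed.

End FrameIso.

(** * Gradings of the matrix superalgebra as gradings of M_k(D) *)

Section Structure.
Variables (F : closedFieldType) (charF0 : [pchar F] =i pred0) (G : zmodType) (n : nat).
Local Notation Gs := (G * 'Z_2)%type.
Local Notation N := (n.+1 + n.+1)%N.
Local Notation M := 'M[F]_(n.+1 + n.+1).

(** D is realized as the algebra of all matrices of size m + 1. The degrees [g i] are still in G x
    Z_2; only when T has an odd element can they be moved into G. *)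
Definition structure_of (Gr : G -> {vspace M}) (T : {fset Gs}) beta k m
   (Dc : Gs -> {vspace 'M[F]_m.+1}) (V : 'I_k -> 'M[F]_(N, m.+1))
   (W : 'I_k -> 'M[F]_(m.+1, N)) (g : 'I_k -> Gs) : Prop :=
  [/\ bichar T beta, graded_division T beta Dc, #|` T| = (m.+1 ^ 2)%N,
      1 \in Dc 0 & forall h x, x \in Dc h -> x != 0 -> x^-1 \in Dc (- h)] /\
  [/\ forall i j, W i *m V j = if i == j then 1%:M else 0,
      \sum_i V i *m W i = 1%:M,
      forall i j t d, d \in Dc t -> V i *m d *m W j \in sharp Gr (g i + t - g j)
    & forall i j h a, a \in sharp Gr h -> W i *m a *m V j \in Dc (h - g i + g j)].

Lemma structure_exists Gr : M_grading Gr ->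
  exists T beta k m Dc V W g, @structure_of Gr T beta k m Dc V W g.
Proof.
move=> gr; have [s [p gp]] := sharp_proj gr; have mulH := sharp_mul gr.
have [m [C [R [RC CR0 minr]]]] := hom_idempotent gp mulH (ltn0Sn _).
have [k [V [W [g [[WV Vg Wg] VW]]]]] := hom_frame_full gp mulH RC CR0 minr.
exists (corner_supp (sharp Gr) s C R), (corner_beta (sharp Gr) C R), k, m.
exists (corner_gr (sharp Gr) C R), (fun i : 'I_k => V i), (fun i : 'I_k => W i).
exists (fun i : 'I_k => g i); split; split.
- exact: (corner_bichar gp mulH RC CR0 minr).
- have [gD [uD sD dD]] := corner_graded_division gp mulH RC CR0 minr.
  split=> // u v _ _ x y xu yv; exact: (corner_comm gp mulH RC CR0 minr xu yv).
- exact: (corner_supp_card gp mulH RC CR0 minr).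
- exact: (corner_gr1 CR0).
- by move=> h x; apply: (corner_inv gp mulH RC CR0 minr).
- by move=> i j; rewrite WV //.
- exact: VW.
- move=> i j t d; rewrite corner_grP => dt.
  have -> : V i *m d *m W j = (V i *m R) *m (C *m d *m R) *m (C *m W j).
    by rewrite !mulmxA -(mulmxA _ R) RC mulmx1 -(mulmxA _ R) RC mulmx1.
  by apply: (mulH); [apply: (mulH); rewrite ?Vg|rewrite Wg].
move=> i j h a ah; rewrite corner_grP.
have -> : C *m (W i *m a *m V j) *m R = (C *m W i) *m a *m (V j *m R).
  by rewrite !mulmxA.
by rewrite [h - _]addrC; apply: (mulH); [apply: (mulH); rewrite ?Wg|rewrite Vg].
Qed.

(* By nondegeneracy the restriction of [chi] to T is [beta u] for some u in T;
   then the even matrix [\sum_i chi (g i) *: V_i X_u W_i] implements [chi]. *)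
Lemma structure_even Gr T beta k m Dc V W g :
  @structure_of Gr T beta k m Dc V W g -> M_grading Gr ->
  (forall t, t \in T -> t.2 = 0) -> even_type_I (induced Gr).
Proof.
move=> [[bc gd cT D1 Dinv] [WV VW VdW WaV]] gr Teven; split; first by exists Gr.
move=> chi [chi0 chiD].
have [u uT uE] : exists2 u, u \in T & {in T, forall v, chi v.1 = beta u v}.
  apply: (char_bichar charF0 bc (chi := fun v => chi v.1)).
    by move=> ? _; apply: chi0.
  by move=> v w _ _; apply: chiD.
have [_ uD supp _ comm] := gd; pose X := vpick (Dc u).
have Xu : X \in Dc u by apply: memv_pick.
have X0 : X != 0 by rewrite vpick0 supp.
have Xun : X \is a GRing.unit by apply: (uD u).
pose P := \sum_i chi (g i).1 *: (V i *m X *m W i).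
pose Q := \sum_i (chi (g i).1)^-1 *: (V i *m X^-1 *m W i).
have VXW (a b : 'I_k -> F) (A B : 'M_m.+1) c :
    (\sum_i a i *: (V i *m A *m W i)) *m c *m (\sum_i b i *: (V i *m B *m W i))
    = \sum_i \sum_j (a i * b j) *: (V i *m (A *m (W i *m c *m V j) *m B) *m W j).
  rewrite !mulmx_suml; apply: eq_bigr => i _; rewrite mulmx_sumr; apply: eq_bigr => j _.
  by rewrite -!scalemxAl -scalemxAr scalerA !mulmxA.
have conjP g0 i a : a \in sharp Gr (g0, i) -> P *m a *m Q = chi g0 *: a.
  move=> ah; rewrite VXW -[in RHS](frame_isoK VW a) scaler_sumr.
  apply: eq_bigr => j _; rewrite scaler_sumr; apply: eq_bigr => l _; rewrite mxE.
  (* The entry d has degree t. If it is nonzero, conjugation by X multiplies it by beta u t = chi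
     t.1, and the factors chi (g j) and 1 / chi (g l) turn this into chi g0. *)
  have := WaV j l _ _ ah; set d := W j *m a *m V l; set t := _ + g l => dt.
  have [->|d0] := eqVneq d 0; first by rewrite !(mul0mx, mulmx0) !scaler0.
  have tT : t \in T.
    rewrite -supp; apply: contra d0 => /eqP D0; by rewrite -memv0 -D0.
  have -> : X *m d *m X^-1 = chi t.1 *: d.
    have := comm _ _ uT tT _ _ Xu dt; rewrite -uE // => E.
    by rewrite -[X *m d]/(X * d) E -[_ *m X^-1]/(_ * _) -scalerAl mulrK.
  rewrite -!scalemxAr -scalemxAl scalerA; congr (_ *: _).
  have chiN x : chi (- x) = (chi x)^-1.
    apply: (mulIf (chi0 x)); rewrite mulVf // -chiD addNr.
    by apply: (mulfI (chi0 0)); rewrite -chiD addr0 mulr1.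
  by rewrite /t /= !chiD chiN; field; rewrite !chi0.
have s1 : (1%:M : M) \in sharp Gr 0.
  by have [s [p gp]] := sharp_proj gr; apply: (grade1 gp (sharp_mul gr)).
have PQ : P *m Q = 1%:M.
  rewrite -[P]mulmx1 (conjP 0 0) //.
  have -> : chi 0 = 1 by apply: (mulfI (chi0 0)); rewrite -chiD addr0 mulr1.
  by rewrite scale1r.
have Pu : P \in unitmx by have [] := mulmx1_unit PQ.
have EQ : Q = invmx P by rewrite -[Q]mul1mx -(mulVmx Pu) -mulmxA PQ mulmx1.
(* Each summand has degree u in G x Z_2, and u has parity 0 by hypothesis on T. *)
have P0 : P \in mx_par F n.+1 0.
  rewrite rpred_sum // => i _; rewrite rpredZ //.
  have /memv_capP[_] := VdW i i u X Xu.
  by rewrite addrAC subrr add0r (Teven u uT).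
have Q0 : Q \in mx_par F n.+1 0.
  rewrite rpred_sum // => i _; rewrite rpredZ //.
  have/mx_par0P[A [B PE]] := P0.
  have Xi := Dinv u X Xu X0.
  have /memv_capP[_] := VdW i i (- u) _ Xi.
  by rewrite addrAC subrr add0r /= (Teven u uT) oppr0.
have [f fE] := psl_conj P0 Q0 PQ.
exists f; split; last first.
  by exists P; split=> // x xs; rewrite fE // EQ.
move=> g0 x /memv_imgP[y /memv_capP[yg ys] ->]; rewrite fE //.
rewrite -linearZ /=; congr (psl_pi F _ _).
have := gr.2 g0 => E; move: yg; rewrite [in X in X -> _]E.
case/memv_addP=> [a ag [b bg ->]]; rewrite mulmxDr mulmxDl scalerDr.
by rewrite (conjP g0 0) // (conjP g0 1).
Qed.

(* Multiplying the [V i] of odd degree by an element of degree t0 moves all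
   the [g i] into G. *)
Lemma structure_gamma Gr T beta k m Dc V W g t0 :
  @structure_of Gr T beta k m Dc V W g -> M_grading Gr ->
  t0 \in T -> t0.2 != 0 ->
  [/\ bicharacter_datum T beta, size_condition n T k
    & exists gamma : k.-tuple G, is_Gamma T beta gamma Gr].
Proof.
move=> [[bc gd cT D1 Dinv] [WV VW VdW WaV]] gr t0T t0odd; split.
- by have [? ? ? ? ? ?] := bc; split=> //; exists t0.
- by exists m.+1; rewrite ?cT // (frame_size WV VW charF0) mul2n addnn.
have [_ uD supp _ comm] := gd; pose X := vpick (Dc t0).
have mulD := (gd_grading gd).2.
have Xt : X \in Dc t0 by apply: memv_pick.
have X0 : X != 0 by rewrite vpick0 supp.
have Xun : X \is a GRing.unit by apply: (uD t0).
have Xi := Dinv t0 X Xt X0.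
pose ev i := (g i).2 == 0.
pose Y i : 'M[F]_m.+1 := if ev i then 1 else X.
pose Z i : 'M[F]_m.+1 := if ev i then 1 else X^-1.
pose h i := if ev i then g i else g i + t0.
have h2 i : (h i).2 = 0.
  rewrite /h /ev; have [//|] := eqVneq (g i).2 0.
  case: (Z2P (g i).2) => [->|/= ->]; rewrite ?eqxx // => _.
  by case: (Z2P t0.2) t0odd => -> // _; apply: val_inj.
have ZY i : Z i *m Y i = 1%:M.
  by rewrite /Z /Y; case: (ev i); [rewrite mulmx1|apply: mulVr].
have YZ i : Y i *m Z i = 1%:M.
  by rewrite /Z /Y; case: (ev i); [rewrite mulmx1|apply: mulrV].
have WV' i j : (Z i *m W i) *m (V j *m Y j) = if i == j then 1%:M else 0.
  rewrite !mulmxA -(mulmxA _ (W i)) WV; case: eqVneq => [->|_].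
    by rewrite mulmx1 ZY.
  by rewrite mulmx0 mul0mx.
have VW' : \sum_i (V i *m Y i) *m (Z i *m W i) = 1%:M.
  by rewrite -VW; apply: eq_bigr => i _; rewrite !mulmxA -(mulmxA _ (Y i)) YZ mulmx1.
exists [tuple (h i).1 | i < k]; split=> //.
exists ('M[F]_m.+1 : falgType F), Dc, (frame_iso (fun i => V i *m Y i) (fun i => Z i *m W i)).
split=> //; split.
- exact: frame_iso_bij.
- exact: frame_iso_linear.
- exact: frame_isoM.
move=> i j t d dt; rewrite frame_iso_delta !tnth_mktuple.
suff : (V i *m (Y i *m d *m Z j) *m W j) \in sharp Gr (h i + t - h j).
  rewrite !mulmxA => /memv_capP[]; rewrite /= !h2 add0r subr0 => Ga Gb.
  by rewrite memv_cap Ga Gb.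
pose eY i := if ev i then 0 else t0.
have EY i' : h i' = g i' + eY i' by rewrite /h /eY; case: (ev i'); rewrite ?addr0.
rewrite [X in sharp Gr X](_ : _ = g i + (eY i + t - eY j) - g j); last first.
  by rewrite !EY opprD !addrA [LHS]addrAC.
have mulD' h1 h2' (x y : 'M_m.+1) :
  x \in Dc h1 -> y \in Dc h2' -> x *m y \in Dc (h1 + h2') := @mulD h1 h2' x y.
apply: (VdW i j (eY i + t - eY j) (Y i *m d *m Z j)).
apply: (mulD' _ _ _ _ (mulD' _ _ _ _ _ dt)).
  by rewrite /Y /eY; case: (ev i).
by rewrite /Z /eY; case: (ev j); rewrite ?oppr0.
Qed.

End Structure.

(** * Automorphisms of the even part *)

Section RankOne.
Variables (F : fieldType) (r : nat).
Local Notation M := 'M[F]_r.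

Definition lie (X Y : M) : M := X *m Y - Y *m X.

Definition pair (b : 'rV[F]_r) (a : 'cV[F]_r) : F := (b *m a) 0 0.

Lemma pairE (b : 'rV[F]_r) (a : 'cV[F]_r) : b *m a = (pair b a)%:M :> 'M_1.
Proof. exact: mx11_scalar. Qed.

Lemma mul_outer (a : 'cV[F]_r) (b : 'rV[F]_r) (c : 'cV[F]_r) (d : 'rV[F]_r) :
  (a *m b) *m (c *m d) = pair b c *: (a *m d) :> M.
Proof. by rewrite mulmxA -(mulmxA a) pairE mul_mx_scalar scalemxAl. Qed.

Lemma mul_row_outer (b : 'rV[F]_r) (a : 'cV[F]_r) (d : 'rV[F]_r) : b *m (a *m d) = pair b a *: d.
Proof. by rewrite mulmxA pairE mul_scalar_mx. Qed.

Lemma mul_outer_col (a : 'cV[F]_r) (b : 'rV[F]_r) (c : 'cV[F]_r) : (a *m b) *m c = pair b c *: a.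
Proof. by rewrite -mulmxA pairE mul_mx_scalar. Qed.

Lemma pairZl x b a : pair (x *: b) a = x * pair b a.
Proof. by rewrite /pair -scalemxAl mxE. Qed.

Lemma pairZr x b a : pair b (x *: a) = x * pair b a.
Proof. by rewrite /pair -scalemxAr mxE. Qed.

Lemma tr_outer (a : 'cV[F]_r) (b : 'rV[F]_r) : \tr (a *m b) = pair b a.
Proof. by rewrite mxtrace_mulC pairE mxtrace_scalar mulr1n. Qed.

Lemma outer_neq0 (a : 'cV[F]_r) (b : 'rV[F]_r) :
  (a *m b != 0) = (a != 0) && (b != 0).
Proof.
apply/idP/andP=> [ab|[a0 b0]].
  by split; apply: contra ab => /eqP->; rewrite ?mul0mx ?mulmx0.
have [X] := mx_sandwich a0 b0; rewrite [X]mx11_scalar mul_mx_scalar -scalemxAl.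
by apply: contraNneq => ->; rewrite scaler0.
Qed.

Lemma lie_tr0 X Y : \tr (lie X Y) = 0.
Proof. by rewrite /lie linearB /= mxtrace_mulC subrr. Qed.

Lemma lie_subr X Y a : lie X (Y - a%:M) = lie X Y.
Proof.
rewrite /lie mulmxBr mulmxBl mul_mx_scalar mul_scalar_mx opprB addrA subrK //.
Qed.

Lemma lie_subl X Y a : lie (X - a%:M) Y = lie X Y.
Proof.
rewrite /lie mulmxBr mulmxBl mul_mx_scalar mul_scalar_mx opprB addrA.
by rewrite subrK.
Qed.

(* [a d] and [c b] are orthogonal idempotents; a rank one eigenvector of
   weight 1 for their difference shares its column or its row with [a b]. *)
Lemma weight_one (a c p : 'cV[F]_r) (b d q : 'rV[F]_r) :
  2%:R != 0 :> F -> 3%:R != 0 :> F ->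
  pair d a = 1 -> pair b c = 1 -> pair b a = 0 -> pair d c = 0 ->
  p *m q != 0 -> lie (a *m d - c *m b) (p *m q) = p *m q ->
  pair d p * pair q c = 0 /\
  p *m q = pair d p *: (a *m q) + pair q c *: (p *m b).
Proof.
move=> ch2 ch3 da bc ba dc; rewrite outer_neq0 => /andP[p0 q0].
rewrite /lie mulmxBl mulmxBr !mul_outer.
set al := pair d p; set be := pair b p; set ga := pair q a; set de := pair q c => E.
(* The equation is tested on a and c from the right and on b from the left, then paired with d and
   b. Dividing by 3 gives be * ga = 0, after which dividing by 2 gives ga = 0 and be = 0. *)
have Ea := congr1 (mulmx^~ a) E; have Ec := congr1 (mulmx^~ c) E.
have Eb := congr1 (mulmx b) E.
rewrite /= !mulmxBl -!scalemxAl !mul_outer_col da ba -/ga scale1r scale0r scaler0 subr0 in Ea.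
rewrite /= !mulmxBl -!scalemxAl !mul_outer_col dc bc -/de scale1r scale0r scaler0 sub0r opprK in Ec.
rewrite /= !mulmxBr -!scalemxAr !mul_row_outer ba bc -/be scale0r scaler0 sub0r scale1r in Eb.
have dEa := congr1 (pair d) Ea; have bEa := congr1 (pair b) Ea.
have dEc := congr1 (pair d) Ec; have bEc := congr1 (pair b) Ec.
have pD u (x y : 'cV_r) : pair u (x + y) = pair u x + pair u y.
  by rewrite /pair mulmxDr mxE.
have pN u (x : 'cV_r) : pair u (- x) = - pair u x by rewrite /pair mulmxN mxE.
rewrite !(pD, pN, pairZr) da dc -/al in dEa; rewrite !(pD, pN, pairZr) ba bc -/be in bEa.
rewrite !(pD, pN, pairZr) da dc -/al in dEc; rewrite !(pD, pN, pairZr) ba bc -/be in bEc.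
have alga : al * ga = 0 by rewrite mulrC -dEa; ring.
have bega : be * ga = 0.
  apply: (mulfI ch3); rewrite mulr0.
  transitivity (ga * be - (al * (ga * 0) - be * (ga * 1) - ga * be)); first by ring.
  by rewrite bEa subrr.
have alde : al * de = 0.
  transitivity (al * (de * 1) - be * (de * 0) + de * al - de * al); first by ring.
  by rewrite dEc subrr.
have bede : be * de = 0 by rewrite mulrC -bEc; ring.
have ga0 : ga = 0.
  move: Ea; rewrite !scalerA alga bega !scale0r subrr sub0r => /eqP.
  rewrite eq_sym -subr_eq0 opprK -mulr2n -scaler_nat scalerA scaler_eq0 (negPf p0).
  by rewrite orbF mulf_eq0 (negPf ch2) => /eqP.
have be0 : be = 0.
  move: Eb; rewrite ga0 scale0r sub0r opprK scalerA [de * be]mulrC bede scale0r addr0.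
  move/eqP; rewrite eq_sym -subr_eq0 opprK -mulr2n -scaler_nat scalerA scaler_eq0 (negPf q0).
  by rewrite orbF mulf_eq0 (negPf ch2) => /eqP.
by split=> //; rewrite -E ga0 be0 !scale0r subr0 sub0r opprK.
Qed.

End RankOne.

Section RankOneExtract.
Variables (F : fieldType) (r : nat).
Hypotheses (eigF : has_eigen F) (charF0 : [pchar F] =i pred0).
Local Notation M := 'M[F]_r.

(** Let w be a left eigenvector of X and n = X - l, so w n = 0. If n^2 is nonzero, the double
    bracket of y w is n^2 y w. If n^2 = 0, that of y z is -2 (n y)(z n), and n is nonzero because X
    is traceless and nonzero. *)
Lemma lie_lie_outer (X : M) : \tr X = 0 -> X != 0 ->
  exists Y (u : 'cV_r) (v : 'rV_r), lie X (lie X Y) = u *m v /\ u *m v != 0.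
Proof.
move=> trX X0; have r_gt0 : (0 < r)%N.
  by case: (r) X X0 {trX} => // X /eqP[]; apply/matrixP=> -[].
have [l [w [wX w0]]] := eigF X r_gt0; have [n nE] : exists n, n = X - l%:M by exists (X - l%:M).
have wn : w *m n = 0 by rewrite nE mulmxBr wX mul_mx_scalar subrr.
have lien Y : lie X (lie X Y) = n *m (n *m Y) - n *m Y *m n - n *m Y *m n + Y *m n *m n.
  have ln Z : lie X Z = lie n Z by rewrite nE lie_subl.
  rewrite !ln /lie.
  by rewrite mulmxBr mulmxBl !mulmxA opprB addrA [_ + _ - _]addrAC.
have [nn|nn0] := eqVneq (n *m n) 0.
  have n0 : n != 0.
    apply: contra X0; rewrite nE subr_eq0 => /eqP Xl.
    move: trX; rewrite Xl mxtrace_scalar => /eqP.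
    rewrite -mulr_natr mulf_eq0 (natF_eq0 charF0) (gtn_eqF r_gt0) orbF => /eqP->.
    by rewrite raddf0.
  have [i [j nij]] := mx_neq0 n0.
  pose y : 'cV[F]_r := delta_mx j 0; pose z : 'rV[F]_r := delta_mx 0 i.
  have ny0 : n *m y != 0.
    by rewrite -colE; apply: contra nij => /eqP/colP/(_ i); rewrite !mxE => ->.
  have zn0 : z *m n != 0.
    by rewrite -rowE; apply: contra nij => /eqP/rowP/(_ j); rewrite !mxE => ->.
  exists (y *m z), (- 2%:R *: (n *m y)), (z *m n); split.
    rewrite lien !mulmxA nn !mul0mx sub0r -!mulmxA nn !mulmx0 addr0.
    rewrite -scalemxAl scaleNr scaler_nat mulr2n opprD !mulmxA //.
  rewrite outer_neq0 zn0 andbT scaler_eq0 oppr_eq0 (natF_eq0 charF0) //.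
have [i [j nij]] := mx_neq0 nn0; pose y : 'cV[F]_r := delta_mx j 0.
exists (y *m w), (n *m n *m y), w; split.
  have -> : lie X (lie X (y *m w)) = n *m (n *m (y *m w)).
    rewrite lien -[n *m _ *m n]mulmxA -[y *m w *m n]mulmxA wn.
    by rewrite !(mulmx0, mul0mx) !subr0 addr0.
  by rewrite !mulmxA.
rewrite outer_neq0 w0 andbT -colE.
by apply: contra nij => /eqP/colP/(_ i); rewrite !mxE => ->.
Qed.

Lemma lie_lie_neq0 (X : M) : \tr X = 0 -> X != 0 ->
  exists2 Y, \tr Y = 0 & lie X (lie X Y) != 0.
Proof.
move=> trX X0; have r_gt0 : (0 < r)%N.
  by case: (r) X X0 {trX} => // X /eqP[]; apply/matrixP=> -[].
have [Y [u [v [E uv0]]]] := lie_lie_outer trX X0.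
exists (Y - (\tr Y / r%:R)%:M); last by rewrite lie_subr E.
rewrite linearB /= mxtrace_scalar -[_ / _ *+ _]mulr_natr divfK ?subrr //.
by rewrite (natF_eq0 charF0) -lt0n.
Qed.

(** The double brackets by X all lie on the line of X, and one of them is of rank one by
    [lie_lie_outer]. *)
Lemma extremal_outer (X : M) : \tr X = 0 -> X != 0 ->
  (forall Y, \tr Y = 0 -> exists c, lie X (lie X Y) = c *: X) ->
  exists (u : 'cV_r) (v : 'rV_r), X = u *m v.
Proof.
move=> trX X0 ext; have r_gt0 : (0 < r)%N.
  by case: (r) X X0 {trX ext} => // X /eqP[]; apply/matrixP=> -[].
have [Y [u [v [E uv0]]]] := lie_lie_outer trX X0.
have [|c cE] := ext (Y - (\tr Y / r%:R)%:M).
  rewrite linearB /= mxtrace_scalar -[_ / _ *+ _]mulr_natr divfK ?subrr //.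
  by rewrite (natF_eq0 charF0) -lt0n.
rewrite lie_subr E in cE; exists (c^-1 *: u), v.
have c0 : c != 0 by apply: contra uv0 => /eqP c0; rewrite cE c0 scale0r.
by rewrite -scalemxAl cE scalerA mulVf // scale1r.
Qed.

End RankOneExtract.

Lemma natF2 (F : fieldType) : [pchar F] =i pred0 -> 2%:R != 0 :> F.
Proof. by move=> charF0; rewrite natF_eq0. Qed.

Lemma natF3 (F : fieldType) : [pchar F] =i pred0 -> 3%:R != 0 :> F.
Proof. by move=> charF0; rewrite natF_eq0. Qed.

Section SlAutomorphisms.
Variables (F : fieldType) (charF0 : [pchar F] =i pred0) (n : nat).
Local Notation M := 'M[F]_n.+1.
Local Notation E i j := (delta_mx i j : M).

Lemma lie_delta i j k l :
  lie (E i j) (E k l) = (j == k)%:R *: E i l - (l == i)%:R *: E k j.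
Proof. by rewrite /lie !mul_delta_mx_cond !scaler_nat. Qed.

Lemma tr_delta i j : \tr (E i j) = (i == j)%:R.
Proof.
rewrite -(mul_delta_mx (0 : 'I_1)) tr_outer /pair mul_delta_mx_cond eq_sym.
by rewrite mulmxnE mxE !eqxx.
Qed.

Lemma delta_neq0 i j : E i j != 0.
Proof. by apply/eqP=> /matrixP/(_ i j)/eqP; rewrite !mxE !eqxx oner_eq0. Qed.

Lemma sl_decomp (X : M) : \tr X = 0 ->
  X = \sum_i \sum_j X i j *: (E i j - (i == j)%:R *: E 0 0).
Proof.
move=> trX; under eq_bigr => i _ do under eq_bigr => j _ do rewrite scalerBr.
under eq_bigr => i _ do rewrite sumrB.
rewrite sumrB -matrix_sum_delta -[LHS]subr0; congr (_ - _).
rewrite -[LHS](scale0r (E 0 0)) -trX /mxtrace scaler_suml.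
apply: eq_bigr => i _; rewrite (bigD1 i) //= eqxx scale1r big1 ?addr0 // => j.
by rewrite eq_sym => /negPf->; rewrite scale0r scaler0.
Qed.

(** The E_0j and E_j0 with j nonzero generate sl as a Lie algebra, since the bracket of E_i0 and
    E_0j is E_ij, minus E_00 when i = j. *)
Lemma sl_ind (good : M -> Prop) :
  (forall a X Y, good X -> good Y -> good (a *: X + Y)) -> good 0 ->
  (forall X Y, \tr X = 0 -> \tr Y = 0 -> good X -> good Y -> good (lie X Y)) ->
  (forall j, j != 0 -> good (E 0 j) /\ good (E j 0)) ->
  forall X, \tr X = 0 -> good X.
Proof.
move=> goodD good0 goodL goodE X /sl_decomp->.
have good_sum I r (f : I -> M) : (forall i, good (f i)) -> good (\sum_(i <- r) f i).
  move=> gf; elim/big_ind: _ => // A B gA gB.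
  by rewrite -[A]scale1r; apply: goodD.
apply: (good_sum) => i; apply: (good_sum) => j; rewrite -[_ *: _]addr0.
apply: (goodD) => //.
have [->|i0] := eqVneq i 0; have [->|j0] := eqVneq j 0.
- by rewrite ?eqxx scale1r subrr.
- by rewrite ?[0 == j]eq_sym ?(negPf j0) scale0r subr0; have [] := goodE j j0.
- by rewrite ?(negPf i0) scale0r subr0; have [] := goodE i i0.
have -> : E i j - (i == j)%:R *: E 0 0 = lie (E i 0) (E 0 j).
  by rewrite lie_delta eqxx scale1r eq_sym.
have [_ gi] := goodE i i0; have [gj _] := goodE j j0.
by apply: goodL; rewrite // tr_delta ?(negPf i0) // eq_sym (negPf j0).
Qed.

(** Preservation of nonzero rank one nilpotents, in [sm_outer], takes the place of bijectivity; it
    is what [pa_outer] will supply. *)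
Record sl_morph (phi : {linear M -> M}) : Prop := {
  sm_tr : forall X, \tr X = 0 -> \tr (phi X) = 0;
  sm_lie : forall X Y, \tr X = 0 -> \tr Y = 0 ->
    phi (lie X Y) = lie (phi X) (phi Y);
  sm_outer : forall (u : 'cV_n.+1) (v : 'rV_n.+1), pair v u = 0 -> u *m v != 0 ->
    phi (u *m v) != 0 /\
    exists (u' : 'cV_n.+1) (v' : 'rV_n.+1), phi (u *m v) = u' *m v' }.

Section Morph.
Variables (phi : {linear M -> M}) (sm : sl_morph phi).

Let tr0 i : i != 0 -> \tr (E 0 i) = 0.
Proof. by rewrite tr_delta eq_sym => /negPf->. Qed.
Let tr0' i : i != 0 -> \tr (E i 0) = 0.
Proof. by rewrite tr_delta => /negPf->. Qed.

Lemma sm_delta i j : i != j ->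
  phi (E i j) != 0 /\ exists (u : 'cV_n.+1) (v : 'rV_n.+1), phi (E i j) = u *m v.
Proof.
move=> ij; rewrite -(mul_delta_mx (0 : 'I_1)); apply: (sm_outer sm).
  by rewrite -tr_outer mul_delta_mx tr_delta (negPf ij).
by rewrite mul_delta_mx delta_neq0.
Qed.

(** The sl_2 relation [[E_0j, E_j0], E_0j] = 2 E_0j forces the product of [pair d a] and [pair b c]
    to be 1; rescaling c against d makes both equal to 1. *)
Lemma sm_frame j (a : 'cV_n.+1) (b : 'rV_n.+1) : j != 0 -> phi (E 0 j) = a *m b ->
  exists c d, phi (E j 0) = c *m d /\
    [/\ pair b a = 0, pair d c = 0, pair d a = 1 & pair b c = 1].
Proof.
move=> j0 Eab; have [_ [c [d Ecd]]] := sm_delta j0.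
have ba : pair b a = 0 by rewrite -tr_outer -Eab (sm_tr sm) ?tr0.
have dc : pair d c = 0 by rewrite -tr_outer -Ecd (sm_tr sm) ?tr0'.
have j0' : 0 != j by rewrite eq_sym.
have ab0 : a *m b != 0 by rewrite -Eab; have [] := sm_delta j0'.
have : lie (lie (a *m b) (c *m d)) (a *m b) = 2%:R *: (a *m b).
  rewrite -Eab -Ecd -!(sm_lie sm) ?tr0 ?tr0' ?lie_tr0 // -linearZ /=; congr (phi _).
  rewrite lie_delta !eqxx !scale1r /lie mulmxBl mulmxBr !mul_delta_mx.
  rewrite mul_delta_mx_0 // mul_delta_mx_0 // subr0 sub0r opprK.
  by rewrite scaler_nat mulr2n.
rewrite /lie !mul_outer mulmxBl mulmxBr -!scalemxAl -!scalemxAr !mul_outer.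
rewrite !scalerA ba !(mulr0, scale0r, subr0, sub0r) opprK [pair d a * _]mulrC -mulr2n.
rewrite -scaler_nat scalerA => /eqP; rewrite -subr_eq0 -scalerBl scaler_eq0.
rewrite (negPf ab0) orbF subr_eq0 -[X in _ == X]mulr1.
rewrite (inj_eq (mulfI _)) ?(natF_eq0 charF0) // => /eqP bcda.
have da0 : pair d a != 0.
  by apply/eqP=> da0; move/eqP: bcda; rewrite da0 mulr0 eq_sym oner_eq0.
exists (pair d a *: c), ((pair d a)^-1 *: d).
rewrite Ecd -scalemxAl -scalemxAr scalerA mulfV // scale1r; split=> //.
split; rewrite ?pairZl ?pairZr ?dc ?mulr0 //; first by rewrite mulVf.
by rewrite mulrC.
Qed.

(** [a *m d - c *m b] is the image of E_00 - E_jj, for which E_0k has weight 1 and E_k0 weight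
    -1. *)
Lemma weight_delta j k a b c d : j != 0 -> phi (E 0 j) = a *m b ->
  phi (E j 0) = c *m d -> pair d a = 1 -> pair b c = 1 ->
  k != 0 -> k != j ->
  lie (a *m d - c *m b) (phi (E 0 k)) = phi (E 0 k) /\
  lie (c *m b - a *m d) (phi (E k 0)) = phi (E k 0).
Proof.
move=> j0 Eab Ecd da bc k0 kj.
have EH : a *m d - c *m b = phi (lie (E 0 j) (E j 0)).
  by rewrite (sm_lie sm) ?tr0 ?tr0' // Eab Ecd /lie !mul_outer da bc !scale1r.
have HE : lie (E 0 j) (E j 0) = E 0 0 - E j j.
  by rewrite lie_delta !eqxx !scale1r.
have jk : j != k by rewrite eq_sym.
split.
  rewrite EH -(sm_lie sm) ?lie_tr0 ?tr0 // HE; congr (phi _).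
  rewrite /lie mulmxBl mulmxBr mul_delta_mx !mul_delta_mx_0 //.
  by rewrite !subr0.
rewrite -opprB EH -linearN -(sm_lie sm) ?tr0' //; last first.
  by rewrite linearN /= lie_tr0 oppr0.
congr (phi _); rewrite HE opprB /lie mulmxBl mulmxBr !mul_delta_mx !mul_delta_mx_0 //.
  by rewrite !subr0 !sub0r opprK.
- by rewrite eq_sym.
by rewrite eq_sym.
Qed.

(** With a common column a, the images of the generators provide dual bases: a and the c j are the
    columns of P, while d and the q j are the rows of its inverse. *)
Lemma sm_conj (a : 'cV[F]_n.+1) (j1 : 'I_n.+1) : j1 != 0 ->
  (forall j, j != 0 -> exists q, phi (E 0 j) = a *m q) ->
  exists2 P, P \in unitmx & forall X, \tr X = 0 -> phi X = P *m X *m invmx P.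
Proof.
move=> j10 Ea.
have [q Eq] : exists q, forall j, j != 0 -> phi (E 0 j) = a *m q j.
  apply: (@fin_all_exists 'I_n.+1 (fun=> 'rV[F]_n.+1)
     (fun j q => j != 0 -> phi (E 0 j) = a *m q)) => j.
  by have [->|/Ea[v ?]] := eqVneq j 0; [exists 0|exists v].
have [d [c1 [Ed1 [qa1 dc1 da qc1]]]] : exists d c1, phi (E j1 0) = c1 *m d /\
    [/\ pair (q j1) a = 0, pair d c1 = 0, pair d a = 1 & pair (q j1) c1 = 1].
  by have [c1 [d Hd]] := sm_frame j10 (Eq _ j10); exists d, c1.
have [c Ec] : exists c, forall j, j != 0 -> phi (E j 0) = c j *m d /\
   [/\ pair (q j) a = 0, pair d (c j) = 0 & pair (q j) (c j) = 1].
  apply: (@fin_all_exists 'I_n.+1 (fun=> 'cV[F]_n.+1)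
     (fun j x => j != 0 -> phi (E j 0) = x *m d /\ [/\ pair (q j) a = 0,
       pair d x = 0 & pair (q j) x = 1])) => j.
  have [->|j0] := eqVneq j 0; first by exists 0.
  have [->|jj1] := eqVneq j j1; first by exists c1.
  have [cj [dj [Edj [qaj dcj daj qcj]]]] := sm_frame j0 (Eq _ j0).
  (* In [weight_one] the roles of the two idempotents are exchanged. As [pair dj a] is 1, the
     conclusion forces the row of the image of E_j0 to be the d already chosen for j1. *)
  have [_ wj] := weight_delta j10 (Eq _ j10) Ed1 da qc1 j0 jj1.
  have cdj0 : cj *m dj != 0 by rewrite -Edj; have [] := sm_delta j0.
  have [|al0 cdE] := weight_one (natF2 charF0) (natF3 charF0) qc1 da dc1 qa1 cdj0.
    by rewrite -Edj.
  move: al0 cdE; rewrite daj mulr1 scale1r => -> cdE; exists cj => _.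
  rewrite scale0r add0r in cdE; split; first by rewrite Edj cdE.
  split=> //; rewrite -tr_outer -cdE -Edj; exact: (sm_tr sm) (tr0' j0).
have qc j k : j != 0 -> k != 0 -> pair (q j) (c k) = (j == k)%:R.
  move=> j0 k0; have [<-|jk] := eqVneq j k; first by have [_ []] := Ec j j0.
  have [Ej [qaj dcj qcj]] := Ec j j0; have [Ek [_ dck _]] := Ec k k0.
  have kj : k != j by rewrite eq_sym.
  have [_] := weight_delta j0 (Eq _ j0) Ej da qcj k0 kj.
  rewrite Ek /lie mulmxBl mulmxBr !mul_outer dck da dcj.
  rewrite !scale0r scale1r subr0 sub0r opprK => /eqP.
  rewrite -subr_eq0 addrK scaler_eq0 -Ej => /orP[/eqP//|].
  by have [/negPf->] := sm_delta j0.
pose P := \matrix_(i, j) (if j == 0 then a i 0 else c j i 0).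
pose Q := \matrix_(i, j) (if i == 0 then d 0 j else q i 0 j).
have colP j : col j P = if j == 0 then a else c j.
  by apply/colP=> i; rewrite !mxE; case: eqP.
have rowQ i : row i Q = if i == 0 then d else q i.
  by apply/rowP=> j; rewrite !mxE; case: eqP.
have QP : Q *m P = 1%:M.
  apply/matrixP=> i j; rewrite -[LHS](_ : pair (row i Q) (col j P) = _); last first.
    by rewrite /pair !mxE; apply: eq_bigr => l _; rewrite !mxE.
  rewrite colP rowQ [RHS]mxE.
  have [Ei|i0] := eqVneq i 0; have [Ej|j0] := eqVneq j 0.
  - by rewrite da Ei Ej eqxx.
  - by have [_ [_ -> _]] := Ec j j0; rewrite Ei eq_sym (negPf j0).
  - by have [_ [-> _ _]] := Ec i i0; rewrite Ej (negPf i0).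
  - exact: qc.
have PQ : P *m Q = 1%:M := mulmx1C QP.
have Pu : P \in unitmx by have [] := mulmx1_unit PQ.
have QE : invmx P = Q by rewrite -[Q]mul1mx -(mulVmx Pu) -mulmxA PQ mulmx1.
exists P => //; rewrite QE.
have PE i j : P *m E i j *m Q = col i P *m row j Q.
  by rewrite -(mul_delta_mx (0 : 'I_1)) !mulmxA -mulmxA -rowE -colE.
pose good X := phi X = P *m X *m Q.
have good_lie X Y : \tr X = 0 -> \tr Y = 0 -> good X -> good Y -> good (lie X Y).
  rewrite /good => X0 Y0 gX gY; rewrite (sm_lie sm) // gX gY /lie mulmxBr mulmxBl.
  have QPc (A B : M) : P *m A *m Q *m (P *m B *m Q) = P *m (A *m B) *m Q.
    by rewrite !mulmxA -(mulmxA _ Q) QP mulmx1.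
  by rewrite !QPc.
have good0 j : j != 0 -> good (E 0 j).
  by move=> j0; rewrite /good PE colP rowQ eqxx (negPf j0) Eq.
have good0' j : j != 0 -> good (E j 0).
  by move=> j0; rewrite /good PE colP rowQ eqxx (negPf j0); have [-> _] := Ec j j0.
apply: (sl_ind (good := good)) => [b X Y||//|j j0].
- by rewrite /good linearP => -> ->; rewrite mulmxDr mulmxDl -scalemxAr -scalemxAl.
- by rewrite /good raddf0 mulmx0 mul0mx.
by split; [apply: good0|apply: good0'].
Qed.

End Morph.

Definition opp_tr (phi : {linear M -> M}) (X : M) : M := - (phi X)^T.

Lemma opp_tr_linear phi : linear (opp_tr phi).
Proof. by move=> a X Y; rewrite /opp_tr linearP linearP opprD scalerN. Qed.

HB.instance Definition _ phi :=
  GRing.isLinear.Build F M M _ (opp_tr phi) (opp_tr_linear phi).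

Lemma opp_tr_sl_morph (phi : {linear M -> M}) :
  sl_morph phi -> sl_morph (opp_tr phi).
Proof.
move=> sm; split.
- by move=> X X0; rewrite /= /opp_tr linearN /= mxtrace_tr (sm_tr sm) ?oppr0.
- move=> X Y X0 Y0; rewrite /= /opp_tr (sm_lie sm) // /lie.
  by rewrite !mulNmx !mulmxN !opprK linearB /= !trmx_mul opprB.
move=> u v vu uv; have [p0 [u' [v' E]]] := sm_outer sm vu uv; split.
  by rewrite /= /opp_tr oppr_eq0 trmx_eq0.
by exists (- v'^T), u'^T; rewrite /= /opp_tr E trmx_mul mulNmx.
Qed.

(** The images of the E_0k either all share the column a of the first one or all share its row b;
    [opp_tr] reduces the second case to the first. *)
Lemma sl_morph_aut (phi : {linear M -> M}) (j1 : 'I_n.+1) : j1 != 0 ->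
  sl_morph phi -> exists2 P, P \in unitmx &
    (forall X, \tr X = 0 -> phi X = P *m X *m invmx P) \/
    (forall X, \tr X = 0 -> phi X = - (P *m X^T *m invmx P)).
Proof.
move=> j10 sm; have j10' : 0 != j1 by rewrite eq_sym.
have [_ [a [b Eab]]] := sm_delta sm j10'.
have [c [d [Ecd [ba dc da bc]]]] := sm_frame sm j10 Eab.
have [col|ncol] := classic (forall j, j != 0 -> exists q, phi (E 0 j) = a *m q).
  by have [P Pu PE] := sm_conj sm j10 col; exists P => //; left.
have [j [j0 jncol]] : exists j, j != 0 /\ ~ exists q, phi (E 0 j) = a *m q.
  apply: NNPP => no; apply: ncol => j j0; apply: NNPP => nq.
  by apply: no; exists j.
have weight (p : 'cV_n.+1) (q : 'rV_n.+1) : p *m q != 0 ->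
    lie (a *m d - c *m b) (p *m q) = p *m q ->
    (exists q', p *m q = a *m q') \/ (exists p', p *m q = p' *m b).
  move=> pq0 /(weight_one (natF2 charF0) (natF3 charF0) da bc ba dc pq0)[/eqP].
  rewrite mulf_eq0 => /orP[]/eqP-> ->; [right; exists (pair q c *: p)|left].
    by rewrite scale0r add0r scalemxAl.
  by exists (pair d p *: q); rewrite scale0r addr0 scalemxAr.
have wk k : k != 0 -> k != j1 -> lie (a *m d - c *m b) (phi (E 0 k)) = phi (E 0 k).
  by move=> k0 kj; have [] := weight_delta sm j10 Eab Ecd da bc k0 kj.
have jj1 : j != j1.
  by apply/eqP=> jj1; apply: jncol; exists b; rewrite jj1.
have [p Ep] : exists p, phi (E 0 j) = p *m b.
  have j0' : 0 != j by rewrite eq_sym.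
  have [n0 [u [v Euv]]] := sm_delta sm j0'.
  have [||//|] := weight u v; rewrite -?Euv //; first exact: wk.
have row k : k != 0 -> exists p, phi (E 0 k) = p *m b.
  move=> k0; have [->|kj1] := eqVneq k j1; first by exists a.
  have [->|kj] := eqVneq k j; first by exists p.
  have k0' : 0 != k by rewrite eq_sym.
  have [n0 [u [v Euv]]] := sm_delta sm k0'.
  have [||[q Eq]|//] := weight u v; rewrite -?Euv //; first exact: wk.
  (* E_0j + E_0k is also of rank one and weight 1, so its image has column a or row b. Column a
     would force the same for E_0j, which was excluded. *)
  pose x : 'cV[F]_n.+1 := delta_mx 0 0.
  pose y : 'rV[F]_n.+1 := delta_mx 0 j + delta_mx 0 k.
  have xy : x *m y = E 0 j + E 0 k by rewrite mulmxDr !mul_delta_mx.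
  have yx : pair y x = 0.
    by rewrite -tr_outer xy linearD /= !tr_delta [0 == j]eq_sym [0 == k]eq_sym
       (negPf j0) (negPf k0) addr0.
  have xy0 : x *m y != 0.
    rewrite xy; apply/eqP=> /matrixP/(_ 0 j)/eqP; rewrite !mxE !eqxx.
    by rewrite [j == k]eq_sym (negPf kj) addr0 oner_eq0.
  have [n1 [u' [v' E']]] := sm_outer sm yx xy0.
  have Ejk : u' *m v' = p *m b + a *m q by rewrite -E' xy linearD /= Ep Euv -Eq.
  have [||[q' Eq']|[p' Ep']] := weight u' v'; rewrite -?E' //.
  - have lieD (X Y Z : M) : lie X (Y + Z) = lie X Y + lie X Z.
      by rewrite /lie mulmxDr mulmxDl opprD addrACA.
    by rewrite xy linearD /= lieD !wk.
  - by case: jncol; exists (q' - q); rewrite Ep mulmxBr -Eq' Ejk addrK.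
  by exists (p' - p); rewrite mulmxBl -Ep' Ejk Euv Eq addrC addKr.
have [|P Pu PE] := sm_conj (opp_tr_sl_morph sm) (a := b^T) j10.
  move=> k k0; have [p' Ep'] := row k k0; exists (- p'^T).
  by rewrite /= /opp_tr Ep' trmx_mul mulmxN.
exists (invmx P)^T; first by rewrite unitmx_tr unitmx_inv.
right=> X X0; have := PE X X0; rewrite /= /opp_tr => /(congr1 (fun Z => - Z^T)).
rewrite linearN /= trmxK opprK => ->; congr (- _).
by rewrite !trmx_mul mulmxA trmx_inv invmxK.
Qed.

End SlAutomorphisms.

(** * The traceless complement of the scalars in sl and its symmetries *)

Section Traceless.
Variables (F : fieldType) (charF0 : [pchar F] =i pred0) (r : nat).
Local Notation M := 'M[F]_(r + r).
Local Notation par := (@mx_par F r).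
Local Notation sl := (sl F r).

Definition ev (X Y : 'M[F]_r) : M := block_mx X 0 0 Y.
Definition od (B C : 'M[F]_r) : M := block_mx 0 B C 0.

Lemma ev_par X Y : ev X Y \in par 0.
Proof. by apply/mx_par0P; exists X, Y. Qed.

Lemma od_par B C : od B C \in par 1.
Proof. by apply/mx_par1P; exists B, C. Qed.

Lemma par0_ev x : x \in par 0 -> exists X Y, x = ev X Y.
Proof. by move/mx_par0P. Qed.

Lemma par1_od x : x \in par 1 -> exists B C, x = od B C.
Proof. by move/mx_par1P. Qed.

Lemma evD a X Y X' Y' : ev (a *: X + X') (a *: Y + Y') = a *: ev X Y + ev X' Y'.
Proof. by rewrite /ev scale_block_mx add_block_mx !scaler0 !addr0. Qed.

Lemma odD a X Y X' Y' : od (a *: X + X') (a *: Y + Y') = a *: od X Y + od X' Y'.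
Proof. by rewrite /od scale_block_mx add_block_mx !scaler0 !addr0. Qed.

Lemma ev_inj X Y X' Y' : ev X Y = ev X' Y' -> X = X' /\ Y = Y'.
Proof. by case/eq_block_mx. Qed.

Lemma od_inj X Y X' Y' : od X Y = od X' Y' -> X = X' /\ Y = Y'.
Proof. by case/eq_block_mx. Qed.

Lemma ev0 : ev 0 0 = 0. Proof. exact: block_mx0. Qed.
Lemma od0 : od 0 0 = 0. Proof. exact: block_mx0. Qed.

Definition blockE := (block_mxKul, block_mxKur, block_mxKdl, block_mxKdr).

Lemma scomm_ev X Y X' Y' : scomm (ev X Y) (ev X' Y') = ev (lie X X') (lie Y Y').
Proof.
by rewrite scomm_block /ev !blockE !(mul0mx, mulmx0, subrr, addr0).
Qed.

Lemma scomm_ev_od X Y B C :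
  scomm (ev X Y) (od B C) = od (X *m B - B *m Y) (Y *m C - C *m X).
Proof.
by rewrite scomm_block /ev /od !blockE !(mul0mx, mulmx0, subrr, addr0).
Qed.

Lemma scomm_od B C B' C' :
  scomm (od B C) (od B' C') = ev (B *m C' + B' *m C) (C *m B' + C' *m B).
Proof.
by rewrite scomm_block /ev /od !blockE !(mul0mx, mulmx0, oppr0, add0r, addr0).
Qed.

Definition inL (x : M) : Prop := x \in sl /\ \tr x = 0.

Lemma inL_ev X Y : inL (ev X Y) <-> \tr X = 0 /\ \tr Y = 0.
Proof.
rewrite /inL /ev mxtrace_block; split=> [[/slP]|[X0 Y0]].
  rewrite /str !blockE => /eqP; rewrite subr_eq0 => /eqP-> /eqP.
  rewrite -mulr2n -mulr_natr mulf_eq0 (negPf (natF2 charF0)) orbF => /eqP->.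
  by [].
by split; [apply/slP; rewrite /str !blockE X0 Y0 subrr|rewrite X0 Y0 addr0].
Qed.

Lemma inL_od B C : inL (od B C).
Proof.
split; last by rewrite /od mxtrace_block !linear0 addr0.
by apply/slP; rewrite /str /od !blockE !linear0 subrr.
Qed.

(** Projects along the scalars; applied to the supercommutator it gives the bracket of psl on this
    complement. *)
Definition Lproj (x : M) : M := x - (\tr x / (r + r)%:R) *: 1%:M.

Lemma Lproj_linear : linear Lproj.
Proof.
move=> a x y; rewrite /Lproj linearP /= mulrDl scalerDl opprD addrACA scalerBr.
by rewrite scalerA mulrA.
Qed.

Lemma Lproj_id x : \tr x = 0 -> Lproj x = x.
Proof. by move=> x0; rewrite /Lproj x0 mul0r scale0r subr0. Qed.

Lemma Lproj_inL x : (0 < r)%N -> x \in sl -> inL (Lproj x).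
Proof.
move=> r0 xs; split; first by rewrite rpredB ?rpredZ ?sl1.
rewrite /Lproj linearB linearZ /= mxtrace1 divfK ?subrr //.
by rewrite natF_eq0 // addn_eq0 negb_and -lt0n r0.
Qed.

(* Morphisms for the bracket of psl transported to the complement [inL] of the
   scalars in sl. *)
Record psl_auto (Fm : {linear M -> M}) : Prop := {
  pa_L : forall x, inL x -> inL (Fm x);
  pa_par : forall i x, inL x -> x \in par i -> Fm x \in par i;
  pa_br : forall x y, inL x -> inL y ->
    Fm (Lproj (scomm x y)) = Lproj (scomm (Fm x) (Fm y));
  pa_inj : forall x, inL x -> Fm x = 0 -> x = 0;
  pa_surj : forall i y, inL y -> y \in par i ->
    exists x, [/\ inL x, x \in par i & Fm x = y] }.

(** For e = true this is the opposite of a superalgebra antiautomorphism, whence the signs on 1 and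
    on traces. The supertrace does not follow this rule: odd conjugations have e = false but change
    its sign. *)
Record nice (e : bool) (Psi : 'End(M)) : Prop := {
  nc_type : lie_type e Psi;
  nc_1 : Psi 1%:M = (-1) ^+ e *: 1%:M;
  nc_tr : forall x, \tr (Psi x) = (-1) ^+ e * \tr x;
  nc_inv : exists Psi' : 'End(M), [/\ cancel Psi Psi', cancel Psi' Psi &
    forall i x, x \in par i -> Psi' x \in par i] }.

Lemma nc_scomm e Psi : nice e Psi -> forall x y, Psi (scomm x y) = scomm (Psi x) (Psi y).
Proof. by case=> /lie_type_scomm. Qed.

Lemma nc_L e Psi x : nice e Psi -> inL x -> inL (Psi x).
Proof.
move=> nc [xs x0]; split; last by rewrite (nc_tr nc) x0 mulr0.
exact: (scomm_morph_sl (nc_scomm nc)).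
Qed.

Lemma nc_Lproj e Psi x : nice e Psi -> Psi (Lproj x) = Lproj (Psi x).
Proof.
move=> nc; rewrite /Lproj linearB linearZ /= (nc_1 nc) (nc_tr nc) scalerA.
by congr (_ - _ *: _); rewrite mulrC mulrA.
Qed.

Lemma nice_comp e e' Psi Psi' : nice e Psi -> nice e' Psi' ->
  nice (e' (+) e) (Psi' \o Psi)%VF.
Proof.
move=> [[pp pm] p1 pt [Pi [PK PiK Pip]]] [[pp' pm'] p1' pt' [Pi' [PK' PiK' Pip']]]; split.
- split=> [i x xi|i j x y xi yj]; rewrite !comp_lfunE.
    by apply: pp'; apply: pp.
  rewrite (pm _ _ _ _ xi yj); case: e p1 pt pm => /= _ _ _.
    rewrite linearZ /= (pm' j i) ?pp // mulnC; case: (e') => /=.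
      rewrite !scaleNr scalerN opprK scalerA -expr2 sqrr_sign scale1r //.
    by rewrite scaleNr.
  by rewrite (pm' i j) ?pp //; case: (e').
- by rewrite comp_lfunE p1 linearZ /= p1' scalerA -signr_addb addbC.
- by move=> x; rewrite comp_lfunE pt' pt mulrA -signr_addb.
exists (Pi \o Pi')%VF; split=> [x|x|i x xi]; rewrite !comp_lfunE.
- by rewrite PK' PK.
- by rewrite PiK PiK'.
by apply: Pip; apply: Pip'.
Qed.

Lemma psl_auto_comp e Psi (Fm : {linear M -> M}) : nice e Psi -> psl_auto Fm ->
  psl_auto (Psi \o Fm).
Proof.
move=> nc pa; have [[pp _] _ pt [Pi [PK PiK Pip]]] := nc; split=> /=.
- by move=> x xL; apply: (nc_L nc); apply: (pa_L pa).
- by move=> i x xL xi; apply: pp; apply: (pa_par pa).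
- move=> x y xL yL; rewrite (pa_br pa) // (nc_Lproj _ nc) (nc_scomm nc) //.
- move=> x xL /(congr1 Pi); rewrite PK linear0; exact: (pa_inj pa).
move=> i y yL yi; have [||x [xL xi xE]] := pa_surj pa (i := i) (y := Pi y).
- split; last first.
    apply: (mulfI (x := (-1) ^+ e)); first by rewrite signr_eq0.
    rewrite mulr0 -pt PiK; by case: yL.
  apply: scomm_morph_sl yL.1 => a b; apply: (can_inj PK).
  by rewrite (nc_scomm nc) !PiK.
- exact: Pip.
by exists x; split; rewrite // xE PiK.
Qed.

Lemma nice_lconj (P Q : M) : P *m Q = 1%:M ->
  (forall i x, x \in par i -> lconj P Q x \in par i) -> nice false (lconj P Q).
Proof.
move=> PQ pp; have QP := mulmx1C PQ.
have PK := lconjK PQ; have QK := lconjK QP.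
split.
- split=> // i j x y xi yj; rewrite !lconjE.
  by rewrite !mulmxA -(mulmxA _ Q) QP mulmx1.
- by rewrite lconjE mulmx1 PQ scale1r.
- by move=> x; rewrite lconjE mxtrace_mulC mulmxA QP mul1mx mul1r.
exists (lconj Q P); split=> // i x xi; set y := lconj Q P x.
suff -> : y = mx_part i y by apply: mx_part_par.
apply: (can_inj PK); rewrite QK.
have /mx_parP {1}<- := xi; rewrite -{1}(QK x) -/y.
have yE : y = mx_part 0 y + mx_part 1 y by rewrite mx_part_sum.
have p0 := pp _ _ (mx_part_par 0 y); have p1 := pp _ _ (mx_part_par 1 y).
rewrite {1}yE !linearD /=.
case: (Z2P i) => ->.
  have /mx_parP -> := p0; rewrite (mx_part_neq p1) ?addr0 //.
by have /mx_parP -> := p1; rewrite (mx_part_neq p0) ?add0r.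
Qed.

Lemma nice_conj i (P Q : M) : P \in par i -> Q \in par i -> P *m Q = 1%:M ->
  nice false (lconj P Q).
Proof.
move=> Pi Qi PQ; apply: nice_lconj => // j x xj; rewrite lconjE.
have -> : j = i + j + i.
  by case: (Z2P i) => ->; case: (Z2P j) => ->; apply: val_inj.
by apply: mx_parM => //; apply: mx_parM.
Qed.

(* The opposite of the supertranspose. *)
Definition nst (x : M) : M :=
  block_mx (- (ulsubmx x)^T) (- (dlsubmx x)^T) ((ursubmx x)^T) (- (drsubmx x)^T).

Definition nst_inv (x : M) : M :=
  block_mx (- (ulsubmx x)^T) ((dlsubmx x)^T) (- (ursubmx x)^T) (- (drsubmx x)^T).

Lemma nst_linear : linear nst.
Proof.
move=> a x y; rewrite /nst scale_block_mx add_block_mx.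
by congr block_mx; apply/matrixP=> i j; rewrite !mxE; ring.
Qed.

Lemma nst_inv_linear : linear nst_inv.
Proof.
move=> a x y; rewrite /nst_inv scale_block_mx add_block_mx.
by congr block_mx; apply/matrixP=> i j; rewrite !mxE; ring.
Qed.

HB.instance Definition _ := GRing.isLinear.Build F M M _ nst nst_linear.
HB.instance Definition _ := GRing.isLinear.Build F M M _ nst_inv nst_inv_linear.

Lemma nst_ev X Y : nst (ev X Y) = ev (- X^T) (- Y^T).
Proof. by rewrite /nst /ev !blockE !trmx0 oppr0. Qed.

Lemma nst_od B C : nst (od B C) = od (- C^T) (B^T).
Proof. by rewrite /nst /od !blockE !trmx0 oppr0. Qed.

Lemma mul_ev X Y X' Y' : ev X Y *m ev X' Y' = ev (X *m X') (Y *m Y').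
Proof. by rewrite mulmx_block !(mul0mx, mulmx0, addr0, add0r). Qed.
Lemma mul_ev_od X Y B C : ev X Y *m od B C = od (X *m B) (Y *m C).
Proof. by rewrite mulmx_block !(mul0mx, mulmx0, addr0, add0r). Qed.
Lemma mul_od_ev X Y B C : od B C *m ev X Y = od (B *m Y) (C *m X).
Proof. by rewrite mulmx_block !(mul0mx, mulmx0, addr0, add0r). Qed.
Lemma mul_od B C B' C' : od B C *m od B' C' = ev (B *m C') (C *m B').
Proof. by rewrite mulmx_block !(mul0mx, mulmx0, addr0, add0r). Qed.
Lemma oppev X Y : - ev X Y = ev (- X) (- Y).
Proof. by rewrite /ev opp_block_mx oppr0. Qed.
Lemma oppod X Y : - od X Y = od (- X) (- Y).
Proof. by rewrite /od opp_block_mx oppr0. Qed.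

Lemma nstE x : linfun nst x = nst x. Proof. by rewrite lfunE. Qed.

Lemma nst_invE x : linfun nst_inv x = nst_inv x. Proof. by rewrite lfunE. Qed.

Lemma nice_nst : nice true (linfun nst).
Proof.
split.
- split=> [i x|i j x y]; rewrite !nstE.
    case: (Z2P i) => ->.
      by case/par0_ev=> X [Y ->]; rewrite nst_ev ev_par.
    by case/par1_od=> X [Y ->]; rewrite nst_od od_par.
  case: (Z2P i) => ->; case: (Z2P j) => ->.
  + case/par0_ev=> X [Y ->] /par0_ev[X' [Y' ->]].
    rewrite mul_ev !nst_ev mul_ev expr0 scaleN1r oppev.
    by rewrite !mulNmx !mulmxN !opprK !trmx_mul.
  + case/par0_ev=> X [Y ->] /par1_od[X' [Y' ->]].
    rewrite mul_ev_od !nst_ev !nst_od mul_od_ev expr0 scaleN1r oppod.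
    by rewrite !mulNmx !mulmxN !opprK !trmx_mul.
  + case/par1_od=> X [Y ->] /par0_ev[X' [Y' ->]].
    rewrite mul_od_ev !nst_ev !nst_od mul_ev_od expr0 scaleN1r oppod.
    by rewrite !mulNmx !mulmxN !opprK !trmx_mul.
  case/par1_od=> X [Y ->] /par1_od[X' [Y' ->]].
  rewrite mul_od !nst_ev !nst_od mul_od expr1 opprK scale1r.
  by rewrite !mulNmx !mulmxN !trmx_mul.
- have -> : 1%:M = ev 1%:M 1%:M by apply: scalar_mx_block.
  by rewrite nstE nst_ev expr1 scaleN1r oppev !tr_scalar_mx.
- move=> x; rewrite nstE -[x in RHS]submxK !mxtrace_block !raddfN /=.
  by rewrite !mxtrace_tr expr1 mulN1r opprD.
exists (linfun nst_inv); split=> [x|x|i x]; rewrite ?nst_invE ?nstE ?nst_invE.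
- by rewrite /nst_inv /nst !blockE !linearN /= !trmxK !opprK submxK.
- by rewrite /nst_inv /nst !blockE !linearN /= !trmxK !opprK submxK.
case: (Z2P i) => ->.
  by case/par0_ev=> X [Y ->]; rewrite /nst_inv /ev /od !blockE !trmx0 oppr0 -/(ev _ _) ev_par.
by case/par1_od=> X [Y ->]; rewrite /nst_inv /ev /od !blockE !trmx0 oppr0 -/(od _ _) od_par.
Qed.

End Traceless.

Section EvenNormal.
Variables (F : fieldType) (eigF : has_eigen F) (charF0 : [pchar F] =i pred0).
Variables (n : nat) (n_gt0 : (0 < n)%N).
Local Notation r := n.+1.
Local Notation M := 'M[F]_(n.+1 + n.+1).
Local Notation E i j := (delta_mx i j : 'M[F]_n.+1).

Lemma ev_add X Y X' Y' : ev X Y + ev X' Y' = ev (X + X') (Y + Y') :> M.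
Proof. by rewrite -[ev X Y]scale1r -evD !scale1r. Qed.

Definition ev1 (X : 'M[F]_r) : M := ev X 0.
Definition ev2 (Y : 'M[F]_r) : M := ev 0 Y.

Lemma ev1_linear : linear ev1.
Proof. by move=> a X Y; rewrite /ev1 -evD scaler0 addr0. Qed.
Lemma ev2_linear : linear ev2.
Proof. by move=> a X Y; rewrite /ev2 -evD scaler0 addr0. Qed.

HB.instance Definition _ := GRing.isLinear.Build F 'M[F]_r M _ ev1 ev1_linear.
HB.instance Definition _ := GRing.isLinear.Build F 'M[F]_r M _ ev2 ev2_linear.

Lemma ev12 X Y : ev X Y = ev1 X + ev2 Y.
Proof. by rewrite ev_add addr0 add0r. Qed.

Lemma traceless_proj (B : 'M[F]_r) : \tr (B - (\tr B / r%:R)%:M) = 0.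
Proof.
rewrite linearB /= mxtrace_scalar -[_ / _ *+ _]mulr_natr divfK ?subrr //.
by rewrite natF_eq0.
Qed.

Lemma scalar_of_sl_cent (A : 'M[F]_r) : \tr A = 0 ->
  (forall X, \tr X = 0 -> lie X A = 0) -> A = 0.
Proof.
move=> trA cA; have [|a Aa] := @mx_scalar_cent _ _ A.
  move=> B; have := cA _ (traceless_proj B); rewrite lie_subl /lie => /eqP.
  by rewrite subr_eq0 => /eqP.
move/eqP: trA; rewrite Aa mxtrace_scalar -mulr_natr mulf_eq0 natF_eq0 // orbF.
by move=> /eqP->; rewrite raddf0.
Qed.

Section Auto.
Variables (Fm : {linear M -> M}) (pa : psl_auto Fm).

Lemma pa_evE X Y : \tr X = 0 -> \tr Y = 0 ->
  exists X' Y', [/\ \tr X' = 0, \tr Y' = 0 & Fm (ev X Y) = ev X' Y'].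
Proof.
move=> X0 Y0; have evL : inL (ev X Y) by apply/inL_ev.
have [X' [Y' EF]] := par0_ev (pa_par pa evL (ev_par X Y)).
exists X', Y'; have := pa_L pa evL; rewrite EF => /(inL_ev charF0)[? ?].
by split.
Qed.

(** Even elements of L have traceless bracket, so [Lproj] has no effect; it matters only for two odd
    elements. *)
Lemma pa_ev_br X Y X' Y' : \tr X = 0 -> \tr Y = 0 -> \tr X' = 0 -> \tr Y' = 0 ->
  Fm (ev (lie X X') (lie Y Y')) = scomm (Fm (ev X Y)) (Fm (ev X' Y')).
Proof.
move=> X0 Y0 X'0 Y'0; have [A [B [A0 B0 EF]]] := pa_evE X0 Y0.
have [A' [B' [A'0 B'0 EF']]] := pa_evE X'0 Y'0.
have L1 : inL (ev X Y) by apply/inL_ev.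
have L2 : inL (ev X' Y') by apply/inL_ev.
have := pa_br pa L1 L2; rewrite EF EF' !scomm_ev !Lproj_id //.
  by rewrite /ev mxtrace_block !lie_tr0 addr0.
by rewrite /ev mxtrace_block !lie_tr0 addr0.
Qed.

Lemma pa_ev_od_br X Y B C : \tr X = 0 -> \tr Y = 0 ->
  Fm (od (X *m B - B *m Y) (Y *m C - C *m X)) = scomm (Fm (ev X Y)) (Fm (od B C)).
Proof.
move=> X0 Y0; have [A [D [A0 D0 EF]]] := pa_evE X0 Y0.
have L1 : inL (ev X Y) by apply/inL_ev.
have L2 : inL (od B C) by apply: inL_od.
have [B' [C' EF']] := par1_od (pa_par pa L2 (od_par B C)).
have := pa_br pa L1 L2; rewrite EF EF' !scomm_ev_od !Lproj_id //.
  by have [] := inL_od (A *m B' - B' *m D) (D *m C' - C' *m A).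
by have [] := inL_od (X *m B - B *m Y) (Y *m C - C *m X).
Qed.

(* The hypothesis characterizes, by brackets only, the elements of rank one
   lying in one of the two ideals of the even part. *)
Lemma pa_extremal X Y : \tr X = 0 -> \tr Y = 0 -> ev X Y != 0 ->
  (forall Z T, \tr Z = 0 -> \tr T = 0 -> exists c,
     ev (lie X (lie X Z)) (lie Y (lie Y T)) = c *: ev X Y) ->
  exists (u : 'cV[F]_r) (v : 'rV[F]_r), u *m v != 0 /\
    (Fm (ev X Y) = ev (u *m v) 0 \/ Fm (ev X Y) = ev 0 (u *m v)).
Proof.
move=> X0 Y0 XY0 ext; have [X' [Y' [X'0 Y'0 EF]]] := pa_evE X0 Y0.
have ext' Z T : \tr Z = 0 -> \tr T = 0 -> exists c,
    lie X' (lie X' Z) = c *: X' /\ lie Y' (lie Y' T) = c *: Y'.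
  move=> Z0 T0; have L : inL (ev Z T) by apply/inL_ev.
  have [x [xL x0 xE]] := pa_surj pa L (ev_par Z T).
  have [Z1 [T1 xE1]] := par0_ev x0; rewrite xE1 in xL xE.
  have [Z10 T10] := (inL_ev charF0 Z1 T1).1 xL.
  have [c cE] := ext _ _ Z10 T10; exists c; apply: ev_inj.
  have -> : ev (c *: X') (c *: Y') = c *: ev X' Y'.
    by rewrite -[RHS]addr0 -ev0 -evD !addr0.
  rewrite -EF -linearZ -cE (pa_ev_br X0 Y0) ?lie_tr0 // (pa_ev_br X0 Y0) //.
  by rewrite xE EF !scomm_ev.
have ev00 : ev X' Y' != 0.
  apply: contra XY0 => /eqP E0; apply/eqP; apply: (pa_inj pa); last by rewrite EF.
  exact/inL_ev.
have t0 : \tr (0 : 'M[F]_r) = 0 by rewrite mxtrace0.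
have l0 (Z : 'M[F]_r) : lie Z 0 = 0 by rewrite /lie mulmx0 mul0mx subrr.
have [X'e|X'n] := eqVneq X' 0.
  have Y'n : Y' != 0 by apply: contra ev00 => /eqP->; rewrite X'e ev0.
  have [|u [v Y'E]] := extremal_outer eigF charF0 Y'0 Y'n.
    by move=> T T0; have [c [_ ?]] := ext' 0 T t0 T0; exists c.
  by exists u, v; rewrite -Y'E; split=> //; right; rewrite EF X'e.
(* If both components survived, testing with elements of the first ideal alone would force c = 0,
   against [lie_lie_neq0]. *)
have Y'e : Y' = 0.
  apply/eqP/negPn/negP=> Y'n; have [Z Z0] := lie_lie_neq0 eigF charF0 X'0 X'n.
  have [c [-> /eqP]] := ext' Z 0 Z0 t0; rewrite !l0 eq_sym scaler_eq0 (negPf Y'n).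
  by rewrite orbF => /eqP->; rewrite scale0r eqxx.
have [|u [v X'E]] := extremal_outer eigF charF0 X'0 X'n.
  by move=> Z Z0; have [c [? _]] := ext' Z 0 Z0 t0; exists c.
by exists u, v; rewrite -X'E; split=> //; left; rewrite EF Y'e.
Qed.

Lemma lie_lie_outer_nil (u : 'cV[F]_r) (v : 'rV[F]_r) Z : pair v u = 0 ->
  exists c, lie (u *m v) (lie (u *m v) Z) = c *: (u *m v).
Proof.
move=> vu; exists (- (2%:R * pair (v *m Z) u)).
have N0 : (u *m v) *m (u *m v) = 0 by rewrite mul_outer vu scale0r.
have N1 : u *m v *m Z *m (u *m v) = pair (v *m Z) u *: (u *m v).
  by rewrite -(mulmxA u v Z) mul_outer.
rewrite /lie mulmxBr mulmxBl (mulmxA (u *m v) (u *m v)) N0 mul0mx sub0r.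
rewrite (mulmxA (u *m v) Z) N1 -(mulmxA Z) N0 mulmx0 subr0.
by rewrite -opprD -scalerDl mulr_natl mulr2n scaleNr.
Qed.

Lemma pa_outer (u : 'cV[F]_r) (v : 'rV[F]_r) (b : bool) :
  pair v u = 0 -> u *m v != 0 ->
  exists (u' : 'cV[F]_r) (v' : 'rV[F]_r), u' *m v' != 0 /\
    let x := if b then ev1 (u *m v) else ev2 (u *m v) in
    (Fm x = ev (u' *m v') 0 \/ Fm x = ev 0 (u' *m v')).
Proof.
move=> vu uv0; have uvt : \tr (u *m v) = 0 by rewrite tr_outer.
have t0 : \tr (0 : 'M[F]_r) = 0 by rewrite mxtrace0.
have l0 (Z : 'M[F]_r) : lie 0 Z = 0 by rewrite /lie mulmx0 mul0mx subrr.
have evZ c X Y : ev (c *: X) (c *: Y) = c *: ev X Y :> M.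
  by rewrite -[RHS]addr0 -ev0 -evD !addr0.
case: b; apply: pa_extremal => //.
- by apply: contra uv0 => /eqP; rewrite -ev0 => /ev_inj[-> _].
- move=> Z T _ _; have [c cE] := lie_lie_outer_nil Z vu; exists c.
  by rewrite cE l0 -evZ scaler0.
- by apply: contra uv0 => /eqP; rewrite -ev0 => /ev_inj[_ ->].
move=> Z T _ _; have [c cE] := lie_lie_outer_nil T vu; exists c.
by rewrite cE l0 -evZ scaler0.
Qed.

End Auto.

Definition normalizable (Fm : {linear M -> M}) : Prop :=
  exists e Psi, nice e Psi /\
    forall X Y, \tr X = 0 -> \tr Y = 0 -> Psi (Fm (ev X Y)) = ev X Y.

Lemma normalizable_comp e Psi (Fm : {linear M -> M}) :
  nice e Psi -> normalizable (Psi \o Fm) -> normalizable Fm.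
Proof.
move=> nc [e' [Psi' [nc' H]]]; exists (e' (+) e), (Psi' \o Psi)%VF.
split; first exact: nice_comp.
by move=> X Y X0 Y0; rewrite comp_lfunE; apply: H.
Qed.

Lemma ev_conj (P1 P2 Q1 Q2 X Y : 'M[F]_r) :
  lconj (ev P1 P2) (ev Q1 Q2) (ev X Y) = ev (P1 *m X *m Q1) (P2 *m Y *m Q2) :> M.
Proof. by rewrite lconjE !mul_ev. Qed.

Lemma ev_conj_od (P1 P2 Q1 Q2 X Y : 'M[F]_r) :
  lconj (ev P1 P2) (ev Q1 Q2) (od X Y) = od (P1 *m X *m Q2) (P2 *m Y *m Q1) :> M.
Proof. by rewrite lconjE mul_ev_od mul_od_ev. Qed.

Lemma ev_1 : ev 1%:M 1%:M = 1%:M :> M.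
Proof. by rewrite [RHS]scalar_mx_block. Qed.

Lemma nice_ev_conj (P1 P2 Q1 Q2 : 'M[F]_r) :
  P1 *m Q1 = 1%:M -> P2 *m Q2 = 1%:M -> nice false (lconj (ev P1 P2) (ev Q1 Q2) : 'End(M)).
Proof.
by move=> PQ1 PQ2; apply: (nice_conj (i := 0)); rewrite ?ev_par // mul_ev PQ1 PQ2 ev_1.
Qed.

(** Applying the rule to E_ik and, in two steps, to E_ij E_jk gives - g B E_ik = g B E_jk E_ij = 0.
    This takes three distinct indices, whence 1 < n. *)
Lemma neg_op_kill (g : 'M[F]_r -> 'M[F]_r) : (1 < n)%N ->
  (forall X B, \tr X = 0 -> g (X *m B) = - (g B *m X)) -> forall B, g B = 0.
Proof.
move=> n1 gN B; apply/matrixP=> a i; rewrite mxE.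
have third (i' k' : 'I_r) : exists j, (j != i') && (j != k').
  case: (pickP (fun j => (j != i') && (j != k'))) => [j ?|no]; first by exists j.
  have : (#|[set: 'I_r]| <= #|[set i'; k']|)%N.
    apply: subset_leq_card; apply/subsetP=> j _; rewrite !inE.
    by have := no j; case: eqP => //= _; case: eqP.
  rewrite cardsT card_ord => /leq_trans/(_ (_ : _ <= 2)%N).
  have -> : (#|[set i'; k']| <= 2)%N by rewrite cards2; case: (_ != _).
  by move=> /(_ isT); rewrite ltnNge n1.
have [k /andP[ki _]] := third i i; have [j /andP[ji jk]] := third i k.
have tr0 x y : x != y -> \tr (E x y) = 0 by rewrite tr_delta => /negPf->.
have ik : i != k by rewrite eq_sym.
have ij : i != j by rewrite eq_sym.
have Eij : E i j *m (E j k *m B) = E i k *m B by rewrite mulmxA mul_delta_mx.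
have : g B *m E i k = 0.
  apply: oppr_inj; rewrite oppr0 -gN ?tr0 // -Eij !gN ?tr0 //.
  by rewrite mulNmx opprK -mulmxA mul_delta_mx_0 ?mulmx0 // eq_sym.
move/matrixP/(_ a k); rewrite !mxE (bigD1 i) //= big1 => [|l li].
  by rewrite addr0 mxE !eqxx mulr1.
by rewrite mxE (negPf li) mulr0.
Qed.

Lemma normalizable_id (Fm : {linear M -> M}) :
  (forall X Y, \tr X = 0 -> \tr Y = 0 -> Fm (ev X Y) = ev X Y) -> normalizable Fm.
Proof.
move=> FE; exists false, (lconj (ev 1%:M 1%:M) (ev 1%:M 1%:M)).
split; first by apply: nice_ev_conj; rewrite mulmx1.
by move=> X Y X0 Y0; rewrite FE // ev_conj !mul1mx !mulmx1.
Qed.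

End EvenNormal.

Section TwoByTwo.
Variables (F : fieldType) (charF0 : [pchar F] =i pred0).
Local Notation M2 := 'M[F]_2.

(* For 2 x 2 matrices this is the adjugate, an antiautomorphism equal to -1 on
   traceless matrices; it is responsible for the automorphisms of psl(2|2) that
   mix the two odd modules. *)
Definition star n (B : 'M[F]_n.+1) : 'M[F]_n.+1 := (\tr B)%:M - B.

Lemma star_linear n : linear (@star n).
Proof.
move=> a X Y; apply/matrixP=> i j; rewrite /star linearP /= !mxE.
by case: (i == j); rewrite ?mulr1n ?mulr0n; ring.
Qed.

HB.instance Definition _ n :=
  GRing.isLinear.Build F 'M[F]_n.+1 'M[F]_n.+1 _ (@star n) (@star_linear n).

(** The symplectic 2 x 2 matrix, with inverse [- Jmx]; [star] is B |-> J B^T J^-1. *)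
Definition Jmx : M2 := \matrix_(i, j) (if i == j then 0 else if i == 0 then 1 else -1).

Lemma I2P (i : 'I_2) : i = 0 \/ i = 1.
Proof. by case: i => -[|[|//]] lt; [left|right]; apply: val_inj. Qed.

Lemma JJ : Jmx *m - Jmx = 1%:M.
Proof.
apply/matrixP=> i j; rewrite !mxE !big_ord_recl big_ord0 !mxE /=.
by case: (I2P i) => ->; case: (I2P j) => ->; rewrite /=; ring.
Qed.

Lemma starJ (B : M2) : star B = Jmx *m B^T *m - Jmx.
Proof.
apply/matrixP=> i j; rewrite !mxE !big_ord_recl !big_ord0 !mxE !big_ord_recl !big_ord0.
rewrite !mxE /= /mxtrace !big_ord_recl big_ord0.
have -> : lift ord0 ord0 = 1 :> 'I_2 by apply: val_inj.
by case: (I2P i) => ->; case: (I2P j) => ->; rewrite /=; ring.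
Qed.

Lemma starM (A B : M2) : star (A *m B) = star B *m star A.
Proof.
by rewrite !starJ trmx_mul !mulmxA -(mulmxA _ (- Jmx) Jmx) (mulmx1C JJ) mulmx1.
Qed.

Lemma starK : involutive (@star 1).
Proof.
move=> B; rewrite /star linearB /= mxtrace_scalar mulr2n addrK opprB.
by rewrite addrCA subrr addr0.
Qed.

Lemma star0 n (X : 'M[F]_n.+1) : \tr X = 0 -> star X = - X.
Proof. by move=> X0; rewrite /star X0 raddf0 sub0r. Qed.

End TwoByTwo.

Section LieZero.
Variables (F : fieldType) (m : nat).

Lemma lie0r (X : 'M[F]_m) : lie X 0 = 0.
Proof. by rewrite /lie mulmx0 mul0mx subrr. Qed.

Lemma lie0l (X : 'M[F]_m) : lie 0 X = 0.
Proof. by rewrite /lie mulmx0 mul0mx subrr. Qed.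

End LieZero.

Section Normalize.
Variables (F : fieldType) (eigF : has_eigen F) (charF0 : [pchar F] =i pred0).
Variables (n : nat) (n_gt0 : (0 < n)%N).
Local Notation r := n.+1.
Local Notation M := 'M[F]_(n.+1 + n.+1).
Local Notation E i j := (delta_mx i j : 'M[F]_n.+1).

Definition corner1 (Fm : {linear M -> M}) (X : 'M[F]_r) : 'M[F]_r :=
  ulsubmx (Fm (ev1 X)).
Definition corner2 (Fm : {linear M -> M}) (Y : 'M[F]_r) : 'M[F]_r :=
  drsubmx (Fm (ev2 Y)).

Lemma corner1_linear Fm : linear (corner1 Fm).
Proof.
move=> a X Y; rewrite /corner1 ev1_linear linearP.
by apply/matrixP=> i j; rewrite !mxE.
Qed.
Lemma corner2_linear Fm : linear (corner2 Fm).
Proof.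
move=> a X Y; rewrite /corner2 ev2_linear linearP.
by apply/matrixP=> i j; rewrite !mxE.
Qed.

HB.instance Definition _ Fm :=
  GRing.isLinear.Build F 'M[F]_r 'M[F]_r _ (corner1 Fm) (corner1_linear Fm).
HB.instance Definition _ Fm :=
  GRing.isLinear.Build F 'M[F]_r 'M[F]_r _ (corner2 Fm) (corner2_linear Fm).

(* For r > 2 the odd modules over the even part do not embed into their twist by
   [ev X Y |-> ev X (- Y^T)], so [Fm] would vanish on [od B 0]. *)
Lemma opp_tr_excluded (Fm : {linear M -> M}) : (1 < n)%N -> psl_auto Fm ->
  (forall X, \tr X = 0 -> Fm (ev X 0) = ev X 0) ->
  (forall Y, \tr Y = 0 -> Fm (ev 0 Y) = ev 0 (- Y^T)) -> False.
Proof.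
move=> n1 pa F1 F2.
(* The two blocks of the image of [od B 0]; both obey the rule of [neg_op_kill], the first one after
   transposing its argument. *)
pose g1 (B : 'M[F]_r) := ursubmx (Fm (od B^T 0)).
pose g2 (B : 'M[F]_r) := dlsubmx (Fm (od B 0)).
have FodE B : exists B' C', Fm (od B 0) = od B' C'.
  exact: (par1_od (pa_par pa (inL_od B 0) (od_par B 0))).
have FN B : Fm (od (- B) 0) = - Fm (od B 0) by rewrite -linearN oppod oppr0.
have g1K : forall B, g1 B = 0.
  apply: (neg_op_kill n1) => X B X0; rewrite /g1 trmx_mul.
  have Xt : \tr X^T = 0 by rewrite mxtrace_tr.
  have [B' [C' EB]] := FodE B^T.
  have := pa_ev_od_br charF0 pa B^T 0 (mxtrace0 F r) Xt.
  rewrite F2 // EB scomm_ev_od trmxK !(mul0mx, mulmx0, sub0r, subr0, oppr0) => /eqP.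
  rewrite FN eqr_oppLR => /eqP->.
  by rewrite /od opp_block_mx !blockE mulmxN opprK.
have g2K : forall B, g2 B = 0.
  apply: (neg_op_kill n1) => X B X0; rewrite /g2.
  have [B' [C' EB]] := FodE B.
  have := pa_ev_od_br charF0 pa B 0 X0 (mxtrace0 F r).
  rewrite F1 // EB scomm_ev_od !(mul0mx, mulmx0, sub0r, subr0, oppr0) => ->.
  by rewrite /od !blockE.
have [B' [C' EB]] := FodE 1%:M.
have := g1K 1%:M; have := g2K 1%:M; rewrite /g1 /g2 trmx1 EB /od !blockE => C0 B0.
have := pa_inj pa (inL_od 1%:M 0); rewrite EB B0 C0 od0 => /(_ erefl).
rewrite -od0 => /od_inj[/eqP].
by rewrite -mxrank_eq0 mxrank1.
Qed.

(** Only r = 2 survives; there conjugating the second block by J turns - Y^T into Y, as [star] is -1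
    on traceless matrices. *)
Lemma normalize_opp_tr (Fm : {linear M -> M}) : psl_auto Fm ->
  (forall X, \tr X = 0 -> Fm (ev X 0) = ev X 0) ->
  (forall Y, \tr Y = 0 -> Fm (ev 0 Y) = ev 0 (- Y^T)) -> normalizable Fm.
Proof.
move=> pa F1 F2; have [n1|n1] := leqP n 1; last first.
  by case: (opp_tr_excluded n1 pa F1 F2).
have n1E : n = 1%N by apply/eqP; rewrite eqn_leq n1.
move: Fm pa F1 F2; rewrite n1E => Fm pa F1 F2.
apply: (normalizable_comp (nice_ev_conj (mulmx1 1%:M) (JJ F))).
apply: normalizable_id => X Y X0 Y0 /=.
rewrite [in LHS](ev12 X Y) linearD /= /ev1 /ev2 F1 // F2 // ev_add addr0 add0r.
rewrite ev_conj mul1mx mulmx1.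
by rewrite [Jmx F *m - _]mulmxN [- _ *m - _]mulNmx -starJ star0 // opprK.
Qed.

Lemma exists_nz : exists j1 : 'I_n.+1, j1 != 0.
Proof.
exists (lift ord0 (Ordinal n_gt0)); by rewrite eq_sym neq_lift.
Qed.

Lemma ev2_sl_morph (Fm : {linear M -> M}) : psl_auto Fm ->
  (forall Y, \tr Y = 0 -> exists Y', Fm (ev2 Y) = ev 0 Y') ->
  sl_morph (corner2 Fm).
Proof.
move=> pa F2; have FE Y : \tr Y = 0 -> Fm (ev2 Y) = ev 0 (drsubmx (Fm (ev2 Y))).
  by move=> /F2[Y' ->]; rewrite /ev !blockE.
split; rewrite /= /corner1 /corner2.
- move=> Y Y0; have [A [B [A0 B0]]] := pa_evE charF0 pa (mxtrace0 F r) Y0.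
  by rewrite -/(ev2 Y) => ->; rewrite /ev !blockE.
- move=> X Y X0 Y0; have := pa_ev_br charF0 pa (mxtrace0 F r) X0 (mxtrace0 F r) Y0.
  rewrite lie0r -!/(ev2 _) (FE X X0) (FE Y Y0) scomm_ev lie0r => ->.
  by rewrite /ev !blockE.
move=> u v vu uv0; have uvt : \tr (u *m v) = 0 by rewrite tr_outer.
have [u' [v' [uv0' []]]] := pa_outer eigF charF0 pa false vu uv0; rewrite (FE _ uvt).
  by move/ev_inj => [E0 _]; move: uv0'; rewrite -E0 eqxx.
by move/ev_inj => [_ ->]; rewrite /ev blockE; split=> //; exists u', v'.
Qed.

Lemma ev1_sl_morph (Fm : {linear M -> M}) : psl_auto Fm ->
  (forall X, \tr X = 0 -> exists X', Fm (ev1 X) = ev X' 0) ->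
  sl_morph (corner1 Fm).
Proof.
move=> pa F1; have FE Y : \tr Y = 0 -> Fm (ev1 Y) = ev (ulsubmx (Fm (ev1 Y))) 0.
  by move=> /F1[Y' ->]; rewrite /ev !blockE.
split; rewrite /= /corner1 /corner2.
- move=> Y Y0; have [A [B [A0 B0]]] := pa_evE charF0 pa Y0 (mxtrace0 F r).
  by rewrite -/(ev1 Y) => ->; rewrite /ev !blockE.
- move=> X Y X0 Y0; have := pa_ev_br charF0 pa X0 (mxtrace0 F r) Y0 (mxtrace0 F r).
  rewrite lie0r -!/(ev1 _) (FE X X0) (FE Y Y0) scomm_ev lie0r => ->.
  by rewrite /ev !blockE.
move=> u v vu uv0; have uvt : \tr (u *m v) = 0 by rewrite tr_outer.
have [u' [v' [uv0' []]]] := pa_outer eigF charF0 pa true vu uv0; rewrite (FE _ uvt).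
  by move/ev_inj => [-> _]; rewrite /ev blockE; split=> //; exists u', v'.
by move/ev_inj => [_ E0]; move: uv0'; rewrite -E0 eqxx.
Qed.

Lemma normalize_second (Fm : {linear M -> M}) : psl_auto Fm ->
  (forall X, \tr X = 0 -> Fm (ev X 0) = ev X 0) -> normalizable Fm.
Proof.
(* The image of [ev2 Y] commutes with the first ideal, so its first block is central and traceless,
   hence zero. *)
move=> pa F1; have F2 Y : \tr Y = 0 -> exists Y', Fm (ev2 Y) = ev 0 Y'.
  move=> Y0; have [A [B [A0 B0 AB]]] := pa_evE charF0 pa (mxtrace0 F r) Y0.
  exists B; rewrite /ev2 AB; congr ev; apply: (scalar_of_sl_cent charF0 A0) => X X0.
  have := pa_ev_br charF0 pa X0 (mxtrace0 F r) (mxtrace0 F r) Y0.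
  by rewrite lie0r lie0l ev0 linear0 F1 // AB scomm_ev lie0l -ev0 => /ev_inj[<-].
have sm := ev2_sl_morph pa F2; have [j1 j10] := exists_nz.
have F2E Y : \tr Y = 0 -> Fm (ev 0 Y) = ev 0 (drsubmx (Fm (ev2 Y))).
  by move=> /F2[Y' EY]; rewrite -/(ev2 Y) EY /ev !blockE.
have [P Pu [PE|PE]] := sl_morph_aut charF0 j10 sm.
  apply: (normalizable_comp (nice_ev_conj (mulmx1 1%:M) (mulVmx Pu))).
  apply: normalizable_id => X Y X0 Y0 /=; rewrite [in LHS](ev12 X Y) linearD /= /ev1 /ev2.
  rewrite F1 // F2E //; have := PE Y Y0; rewrite /= /corner2 => ->; rewrite ev_add addr0 add0r ev_conj mul1mx mulmx1.
  by rewrite !mulmxA mulVmx // mul1mx mulmxKV.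
have nc := nice_ev_conj (mulmx1 1%:M) (mulVmx Pu).
apply: (normalizable_comp nc); apply: normalize_opp_tr.
- exact: psl_auto_comp nc pa.
- by move=> X X0 /=; rewrite F1 // ev_conj mul1mx mulmx1 mulmx0 mul0mx.
move=> Y Y0 /=; rewrite F2E //; have := PE Y Y0; rewrite /= /corner2 => ->.
rewrite ev_conj mul1mx mulmx1.
by rewrite mulmxN mulNmx !mulmxA mulVmx // mul1mx mulmxKV.
Qed.

(** An inner first block is undone by a conjugation. An outer one is first corrected by the
    supertranspose, which acts on both blocks at once. *)
Lemma normalize_first (Fm : {linear M -> M}) : psl_auto Fm ->
  (forall X, \tr X = 0 -> exists X', Fm (ev1 X) = ev X' 0) -> normalizable Fm.
Proof.
move=> pa F1; have sm := ev1_sl_morph pa F1; have [j1 j10] := exists_nz.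
have F1E Y : \tr Y = 0 -> Fm (ev Y 0) = ev (ulsubmx (Fm (ev1 Y))) 0.
  by move=> /F1[Y' EY]; rewrite -/(ev1 Y) EY /ev !blockE.
have [P Pu [PE|PE]] := sl_morph_aut charF0 j10 sm.
  have nc := nice_ev_conj (mulVmx Pu) (mulmx1 1%:M).
  apply: (normalizable_comp nc); apply: normalize_second.
    exact: psl_auto_comp nc pa.
  move=> X X0 /=; rewrite F1E //; have := PE X X0; rewrite /= /corner1 => ->.
  rewrite ev_conj mul1mx mulmx1.
  by rewrite !mulmxA mulVmx // mul1mx mulmxKV.
apply: (normalizable_comp (nice_nst F r)).
have pa' := psl_auto_comp (nice_nst F r) pa.
have PV : P^T *m (invmx P)^T = 1%:M by rewrite -trmx_mul mulVmx // trmx1.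
have nc := nice_ev_conj PV (mulmx1 1%:M).
apply: (normalizable_comp nc); apply: normalize_second.
  exact: psl_auto_comp nc pa'.
move=> X X0 /=; rewrite F1E //; have := PE X X0; rewrite /= /corner1 => ->.
rewrite nstE nst_ev ev_conj trmx0 oppr0 mulmx0 mul0mx; congr ev.
have trN (Z : 'M[F]_r) : (- Z)^T = - Z^T by apply/matrixP=> i j; rewrite !mxE.
rewrite trN opprK !trmx_mul trmxK !mulmxA PV mul1mx.
by rewrite -mulmxA PV mulmx1.
Qed.

Definition swapmx : M := od 1%:M 1%:M.

Lemma swap_swap : swapmx *m swapmx = 1%:M.
Proof. by rewrite mul_od mulmx1 ev_1. Qed.

Lemma swap_ev X Y : lconj swapmx swapmx (ev X Y) = ev Y X.
Proof. by rewrite lconjE mul_od_ev mul_od !mul1mx !mulmx1. Qed.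

(** The matrices sent into the first ideal are stable under brackets with sl, so a single E_0j1
    among them suffices, as in the simplicity of sl. *)
Lemma first_ideal (Fm : {linear M -> M}) (j1 : 'I_n.+1) : j1 != 0 -> psl_auto Fm ->
  drsubmx (Fm (ev1 (E 0 j1))) = 0 ->
  forall X, \tr X = 0 -> exists X', Fm (ev1 X) = ev X' 0.
Proof.
move=> j10 pa D0 X X0; suff : drsubmx (Fm (ev1 X)) = 0.
  have [A [B [A0 B0]]] := pa_evE charF0 pa X0 (mxtrace0 F r).
  by rewrite -/(ev1 X) => ->; rewrite /ev !blockE => ->; exists A.
have trE i j : i != j -> \tr (E i j) = 0 by rewrite tr_delta => /negPf->.
have t0 := mxtrace0 F r; pose good (X : 'M[F]_r) := drsubmx (Fm (ev1 X)) = 0.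
have br A B : \tr A = 0 -> \tr B = 0 -> good A -> good (lie A B).
  rewrite /good => A0 B0; have -> : ev1 (lie A B) = ev (lie A B) (lie 0 0) by rewrite lie0r.
  rewrite pa_ev_br //; have [A1 [A2 [_ _ EA]]] := pa_evE charF0 pa A0 t0.
  have [B1 [B2 [_ _ EB]]] := pa_evE charF0 pa B0 t0.
  by rewrite /ev1 EA EB scomm_ev /ev !blockE => ->; rewrite lie0l.
have brN A : good (- A) <-> good A.
  have dN (x : M) : drsubmx (- x) = - drsubmx x by apply/matrixP=> i j; rewrite !mxE.
  rewrite /good !linearN /= dN.
  split=> [H|->]; last by rewrite oppr0.
  by apply: oppr_inj; rewrite H oppr0.
have j10' : 0 != j1 by rewrite eq_sym.
have g01 : good (E 0 j1) by [].
have g10 : good (E j1 0).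
  (* This double bracket equals -2 E_j1,0. *)
  have : good (lie (lie (E 0 j1) (E j1 0)) (E j1 0)).
    by apply: (br); rewrite ?lie_tr0 ?trE //; apply: (br); rewrite ?trE.
  rewrite lie_delta !eqxx !scale1r /lie mulmxBl mulmxBr !mul_delta_mx.
  rewrite !mul_delta_mx_0 // sub0r subr0 -opprD; move/brN.
  have dZ a (x : M) : drsubmx (a *: x) = a *: drsubmx x.
    by apply/matrixP=> i j; rewrite !mxE.
  rewrite /good -mulr2n -scaler_nat !linearZ /= dZ => /eqP.
  by rewrite scaler_eq0 (negPf (natF2 charF0)) /= => /eqP.
have gj j : j != 0 -> good (E 0 j) /\ good (E j 0).
  move=> j0; have [->|jj] := eqVneq j j1; first by split.
  have j0' : 0 != j by rewrite eq_sym.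
  have jj' : j1 != j by rewrite eq_sym.
  split.
    have := br _ _ (trE _ _ j10') (trE _ _ jj') g01.
    by rewrite lie_delta eqxx scale1r (negPf j0) scale0r subr0.
  have := br _ _ (trE _ _ j10) (trE _ _ jj) g10.
  rewrite lie_delta eqxx scale1r (negPf j0') scale0r sub0r; exact: (brN _).1.
apply: (sl_ind (good := good)) X0 => //.
- move=> a A B gA gB; rewrite /good ev1_linear linearP.
  move: gA gB; rewrite /good => gA gB; apply/matrixP=> i j.
  have /matrixP/(_ i j) := gA; have /matrixP/(_ i j) := gB; rewrite !mxE => -> ->.
  by rewrite mulr0 addr0.
- by rewrite /good -[ev1 0]/(ev 0 0) ev0 linear0; apply/matrixP=> i j; rewrite !mxE.
by move=> A B A0 B0 gA _; apply: br.
Qed.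

(** By [pa_outer] the image of one rank one element lies in one of the two ideals, which decides
    whether they are exchanged; the odd matrix [swapmx] corrects an exchange. *)
Lemma psl_auto_normalizable (Fm : {linear M -> M}) : psl_auto Fm -> normalizable Fm.
Proof.
move=> pa; have [j1 j10] := exists_nz; have j10' : 0 != j1 by rewrite eq_sym.
have vu : pair (delta_mx 0 j1 : 'rV[F]_r) (delta_mx 0 0) = 0.
  by rewrite -tr_outer mul_delta_mx tr_delta (negPf j10').
have uv0 : (delta_mx 0 0 : 'cV[F]_r) *m (delta_mx 0 j1 : 'rV_r) != 0.
  by rewrite mul_delta_mx delta_neq0.
have [u [v [_ []]]] := pa_outer eigF charF0 pa true vu uv0; rewrite mul_delta_mx => EF.
  apply: normalize_first => //; apply: (first_ideal j10) => //.
  by rewrite EF /ev blockE.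
have nc : nice false (lconj swapmx swapmx).
  by apply: (nice_conj (i := 1)); rewrite ?od_par // swap_swap.
have pa' := psl_auto_comp nc pa.
apply: (normalizable_comp nc); apply: normalize_first => //.
by apply: (first_ideal j10) => //=; rewrite EF swap_ev /ev blockE.
Qed.


End Normalize.

(** The hypotheses extend from traceless to all matrices by adding scalars; then h is determined by
    h 1, which is central. *)
Lemma bimodule_scalar (F : fieldType) n (h : 'M[F]_n.+1 -> 'M[F]_n.+1) :
  [pchar F] =i pred0 -> linear h ->
  (forall X B, \tr X = 0 -> h (X *m B) = X *m h B) ->
  (forall X B, \tr X = 0 -> h (B *m X) = h B *m X) ->
  exists b, forall B, h B = b *: B.
Proof.
move=> charF0 hlin hl hr.
have hD A B : h (A + B) = h A + h B by have := hlin 1 A B; rewrite !scale1r.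
have h0 : h 0 = 0 by apply: (addIr (h 0)); rewrite add0r -hD addr0.
have hZ a A : h (a *: A) = a *: h A by have := hlin a A 0; rewrite !addr0 h0 addr0.
have dec (X : 'M[F]_n.+1) : exists a Y, \tr Y = 0 /\ X = a%:M + Y.
  exists (\tr X / n.+1%:R), (X - (\tr X / n.+1%:R)%:M).
  by rewrite traceless_proj // addrC subrK.
have hl' X B : h (X *m B) = X *m h B.
  have [a [Y [Y0 ->]]] := dec X.
  by rewrite !mulmxDl !mul_scalar_mx hD hZ hl.
have hr' X B : h (B *m X) = h B *m X.
  have [a [Y [Y0 ->]]] := dec X.
  by rewrite !mulmxDr !mul_mx_scalar hD hZ hr.
have [|b bE] := @mx_scalar_cent _ _ (h 1%:M).
  by move=> B; rewrite -hl' -hr' mulmx1 mul1mx.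
by exists b => B; rewrite -[B in LHS]mulmx1 hl' bE mul_mx_scalar.
Qed.

(** * The action on the odd part *)

Section OddPart.
Variables (F : fieldType) (charF0 : [pchar F] =i pred0).
Variables (n : nat) (n_gt0 : (0 < n)%N).
Local Notation r := n.+1.
Local Notation M := 'M[F]_(n.+1 + n.+1).
Local Notation E i j := (delta_mx i j : 'M[F]_n.+1).

(** For r = 2, composing g with [star] cancels the signs and puts the factors back on their sides,
    so [bimodule_scalar] applies. *)
Lemma neg_op_star (g : 'M[F]_r -> 'M[F]_r) : linear g ->
  (forall X B, \tr X = 0 -> g (X *m B) = - (g B *m X)) ->
  (forall X B, \tr X = 0 -> g (B *m X) = - (X *m g B)) ->
  exists c, ((1 < n)%N -> c = 0) /\ forall B, g B = c *: star B.
Proof.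
move=> glin gl gr; have [n1|n1] := leqP n 1; last first.
  by exists 0; split=> // B; rewrite scale0r (neg_op_kill n1 gl).
have n1E : n = 1%N by apply/eqP; rewrite eqn_leq n1.
move: g glin gl gr; rewrite n1E => g glin gl gr.
have [|||c cE] := @bimodule_scalar F 1 (fun B => star (g B)) charF0.
- by move=> a A B; rewrite glin star_linear.
- by move=> X B X0; rewrite gl // linearN /= starM (star0 X0) mulNmx opprK.
- by move=> X B X0; rewrite gr // linearN /= starM (star0 X0) mulmxN opprK.
exists c; split=> // B.
by rewrite -[LHS]starK cE linearZ.
Qed.

(* For r > 2 the two odd modules over the even part are not isomorphic, whence
   b' = c' = 0; for r = 2 [star] intertwines them. *)
Lemma odd_part (Fm : {linear M -> M}) : psl_auto Fm ->
  (forall X Y, \tr X = 0 -> \tr Y = 0 -> Fm (ev X Y) = ev X Y) ->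
  exists b c b' c', [/\ b * c - b' * c' = 1, (1 < n)%N -> b' = 0 /\ c' = 0 &
    forall B C, Fm (od B C) = od (b *: B + b' *: star C) (c' *: star B + c *: C)].
Proof.
move=> pa Fev; have t0 := mxtrace0 F r.
pose f11 B := ursubmx (Fm (od B 0)); pose f21 B := dlsubmx (Fm (od B 0)).
pose f12 C := ursubmx (Fm (od 0 C)); pose f22 C := dlsubmx (Fm (od 0 C)).
have F1 B : Fm (od B 0) = od (f11 B) (f21 B).
  rewrite /f11 /f21; have [B' [C' ->]] := par1_od (pa_par pa (inL_od B 0) (od_par B 0)).
  by rewrite /od !blockE.
have F2 C : Fm (od 0 C) = od (f12 C) (f22 C).
  rewrite /f12 /f22; have [B' [C' ->]] := par1_od (pa_par pa (inL_od 0 C) (od_par 0 C)).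
  by rewrite /od !blockE.
have od1D a X Y : od (a *: X + Y) 0 = a *: od X 0 + od Y 0 :> M.
  by rewrite -odD scaler0 addr0.
have od2D a X Y : od 0 (a *: X + Y) = a *: od 0 X + od 0 Y :> M.
  by rewrite -odD scaler0 addr0.
have l1 : linear f11 /\ linear f21.
  by split=> a X Y; rewrite /f11 /f21 od1D linearP; apply/matrixP=> i j; rewrite !mxE.
have l2 : linear f12 /\ linear f22.
  by split=> a X Y; rewrite /f12 /f22 od2D linearP; apply/matrixP=> i j; rewrite !mxE.
have br1X X B : \tr X = 0 ->
    f11 (X *m B) = X *m f11 B /\ f21 (X *m B) = - (f21 B *m X).
  move=> X0; have := pa_ev_od_br charF0 pa B 0 X0 t0.
  rewrite Fev // F1 scomm_ev_od !(mul0mx, mulmx0, sub0r, subr0, oppr0) F1.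
  by move/od_inj.
have br1Y Y B : \tr Y = 0 ->
    f11 (B *m Y) = f11 B *m Y /\ f21 (B *m Y) = - (Y *m f21 B).
  move=> Y0; have := pa_ev_od_br charF0 pa B 0 t0 Y0.
  rewrite Fev // F1 scomm_ev_od !(mul0mx, mulmx0, sub0r, subr0, oppr0).
  rewrite -[- (B *m Y)]scaleN1r -[X in od X 0]addr0 od1D od0 addr0 linearZ /= F1.
  rewrite -[_ *: _]addr0 -od0 -odD !addr0 !scaleN1r => /od_inj[/oppr_inj-> E21].
  by split=> //; rewrite -E21 opprK.
have br2X X C : \tr X = 0 ->
    f22 (C *m X) = f22 C *m X /\ f12 (C *m X) = - (X *m f12 C).
  move=> X0; have := pa_ev_od_br charF0 pa 0 C X0 t0.
  rewrite Fev // F2 scomm_ev_od !(mul0mx, mulmx0, sub0r, subr0, oppr0).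
  rewrite -[- (C *m X)]scaleN1r -[X in od 0 X]addr0 od2D od0 addr0 linearZ /= F2.
  rewrite -[_ *: _]addr0 -od0 -odD !addr0 !scaleN1r => /od_inj[E21 /oppr_inj->].
  by split=> //; rewrite -E21 opprK.
have br2Y Y C : \tr Y = 0 ->
    f22 (Y *m C) = Y *m f22 C /\ f12 (Y *m C) = - (f12 C *m Y).
  move=> Y0; have := pa_ev_od_br charF0 pa 0 C t0 Y0.
  rewrite Fev // F2 scomm_ev_od !(mul0mx, mulmx0, sub0r, subr0, oppr0) F2.
  by move/od_inj => [].
have [b bE] : exists b, forall B, f11 B = b *: B.
  apply: (bimodule_scalar charF0 l1.1) => X B X0.
    by have [] := br1X X B X0.
  by have [] := br1Y X B X0.
have [c cE] : exists b, forall B, f22 B = b *: B.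
  apply: (bimodule_scalar charF0 l2.2) => X B X0.
    by have [] := br2Y X B X0.
  by have [] := br2X X B X0.
have [c' [c'0 c'E]] : exists c, ((1 < n)%N -> c = 0) /\ forall B, f21 B = c *: star B.
  apply: (neg_op_star l1.2) => X B X0.
    by have [] := br1X X B X0.
  by have [] := br1Y X B X0.
have [b' [b'0 b'E]] : exists c, ((1 < n)%N -> c = 0) /\ forall B, f12 B = c *: star B.
  apply: (neg_op_star l2.1) => X B X0.
    by have [] := br2Y X B X0.
  by have [] := br2X X B X0.
exists b, c, b', c'; split.
(* The determinant relation is read off from the bracket of [od B 0] and [od 0 C], which is
   [ev B 0]. The minus sign arises because [star] reverses products and sends the traceless B to
   -B. *)
- have [j j0] := exists_nz n_gt0; pose B := E 0 j; pose C := E j j.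
  have j0' : 0 != j by rewrite eq_sym.
  have BC : B *m C = B by rewrite mul_delta_mx.
  have CB : C *m B = 0 by rewrite mul_delta_mx_0.
  have trB : \tr B = 0 by rewrite tr_delta (negPf j0').
  have st : (b' * c') *: (star C *m star B) = - (b' * c') *: B /\
            (c' * b') *: (star B *m star C) = 0.
    have [n1|n1] := leqP n 1; last by rewrite b'0 // c'0 // mul0r oppr0 !scale0r.
    have starM' (A A' : 'M[F]_r) : star (A *m A') = star A' *m star A.
      have n1E : n = 1%N by apply/eqP; rewrite eqn_leq n1.
      by move: A A'; rewrite n1E; apply: starM.
    by rewrite -!starM' BC CB star0 // linear0 scaler0 scalerN scaleNr.
  have := pa_br pa (inL_od B 0) (inL_od 0 C).
  rewrite F1 F2 bE c'E b'E cE !scomm_od.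
  rewrite !(mul0mx, mulmx0, addr0) BC CB.
  rewrite -!scalemxAl -!scalemxAr !scalerA st.1 st.2 BC CB scaler0 addr0 -scalerDl.
  have evL x : \tr (ev (x *: B) 0 : M) = 0.
    by rewrite /ev mxtrace_block linearZ /= trB mulr0 t0 addr0.
  have evB0 : \tr (ev B 0 : M) = 0 by rewrite -[B]scale1r evL.
  rewrite (Lproj_id evB0) Lproj_id ?evL // Fev //.
  case/ev_inj=> E0 _; move: E0 => /matrixP/(_ 0 j); by rewrite !mxE !eqxx /= mulr1 => <-.
- by move=> n1; split; [apply: b'0|apply: c'0].
move=> B C; have -> : od B C = od B 0 + od 0 C :> M.
  by rewrite -[od B 0]scale1r -odD !scale1r addr0 add0r.
rewrite linearD /= F1 F2 bE c'E b'E cE -[od (b *: B) _]scale1r -odD !scale1r //.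
Qed.

End OddPart.

(** * Models of the gradings *)

Section Model.
Variables (F : fieldType) (charF0 : [pchar F] =i pred0) (G : zmodType) (n : nat).
Local Notation r := n.+1.
Local Notation M := 'M[F]_(n.+1 + n.+1).
Local Notation Gs := (G * 'Z_2)%type.
Local Notation par := (@mx_par F n.+1).

(* A presentation of M_k(D) inside the matrix algebra: [E i j] is the matrix
   unit E_ij and [U t] the diagonal matrix X_t. *)
Record model (T : {fset Gs}) (beta : Gs -> Gs -> F) (k : nat)
    (E : 'I_k -> 'I_k -> M) (U : Gs -> M) : Prop := {
  md_bc : bichar T beta;
  md_E : forall i j l m, E i j *m E l m = if j == l then E i m else 0;
  md_1 : \sum_i E i i = 1%:M;
  md_EU : forall i j t, t \in T -> E i j *m U t = U t *m E i j;
  md_UU : {in T &, forall s t, exists2 c, c != 0 & U s *m U t = c *: U (s + t)};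
  md_comm : {in T &, forall s t, U s *m U t = beta s t *: (U t *m U s)};
  md_U0 : U 0 = 1%:M;
  md_Epar : forall i j, E i j \in par 0;
  md_Upar : {in T, forall t, U t \in par t.2};
  md_dim : (k * k * #|` T| = (r + r) * (r + r))%N }.

Section Theory.
Variables (T : {fset Gs}) (beta : Gs -> Gs -> F) (k : nat).
Variables (E : 'I_k -> 'I_k -> M) (U : Gs -> M).
Hypothesis md : model T beta E U.

Let bc := md_bc md.

Lemma md_k0 : (0 < k)%N.
Proof.
rewrite lt0n; apply/eqP=> k0; have := md_dim md; rewrite k0 mul0n => /esym/eqP.
by rewrite muln_eq0 addn_eq0.
Qed.

Lemma md_unit t : t \in T -> U t \in unitmx.
Proof.
move=> tT; have [c c0 E1] := md_UU md tT (bcN bc tT).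
rewrite subrr (md_U0 md) in E1.
have : U t *m (c^-1 *: U (- t)) = 1%:M by rewrite -scalemxAr E1 scalerA mulVf ?scale1r.
by case/mulmx1_unit.
Qed.

Lemma md_inv t : t \in T -> exists2 c, c != 0 & invmx (U t) = c *: U (- t).
Proof.
move=> tT; have [c c0 E1] := md_UU md tT (bcN bc tT).
rewrite subrr (md_U0 md) in E1; exists c^-1; first by rewrite invr_eq0.
rewrite -[RHS](mulKmx (md_unit tT)) -scalemxAr E1 scalerA mulVf ?scale1r //.
by rewrite mulmx1.
Qed.

Lemma md_invE i j t : t \in T -> invmx (U t) *m E i j = E i j *m invmx (U t).
Proof.
move=> tT; have Ut := md_unit tT.
rewrite -[LHS]mulmx1 -(mulmxV Ut) !mulmxA -[invmx _ *m _ *m _]mulmxA (md_EU md) //.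
by rewrite mulKmx.
Qed.

Lemma md_par i j t : t \in T -> E i j *m U t \in par t.2.
Proof. by move=> tT; have := mx_parM (md_Epar md i j) (md_Upar md tT); rewrite add0r. Qed.

(** The common trace of the [E i i]; by [md_dim] it is the square root of |T|. *)
Definition md_lam : F := (r + r)%:R / k%:R.

Lemma md_lam_neq0 : md_lam != 0.
Proof.
by rewrite mulf_neq0 ?invr_eq0 ?natF_eq0 // -?lt0n ?md_k0 // addn_gt0.
Qed.

(** Nondegeneracy gives s with beta s t different from 1, and conjugation by U s multiplies the
    matrix by beta s t without changing its trace. *)
Lemma md_trU i j t : t \in T -> t != 0 -> \tr (E i j *m U t) = 0.
Proof.
move=> tT t0.
have [s sT st] : exists2 s, s \in T & beta s t != 1.
  have [/hasP[s sT s1]|/hasPn no] := boolP (has (fun s => beta t s != 1) T).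
    exists s => //; apply: contra s1 => /eqP s1.
    by have := bc_swap bc tT sT; rewrite s1 mulr1 => ->.
  case/eqP: t0; apply: (bc_nondeg bc tT) => s sT.
  by apply/eqP; have := no s sT; rewrite negbK.
have Us := md_unit sT; have : \tr (E i j *m U t) = beta s t * \tr (E i j *m U t).
  rewrite -{1}[E i j *m U t](mulKmx Us) mxtrace_mulC mulmxA -(md_EU md _ _ sT).
  rewrite -(mulmxA _ (U s)) (md_comm md sT tT) -scalemxAr -scalemxAl mxtraceZ.
  by rewrite mulmxA mulmxK.
move/eqP; rewrite -[X in X == _]mul1r -subr_eq0 -mulrBl mulf_eq0 subr_eq0 eq_sym.
by rewrite (negPf st) => /eqP.
Qed.

Lemma md_trE i j : \tr (E i j) = if i == j then md_lam else 0.
Proof.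
have [<-|ij] := eqVneq i j; last first.
  have -> : E i j = E i i *m E i j by rewrite (md_E md) eqxx.
  by rewrite mxtrace_mulC (md_E md) eq_sym (negPf ij) mxtrace0.
have trE l : \tr (E l l) = \tr (E i i).
  have -> : E l l = E l i *m E i l by rewrite (md_E md) eqxx.
  by rewrite mxtrace_mulC (md_E md) eqxx.
have := congr1 mxtrace (md_1 md); rewrite raddf_sum /= mxtrace1 => trN.
rewrite /md_lam -trN (eq_bigr (fun=> \tr (E i i))) => [|l _]; last exact: trE.
by rewrite sumr_const card_ord -[_ *+ k]mulr_natr mulfK // natF_eq0 // -lt0n md_k0.
Qed.

(** The coefficient of a on [E i j *m U t], computed by the trace form: [invmx (U t) *m E j i],
    divided by [md_lam], is the dual basis. *)
Definition kap i j t (a : M) : F^o := \tr (a *m (invmx (U t) *m E j i)) / md_lam.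

Lemma kap_linear i j t : linear (kap i j t).
Proof.
move=> c a b; rewrite /kap mulmxDl -scalemxAl mxtraceD mxtraceZ mulrDl -mulrA.
by [].
Qed.

HB.instance Definition _ i j t :=
  GRing.isLinear.Build F M F^o _ (kap i j t) (kap_linear i j t).

Lemma kapE i j t i' j' t' : t \in T -> t' \in T ->
  kap i j t (E i' j' *m U t') = ([&& i == i', j == j' & t == t'])%:R.
Proof.
move=> tT t'T; rewrite /kap md_invE // mulmxA.
have -> : E i' j' *m U t' *m E j i *m invmx (U t) =
          E i' j' *m E j i *m (U t' *m invmx (U t)).
  by rewrite -!mulmxA; congr (_ *m _); rewrite !mulmxA (md_EU md).
rewrite (md_E md) [j == j']eq_sym; case: eqVneq => [_|_]; last first.
  by rewrite mul0mx mxtrace0 mul0r andbF.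
have [->|tt] := eqVneq t t'.
  rewrite mulmxV ?md_unit // mulmx1 md_trE [i == i']eq_sym.
  by case: eqVneq; rewrite ?mul0r // mulfV // md_lam_neq0.
have [c c0 ->] := md_inv tT.
have [d d0 Ed] := md_UU md t'T (bcN bc tT).
rewrite -scalemxAr Ed scalerA -scalemxAr mxtraceZ md_trU ?mulr0 ?mul0r ?andbF //.
  exact: (bcB bc).
by rewrite subr_eq0 eq_sym.
Qed.

Local Notation I := ('I_k * 'I_k * T)%type.

(** Duality makes the coefficient map onto, and [md_dim] then makes it injective; both sides have
    the same coefficients. *)
Lemma kap_sum a : a = \sum_(x : I) kap x.1.1 x.1.2 (val x.2) a *:
  (E x.1.1 x.1.2 *m U (val x.2)).
Proof.
pose b (x : I) := E x.1.1 x.1.2 *m U (val x.2).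
pose kp (a : M) : {ffun I -> F^o} := [ffun x : I => kap x.1.1 x.1.2 (val x.2) a].
have kpl : linear kp.
  by move=> c u v; apply/ffunP=> x; rewrite !ffunE linearP.
pose L := GRing.isLinear.Build F M {ffun I -> F^o} _ kp kpl.
pose K : {linear M -> {ffun I -> F^o}} := HB.pack kp L.
have kb x y : kap y.1.1 y.1.2 (val y.2) (b x) = (y == x)%:R.
  rewrite kapE ?fsvalP //; congr (_%:R); case: x y => [[i j] t] [[i' j'] t'] /=.
  by rewrite !xpair_eqE val_eqE andbA.
have Kb (f : {ffun I -> F^o}) : K (\sum_x f x *: b x) = f.
  apply/ffunP=> y; rewrite ffunE linear_sum (bigD1 y) //= big1 => [|x xy].
    by rewrite linearZ /= kb eqxx addr0; apply: mulr1.
  by rewrite linearZ /= kb eq_sym (negPf xy); apply: mulr0.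
have ker0 : lker (linfun K) = 0%VS.
  have := limg_ker_dim (linfun K) fullv.
  have -> : (linfun K @: fullv)%VS = fullv.
    apply/vspaceP=> f; rewrite memvf; apply/memv_imgP.
    by exists (\sum_x f x *: b x); rewrite ?memvf // lfunE Kb.
  rewrite capfv !dimvf dim_matrix => D; apply/eqP; rewrite -dimv_eq0.
  have dimI : dim {ffun I -> F^o} = (#|{: I}| * 1)%N by [].
  move: D; rewrite dimI !card_prod !card_ord -cardfE.
  rewrite (md_dim md) muln1 => /eqP.
  by rewrite -[X in _ == X]add0n eqn_add2r.
apply/eqP; rewrite -subr_eq0 -memv0 -ker0 memv_ker lfunE linearB /=.
rewrite subr_eq0; apply/eqP.
have := Kb (kp a); rewrite /=.
move=> {1}<-; congr kp.
by apply: eq_bigr => x _; rewrite ffunE.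
Qed.

Lemma kap_ext a b : (forall i j t, t \in T -> kap i j t a = kap i j t b) -> a = b.
Proof.
move=> ab; rewrite [a]kap_sum [b]kap_sum; apply: eq_bigr => x _.
by rewrite ab ?fsvalP.
Qed.

(** Only basis elements that occur in a have to be treated, so hypotheses on the degree or parity of
    a apply to them. *)
Lemma kap_ind (P : M -> Prop) a :
  P 0 -> (forall c x y, P x -> P y -> P (c *: x + y)) ->
  (forall i j t, t \in T -> kap i j t a != 0 -> P (E i j *m U t)) -> P a.
Proof.
move=> P0 PD Pb; rewrite [a]kap_sum; elim/big_ind: _ => // [x y Px Py|x _].
  by rewrite -[x]scale1r; apply: PD.
have [->|kx] := eqVneq (kap x.1.1 x.1.2 (val x.2) a) 0; first by rewrite scale0r.
by rewrite -[_ *: _]addr0; apply: PD => //; apply: Pb => //; apply: fsvalP.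
Qed.

End Theory.
End Model.

Section Degrees.
Variables (F : fieldType) (charF0 : [pchar F] =i pred0) (G : zmodType) (n : nat).
Local Notation r := n.+1.
Local Notation M := 'M[F]_(n.+1 + n.+1).
Local Notation Gs := (G * 'Z_2)%type.
Local Notation par := (@mx_par F n.+1).

Section Theory.
Variables (T : {fset Gs}) (beta : Gs -> Gs -> F) (k : nat).
Variables (E : 'I_k -> 'I_k -> M) (U : Gs -> M).
Hypothesis md : model T beta E U.
Variable g : 'I_k -> G.

Let bc := md_bc md.

(* For a model (E, U) and a tuple [g], [hmg h a] says that [a] is homogeneous of
   degree [h] in G x Z_2, and [hmG x a] that it is homogeneous of degree [x] in
   G. *)
Definition dg i j (t : Gs) : Gs := (g i + t.1 - g j, t.2).

Definition hmg (h : Gs) (a : M) : Prop :=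
  forall i j t, t \in T -> dg i j t != h -> kap E U i j t a = 0.

Definition hmG (x : G) (a : M) : Prop :=
  forall i j t, t \in T -> g i + t.1 - g j != x -> kap E U i j t a = 0.

Lemma hmG0 x : hmG x 0. Proof. by move=> i j t _ _; rewrite linear0. Qed.

Lemma hmGD x c a b : hmG x a -> hmG x b -> hmG x (c *: a + b).
Proof.
move=> ha hb i j t tT ne; rewrite linearP /= ha // hb // addr0; exact: mulr0.
Qed.

Lemma hmg0 h : hmg h 0. Proof. by move=> i j t _ _; rewrite linear0. Qed.

Lemma hmgD h c a b : hmg h a -> hmg h b -> hmg h (c *: a + b).
Proof.
move=> ha hb i j t tT ne; rewrite linearP /= ha // hb // addr0; exact: mulr0.
Qed.

Lemma hmgZ h c a : hmg h a -> hmg h (c *: a).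
Proof. by move=> ha; rewrite -[c *: a]addr0; apply: hmgD => //; apply: hmg0. Qed.

Lemma hmg_basis i j t : t \in T -> hmg (dg i j t) (E i j *m U t).
Proof.
move=> tT i' j' t' t'T ne; rewrite (kapE charF0 md) //.
by case: and3P => // -[/eqP Ei /eqP Ej /eqP Et]; rewrite Ei Ej Et eqxx in ne.
Qed.

Lemma md_mul_basis i j s l m t : s \in T -> t \in T ->
  exists c, (E i j *m U s) *m (E l m *m U t) =
    (if j == l then c *: (E i m *m U (s + t)) else 0) /\ c != 0.
Proof.
move=> sT tT; have [c c0 Est] := md_UU md sT tT; exists c; split=> //.
rewrite mulmxA -(mulmxA (E i j)) -(md_EU md) // mulmxA -mulmxA Est (md_E md).
by case: eqP => _; rewrite ?mul0mx // scalemxAr.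
Qed.

Lemma hmgM h h' a b : hmg h a -> hmg h' b -> hmg (h + h') (a *m b).
Proof.
move=> ha hb; apply: (kap_ind charF0 md
    (P := fun a => hmg (h + h') (a *m b)) (a := a)) => [|c x y Px Py|i j s sT ks].
- by rewrite mul0mx; apply: hmg0.
- by rewrite mulmxDl -scalemxAl; apply: hmgD.
have hE : dg i j s = h by apply/eqP; apply: contraNT ks => ne; rewrite ha.
apply: (kap_ind charF0 md
    (P := fun b => hmg (h + h') ((E i j *m U s) *m b)) (a := b)) => [|c x y Px Py|l m t tT kt].
- by rewrite mulmx0; apply: hmg0.
- by rewrite mulmxDr -scalemxAr; apply: hmgD.
have hE' : dg l m t = h' by apply/eqP; apply: contraNT kt => ne; rewrite hb.
have [c [-> c0]] := md_mul_basis i j l m sT tT.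
case: eqP => [jl|_]; last exact: hmg0.
have -> : h + h' = dg i m (s + t).
  rewrite -hE -hE' -jl; congr (_, _) => /=.
  by rewrite !addrA addrNK.
by apply: hmgZ; apply: hmg_basis; apply: (bcD bc).
Qed.

Lemma kap_par p a : a \in par p -> forall i j t, t \in T ->
  kap E U i j t a != 0 -> t.2 = p.
Proof.
move=> ap i j t tT; apply: contraNeq => tp.
have /mx_parP <- := ap.
pose P b := kap E U i j t (mx_part p b) == 0; change (P a).
apply: (kap_ind charF0 md (P := P)) => [|c x y Px Py|i' j' t' t'T kt]; rewrite /P.
- by rewrite !linear0.
- rewrite linearP linearP /= (eqP Px) (eqP Py) addr0; apply/eqP; exact: mulr0.
have bp := md_par md i' j' t'T.
have [tp'|tp'] := eqVneq t'.2 p; last first.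
  by rewrite (mx_part_neq bp) 1?eq_sym // linear0.
move: bp; rewrite tp' => /mx_parP->; rewrite (kapE charF0 md) //.
by case: and3P => // -[_ _ /eqP Et]; rewrite Et tp' eqxx in tp.
Qed.

Lemma hmg_par h a : hmg h a -> a \in par h.2.
Proof.
move=> ha; apply: (kap_ind charF0 md
  (P := fun a => a \in par h.2) (a := a)) => [|c x y Px Py|i j t tT kt].
- exact: mem0v.
- by rewrite rpredD ?rpredZ.
have <- : dg i j t = h by apply/eqP; apply: contraNT kt => ne; rewrite ha.
exact: (md_par md).
Qed.

Lemma hmgP h a : hmg h a <-> hmG h.1 a /\ a \in par h.2.
Proof.
split=> [ha|[ha ap] i j t tT ne].
  split; last exact: hmg_par.
  move=> i j t tT ne; apply: ha => //; apply: contra ne => /eqP <- //.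
have [//|kt] := eqVneq (kap E U i j t a) 0.
apply: ha => //; apply: contra ne => /eqP E1.
by rewrite /dg E1 (kap_par ap tT kt); case: (h).
Qed.

Lemma hmG_basis i j t : t \in T -> hmG (dg i j t).1 (E i j *m U t).
Proof. by move=> tT; have /hmgP[] := hmg_basis (i:=i) (j:=j) tT. Qed.

(** Among the basis elements only the [E i i], of degree 0, have nonzero trace. *)
Lemma hmG_tr x a : hmG x a -> \tr a != 0 -> x = 0.
Proof.
move=> ha; apply: contraNeq => x0; apply/eqP.
apply/eqP; apply: (kap_ind charF0 md
  (P := fun a => \tr a == 0) (a := a)) => [|c y z Py Pz|i j t tT kt].
- by rewrite mxtrace0.
- by rewrite mxtraceD mxtraceZ (eqP Py) (eqP Pz) mulr0 addr0.
have [t0|t0] := eqVneq t 0; last by rewrite (md_trU md) ?eqxx.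
rewrite t0 (md_U0 md) mulmx1 (md_trE charF0 md).
have [ij|_] := eqVneq i j; last by rewrite eqxx.
by case/eqP: kt; apply: ha => //; rewrite t0 ij addr0 subrr eq_sym.
Qed.

Lemma hmG1 : hmG 0 1%:M.
Proof.
rewrite -(md_1 md); elim/big_ind: _ => [|a b ha hb|i _]; first exact: hmG0.
  by rewrite -[a]scale1r; apply: hmGD.
have := hmG_basis (i:=i) (j:=i) (bc0 bc); rewrite (md_U0 md) mulmx1 /dg /= addr0 subrr.
exact.
Qed.

Definition Smx : M := ev 1%:M (- 1%:M).

Lemma SmxS : Smx *m Smx = 1%:M.
Proof. by rewrite mul_ev !mulmx1 mulNmx mulmxN opprK mulmx1 ev_1. Qed.

Lemma Smx_comm p (x : M) : x \in par p -> Smx *m x = (-1) ^+ p *: (x *m Smx).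
Proof.
case: (Z2P p) => -> /=.
  case/par0_ev=> X [Y ->]; rewrite !mul_ev expr0 scale1r mul1mx mulmx1.
  by rewrite mulNmx mulmxN mul1mx mulmx1.
case/par1_od=> X [Y ->]; rewrite mul_ev_od mul_od_ev expr1 scaleN1r oppod.
by rewrite mul1mx mulmx1 mulNmx mulmxN mul1mx mulmx1 opprK.
Qed.

Lemma Z2signD (p q : 'Z_2) : (-1) ^+ (p + q)%R = (-1) ^+ p * (-1) ^+ q :> F.
Proof.
by case: (Z2P p) => ->; case: (Z2P q) => ->; rewrite /= ?expr0 ?expr1 ?mul1r ?mulr1 ?mulN1r ?opprK.
Qed.

(** The parity sign is a character of T, hence equals beta s for some s. Then [Smx *m U s] commutes
    with the whole basis, so it is scalar. *)
Lemma Smx_hom : exists s, [/\ s \in T, s.2 = 0, s + s = 0 &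
  exists2 c, c != 0 & U s = c *: Smx].
Proof.
have [s sT sE] : exists2 s, s \in T & {in T, forall t : Gs, (-1) ^+ t.2 = beta s t}.
  apply: (char_bichar charF0 bc (chi := fun t : Gs => (-1) ^+ t.2)).
    by move=> t _; rewrite signr_eq0.
  by move=> u v _ _; rewrite -Z2signD.
have [|c cE] := @mx_scalar_cent _ _ (Smx *m U s).
  move=> a; apply/eqP; apply: (kap_ind charF0 md
    (P := fun a => Smx *m U s *m a == a *m (Smx *m U s)) (a := a)) => [|d x y Px Py|i j t tT _].
  - by rewrite mulmx0 mul0mx.
  - by rewrite mulmxDr mulmxDl -scalemxAr -scalemxAl (eqP Px) (eqP Py).
  have bp := md_par md i j tT.
  have Ub : U s *m (E i j *m U t) = (-1) ^+ t.2 *: (E i j *m U t *m U s).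
    rewrite mulmxA -(md_EU md) // -mulmxA (md_comm md) // -sE // -scalemxAr.
    by rewrite mulmxA.
  rewrite -mulmxA Ub -scalemxAr [Smx *m (_ *m U s)]mulmxA (Smx_comm bp) -scalemxAl scalerA.
  by rewrite -expr2 sqrr_sign scale1r mulmxA.
have UE : U s = c *: Smx.
  by rewrite -[U s]mul1mx -SmxS -mulmxA cE mul_mx_scalar.
have Us := md_unit md sT.
have c0 : c != 0.
  apply: contraTneq Us => c0; rewrite UE c0 scale0r unitmxE det0 ?unitr0 //.
have s2 : s.2 = 0.
  apply/eqP; rewrite eq_sym; apply: contraTT Us => s2.
  have U0 : U s \in par 0 by rewrite UE rpredZ // ev_par.
  have /mx_parP <- := md_Upar md sT; rewrite (mx_part_neq U0) 1?eq_sym //.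
  by rewrite unitmxE det0 ?unitr0.
exists s; split=> //; last by exists c.
apply: (bc_nondeg bc (bcD bc sT sT)) => t tT; rewrite (bc_mull bc) //.
by rewrite -sE // -expr2 sqrr_sign.
Qed.

Lemma strE (b : M) : str b = \tr (Smx *m b).
Proof.
rewrite -[b in RHS]submxK /Smx /ev mulmx_block !(mul0mx, mul1mx, addr0, add0r).
by rewrite mxtrace_block mulNmx mul1mx linearN.
Qed.

(** The supertrace is the trace after multiplication by S, and S is proportional to U s; so only the
    [E i i *m U s] contribute. *)
Lemma md_str s i j t : s \in T -> s + s = 0 -> (exists2 c, c != 0 & U s = c *: Smx) ->
  t \in T -> (i != j) || (t != s) -> str (E i j *m U t) = 0.
Proof.
move=> sT ss [c c0 Us] tT ijt; rewrite strE.
have -> : Smx = c^-1 *: U s by rewrite Us scalerA mulVf // scale1r.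
rewrite -scalemxAl mulmxA -(md_EU md) // -mulmxA; have [e e0 ->] := md_UU md sT tT.
rewrite -scalemxAr !mxtraceZ; have [t0|t0] := eqVneq (s + t) 0; last first.
  by rewrite (md_trU md) ?(bcD bc) // !mulr0.
have ts : t = s by apply: (addrI s); rewrite t0 ss.
rewrite t0 (md_U0 md) mulmx1 (md_trE charF0 md); move: ijt; rewrite ts eqxx orbF.
by move/negPf->; rewrite !mulr0.
Qed.

Lemma hmG_str x a s : s \in T -> s + s = 0 -> (exists2 c, c != 0 & U s = c *: Smx) ->
  hmG x a -> str a != 0 -> x = s.1.
Proof.
move=> sT ss Us ha; apply: contraNeq => xs; apply/eqP.
apply/eqP; apply: (kap_ind charF0 md
  (P := fun a => str a == 0) (a := a)) => [|d y z Py Pz|i j t tT kt].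
- by rewrite linear0.
- by rewrite linearP /= (eqP Py) (eqP Pz) addr0; apply/eqP; apply: mulr0.
apply/eqP; apply: (md_str sT ss Us tT); apply: contraNT kt.
rewrite negb_or !negbK => /andP[/eqP ij /eqP ts]; apply/eqP; apply: ha => //.
by rewrite ts ij addrAC subrr add0r eq_sym.
Qed.

End Theory.

End Degrees.

Section GammaModel.
Variables (F : fieldType) (charF0 : [pchar F] =i pred0) (G : zmodType) (n : nat).
Local Notation r := n.+1.
Local Notation M := 'M[F]_(n.+1 + n.+1).
Local Notation Gs := (G * 'Z_2)%type.
Local Notation par := (@mx_par F n.+1).

Lemma gamma_model (T : {fset Gs}) beta k (gamma : k.-tuple G) (Gr : G -> {vspace M}) :
  bicharacter_datum T beta -> size_condition n T k -> is_Gamma T beta gamma Gr ->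
  exists E U, model T beta E U /\
    forall i j t, t \in T ->
      E i j *m U t \in Gr (tnth gamma i + t.1 - tnth gamma j).
Proof.
move=> bd [l lT kl] [gr [D [Dc [phi [gd [[psi phiK psiK] phiL phiM phideg]]]]]].
have bc : bichar T beta by have [? ? ? ? ? ? ?] := bd.
have [[_ mulD] unitD suppD dimD commD] := gd.
have map1 (A : 'M[D]_k) : map_mx ( *:%R (1 : F)) A = A.
  by apply/matrixP=> i j; rewrite mxE scale1r.
have phiD A B : phi (A + B) = phi A + phi B.
  by have := phiL 1 A B; rewrite map1 scale1r.
have phi0 : phi 0 = 0 by apply: (addIr (phi 0)); rewrite -phiD !add0r.
have phiZ a A : phi (map_mx ( *:%R a) A) = a *: phi A.
  by rewrite -[map_mx _ A]addr0 phiL phi0 addr0.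
have phi1 : phi 1%:M = 1%:M.
  by rewrite -[LHS]mulmx1 -[X in _ *m X = _](psiK 1%:M) -phiM mul1mx psiK.
have line t (x : D) : t \in T -> x \in Dc t -> x != 0 -> Dc t = <[x]>%VS.
  move=> tT xt x0; apply/esym/eqP; rewrite eqEdim -memvE xt dim_vline x0.
  by rewrite dimD.
have T0 := bc0 bc.
(* A nonzero x of degree 0 is invertible and x * x is a multiple c x, so x is c times 1. *)
have D1 : (1 : D) \in Dc 0.
  pose x := vpick (Dc 0); have x0 : x != 0 by rewrite vpick0 suppD.
  have xD : x \in Dc 0 by apply: memv_pick.
  have xu := unitD _ _ xD x0.
  have : x * x \in Dc 0 by rewrite -[0 : Gs]addr0 mulD.
  rewrite (line 0 x) // => /vlineP[c cE].
  have xc : x = c%:A by apply: (mulrI xu); rewrite cE -scalerAr mulr1.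
  have c0 : c != 0 by apply: contra x0 => /eqP c0; rewrite xc c0 scale0r.
  by apply/vlineP; exists c^-1; rewrite [in RHS]xc scalerA mulVf // scale1r.
have n1 : (1 : D) != 0.
  have : vpick (Dc 0) != 0 by rewrite vpick0 suppD.
  by apply: contraNneq => e; rewrite -[vpick _]mulr1 e mulr0.
(* Degree 0 is normalized to 1, as [md_U0] demands; in the other degrees any nonzero element will
   do. *)
pose X t : D := if t == 0 then 1 else vpick (Dc t).
have Xt t : X t \in Dc t by rewrite /X; case: eqP => [->|_]; rewrite ?memv_pick.
have X0 t : t \in T -> X t != 0.
  by rewrite /X; case: (t =P 0) => [_ _|_ tT]; [exact: n1|rewrite vpick0 suppD].
have Xu t : t \in T -> X t \is a GRing.unit by move=> tT; apply: (unitD t); rewrite ?X0.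
pose E i j := phi (delta_mx i j); pose U t := phi (X t)%:M.
have dE i j (d : D) : delta_mx i j *m d%:M = d *: delta_mx i j :> 'M[D]_k.
  apply/matrixP=> a b; rewrite !mxE (bigD1 b) //= big1 ?addr0 => [|c cb].
    rewrite !mxE eqxx mulr1n; case: (_ && _); rewrite ?mul1r ?mulr1 //.
    by rewrite mul0r mulr0.
  by rewrite !mxE (negPf cb) mulr0n mulr0.
have EUphi i j t : E i j *m U t = phi (X t *: delta_mx i j) by rewrite -phiM dE.
have EUdeg i j t : E i j *m U t
    \in (Gr (tnth gamma i + t.1 - tnth gamma j) :&: par t.2)%VS.
  by rewrite EUphi; apply: phideg.
have phisum (I : finType) (f : I -> 'M[D]_k) : phi (\sum_i f i) = \sum_i phi (f i).
  exact: (big_morph phi phiD phi0).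
exists E, U; split; last by move=> i j t tT; have /memv_capP[] := EUdeg i j t.
split.
- exact: bc.
- move=> i j l' m; rewrite -phiM mul_delta_mx_cond; case: eqP => _ //.
- rewrite -phisum -phi1; congr phi; rewrite (scalar_mx_sum_delta _ 1).
  by apply: eq_bigr => i _; rewrite scale1r.
- by move=> i j t tT; rewrite EUphi -phiM mul_scalar_mx.
- move=> s t sT tT.
  have XX : X s * X t \in Dc (s + t) by apply: mulD.
  have stT := bcD bc sT tT.
  move: XX; rewrite (line (s + t) (X (s + t))) ?X0 // => /vlineP[c cE].
  exists c.
    have : X s * X t \is a GRing.unit by rewrite unitrMl ?Xu.
    by apply: contraTneq => c0; rewrite cE c0 scale0r unitr0.
  rewrite -phiM -scalar_mxM cE -phiZ; congr phi; apply/matrixP=> i j.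
  by rewrite !mxE scalerMnr.
- move=> s t sT tT; rewrite -!phiM -!scalar_mxM.
  rewrite (commD s t sT tT (X s) (X t)) // -phiZ; congr phi; apply/matrixP=> i j.
  by rewrite !mxE scalerMnr.
- by rewrite /U /X eqxx.
- move=> i j; rewrite -[E i j]mulmx1; have := EUdeg i j 0.
  by rewrite /U /X eqxx phi1 => /memv_capP[].
- move=> t tT; rewrite /U scalar_mx_sum_delta phisum rpred_sum // => i _.
  by have := EUdeg i i t; rewrite EUphi => /memv_capP[].
by rewrite -lT -mulnn mulnACA kl mul2n addnn.
Qed.

End GammaModel.

(** By induction on the list: the eigenspace of the head inside V is stable under the rest of the
    list, which commutes with it. *)
Lemma common_eigen (F : fieldType) N (L : seq 'M[F]_N) (V : 'M[F]_N) :
  has_eigen F -> V != 0 -> (forall A, A \in L -> (V *m A <= V)%MS) ->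
  {in L &, forall A B, A *m B = B *m A} ->
  exists v : 'rV_N, [/\ v != 0, (v <= V)%MS &
    forall A, A \in L -> exists a, v *m A = a *: v].
Proof.
move=> eigF; elim: L V => [|A L IHL] V V0 stV comL.
  by exists (nz_row V); rewrite nz_row_eq0 nz_row_sub; split.
pose B := row_base V; have VA : (B *m A <= B)%MS.
  rewrite eq_row_base (eqmxMr A (eq_row_base V)); apply: stV; exact: mem_head.
have rV : (0 < \rank V)%N by rewrite lt0n mxrank_eq0.
have [a [w [wE w0]]] := eigF _ (B *m A *m pinvmx B) rV.
have wBA : w *m B *m A = a *: (w *m B).
  by rewrite -[in LHS]mulmxA -(mulmxKpV VA) mulmxA wE scalemxAl.
have wB0 : w *m B != 0.
  apply: contra w0 => /eqP wB; apply/eqP.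
  by apply: (row_free_inj (row_base_free V)); rewrite wB mul0mx.
pose V' : 'M[F]_N := (V :&: eigenspace A a)%MS.
have wV' : (w *m B <= V')%MS.
  rewrite sub_capmx; apply/andP; split; last exact/eigenspaceP.
  by rewrite -(eq_row_base V) submxMl.
have [|||v [v0 vV' vL]] := IHL V'.
- by apply: contraTneq wV' => ->; rewrite submx0.
- move=> C CL; rewrite sub_capmx; apply/andP; split.
    apply: submx_trans (submxMr _ (capmxSl _ _)) _.
    by apply: stV; rewrite inE CL orbT.
  apply/eigenspaceP; rewrite -mulmxA.
  rewrite (comL C A) ?inE ?eqxx ?CL ?orbT // mulmxA.
  have /eigenspaceP -> := capmxSr V (eigenspace A a).
  by rewrite scalemxAl.
- by move=> A1 A2 A1L A2L; apply: comL; rewrite inE ?A1L ?A2L orbT.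
exists v; split=> //; first exact: submx_trans vV' (capmxSl _ _).
move=> C; rewrite inE => /orP[/eqP->|/vL//].
by exists a; apply/eigenspaceP; apply: submx_trans vV' (capmxSr _ _).
Qed.

(** * Transport and equivalence of models *)

Section Transfer.
Variables (F : fieldType) (charF0 : [pchar F] =i pred0) (G : zmodType) (n : nat).
Local Notation r := n.+1.
Local Notation M := 'M[F]_(n.+1 + n.+1).
Local Notation Gs := (G * 'Z_2)%type.
Local Notation par := (@mx_par F n.+1).

Section Two.
Variables (T T' : {fset Gs}) (beta beta' : Gs -> Gs -> F) (k k' : nat).
Variables (E : 'I_k -> 'I_k -> M) (U : Gs -> M).
Variables (E' : 'I_k' -> 'I_k' -> M) (U' : Gs -> M).
Hypothesis md : model T beta E U.
Hypothesis md' : model T' beta' E' U'.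
Variables (g : 'I_k -> G) (g' : 'I_k' -> G).

Lemma hmG_map (L : 'End(M)) :
  (forall i j t, t \in T -> hmG T' E' U' g' (g i + t.1 - g j) (L (E i j *m U t))) ->
  forall x a, hmG T E U g x a -> hmG T' E' U' g' x (L a).
Proof.
move=> Lb x a ha; apply: (kap_ind charF0 md (P := fun a => hmG T' E' U' g' x (L a)) (a := a)).
- by rewrite linear0; apply: hmG0.
- by move=> c y z; rewrite linearP; apply: hmGD.
move=> i j t tT kt; have <- : g i + t.1 - g j = x; last exact: Lb.
by apply/eqP; apply: contraNT kt => ne; rewrite ha.
Qed.

(** For the converse, let ar be the part of a of degrees other than x. If L a has degree x, then L
    ar has no coefficient in degree x nor in any other, so ar = 0 by injectivity. *)
Lemma hmG_mapE (L : 'End(M)) : injective L ->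
  (forall i j t, t \in T -> hmG T' E' U' g' (g i + t.1 - g j) (L (E i j *m U t))) ->
  forall x a, hmG T E U g x a <-> hmG T' E' U' g' x (L a).
Proof.
move=> Linj Lb x a; split; first exact: hmG_map.
move=> hLa i j t tT ne.
pose I := ('I_k * 'I_k * T)%type.
pose tm (y : I) := kap E U y.1.1 y.1.2 (val y.2) a *: (E y.1.1 y.1.2 *m U (val y.2)).
pose dx (y : I) := g y.1.1 + (val y.2).1 - g y.1.2 == x.
pose ar := \sum_(y | ~~ dx y) tm y.
have aE : a = \sum_(y | dx y) tm y + ar by rewrite {1}(kap_sum charF0 md a) (bigID dx).
have hx : hmG T' E' U' g' x (L (\sum_(y | dx y) tm y)).
  rewrite linear_sum; elim/big_ind: _ => [|b c hb hc|y /eqP yx].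
  - exact: hmG0.
  - by rewrite -[b]scale1r; apply: hmGD.
  rewrite /tm linearZ /= -[_ *: _]addr0; apply: hmGD; last exact: hmG0.
  by rewrite -yx; apply: Lb; apply: fsvalP.
have Lar0 : L ar = 0.
  apply: (kap_ext charF0 md') => i' j' t' t'T; rewrite [RHS]linear0.
  have [xE|xN] := eqVneq (g' i' + t'.1 - g' j') x; last first.
    have -> : L ar = -1 *: L (\sum_(y | dx y) tm y) + L a.
      by rewrite [in RHS]aE linearD scaleN1r addrA addNr add0r.
    rewrite linearP /= hx // hLa // addr0; exact: mulr0.
  rewrite linear_sum linear_sum big1 // => y yx.
  rewrite /tm linearZ linearZ /= (Lb y.1.1 y.1.2 (val y.2)) ?fsvalP //.
    exact: mulr0.
  by rewrite xE eq_sym.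
have ar0 : ar = 0 by apply: Linj; rewrite Lar0 linear0.
rewrite aE ar0 addr0 linear_sum big1 // => y yx.
rewrite /tm linearZ /= (kapE charF0 md) ?fsvalP //.
case: and3P => [[/eqP ei /eqP ej /eqP et]|_]; last exact: mulr0.
by move/eqP: yx => yx; case/eqP: ne; rewrite ei ej et.
Qed.

End Two.

Lemma hmG_shift T k (E : 'I_k -> 'I_k -> M) U (g : 'I_k -> G) g0 x a :
  hmG T E U g x a <-> hmG T E U (fun i => g0 + g i) x a.
Proof.
have E0 i j (t : Gs) : g0 + g i + t.1 - (g0 + g j) = g i + t.1 - g j.
  by rewrite -[g0 + g i + t.1]addrA opprD addrACA subrr add0r.
by split=> ha i j t tT; [rewrite E0|rewrite -E0]; apply: ha.
Qed.

Section NiceTransport.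
Variables (T : {fset Gs}) (beta : Gs -> Gs -> F) (k : nat).
Variables (E : 'I_k -> 'I_k -> M) (U : Gs -> M).
Hypothesis md : model T beta E U.
Variables (e : bool) (Psi : 'End(M)) (nc : nice e Psi).

(** For e = true, Psi reverses products: transposing the indices restores the relations of matrix
    units, exchanging factors inverts beta, and the signs make up for Psi 1 = -1. *)
Definition tE i j : M := if e then - Psi (E j i) else Psi (E i j).
Definition tU t : M := (-1) ^+ e *: Psi (U t).
Definition tbeta u v : F := if e then (beta u v)^-1 else beta u v.

Lemma nice_inj : injective Psi.
Proof. by have [_ _ _ [Psi' [K _ _]]] := nc; apply: can_inj K. Qed.

Lemma tmodel : model T tbeta tE tU.
Proof.
have [[pp pm] p1 pt _] := nc; have bc := md_bc md; split.
- rewrite /tbeta; case: (e) => //; have [? neq0 ml mr al nd] := bc; split=> //.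
  + by move=> u v uT vT; rewrite invr_eq0 neq0.
  + by move=> u v w uT vT wT; rewrite ml // invfM.
  + by move=> u v w uT vT wT; rewrite mr // invfM.
  + by move=> u uT; rewrite al // invr1.
  move=> u uT u1; apply: nd => // v vT; apply: (can_inj invrK).
  by rewrite invr1; apply: u1.
- move=> i j l m; rewrite /tE; have Ep := md_Epar md.
  case: (e) pm => pm; rewrite ?mulNmx ?mulmxN ?opprK.
    have := pm 0 0 (E m l) (E j i) (Ep _ _) (Ep _ _); rewrite expr0 scaleN1r.
    move/(congr1 -%R); rewrite opprK => <-; rewrite (md_E md) eq_sym.
    by case: eqP => // _; rewrite linear0 oppr0.
  rewrite -(pm 0 0) // (md_E md); by case: eqP => // _; rewrite linear0.
- rewrite /tE; case: (e) p1 => p1.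
    rewrite sumrN -linear_sum (eq_bigr (fun i => E i i)) // (md_1 md) /= p1.
    by rewrite expr1 scaleN1r opprK.
  by rewrite -linear_sum (md_1 md) /= p1 scale1r.
- move=> i j t tT; rewrite /tE /tU -scalemxAl -scalemxAr; congr (_ *: _).
  have Ep := md_Epar md; have Up := md_Upar md tT.
  case: (e) pm => pm; rewrite ?mulNmx ?mulmxN.
    have := pm t.2 0 (U t) (E j i) Up (Ep _ _).
    have := pm 0 t.2 (E j i) (U t) (Ep _ _) Up.
    rewrite mul0n muln0 expr0 !scaleN1r (md_EU md) // => -> /oppr_inj ->.
    by [].
  by rewrite -(pm 0 t.2) // (md_EU md) // (pm t.2 0).
- move=> s t sT tT; have [c c0 Ec] := md_UU md sT tT.
  have Us := md_Upar md sT; have Ut := md_Upar md tT; rewrite /tU.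
  case: (e) pm => pm; last first.
    by exists c => //; rewrite !scale1r -(pm s.2 t.2) // Ec linearZ.
  have [d d0 Ed] := md_UU md tT sT.
  exists ((-1) ^+ (t.2 * s.2)%N * d).
    by rewrite mulf_neq0 ?signr_eq0.
  rewrite expr1 !scaleN1r mulNmx mulmxN opprK.
  have := pm t.2 s.2 _ _ Ut Us; rewrite Ed linearZ /= scaleNr => /(congr1 -%R).
  rewrite opprK => /(congr1 (fun z => (-1) ^+ (t.2 * s.2)%N *: z)).
  rewrite /= scalerA -expr2 sqrr_sign scale1r => <-.
  by rewrite !scalerN scalerA [s + t]addrC.
- move=> s t sT tT; have Us := md_Upar md sT; have Ut := md_Upar md tT.
  have tUU u v : tU u *m tU v = Psi (U u) *m Psi (U v).
    by rewrite /tU -scalemxAl -scalemxAr scalerA -expr2 sqrr_sign scale1r.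
  rewrite !tUU /tbeta.
  case: (e) pm => pm; last first.
    by rewrite -(pm s.2 t.2) // -(pm t.2 s.2) // (md_comm md) // linearZ.
  have := pm t.2 s.2 _ _ Ut Us; have := pm s.2 t.2 _ _ Us Ut.
  rewrite [(t.2 * s.2)%N]mulnC !scaleNr => E1 E2.
  have F1 : Psi (U s) *m Psi (U t) = - (-1) ^+ (s.2 * t.2)%N *: Psi (U t *m U s).
    by rewrite E2 scaleNr scalerN opprK scalerA -expr2 sqrr_sign scale1r.
  have F2 : Psi (U t) *m Psi (U s) = - (-1) ^+ (s.2 * t.2)%N *: Psi (U s *m U t).
    by rewrite E1 scaleNr scalerN opprK scalerA -expr2 sqrr_sign scale1r.
  rewrite F1 F2 (md_comm md sT tT) [Psi (beta s t *: _)]linearZ /= !scalerA; congr (_ *: _).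
  by rewrite mulrAC mulVf ?mul1r // (bc_neq0 bc).
- by rewrite /tU (md_U0 md) p1 scalerA -expr2 sqrr_sign scale1r.
- by move=> i j; rewrite /tE; case: (e); rewrite ?rpredN; apply: pp; apply: (md_Epar md).
- by move=> t tT; rewrite /tU rpredZ //; apply: pp; apply: (md_Upar md).
exact: (md_dim md).
Qed.

Variable g : 'I_k -> G.
Definition tg i : G := if e then - g i else g i.

Lemma tmodel_hmG x a : hmG T E U g x a <-> hmG T tE tU tg x (Psi a).
Proof.
have [[pp pm] p1 pt _] := nc; have bc := md_bc md.
apply: (hmG_mapE md tmodel) => [|i j t tT]; first exact: nice_inj.
have Ep := md_Epar md; have Up := md_Upar md tT.
have -> : g i + t.1 - g j = (if e then tg j + t.1 - tg i else tg i + t.1 - tg j).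
  rewrite /tg; case: (e) => //.
  by rewrite opprK [RHS]addrC [- g j + _]addrC addrA.
have [c ->] : exists c, Psi (E i j *m U t) =
    c *: (if e then tE j i *m tU t else tE i j *m tU t).
  rewrite /tE /tU; case: (e) pm => pm.
    exists (-1); rewrite (pm 0 t.2) // mul0n expr0 expr1 !scaleN1r mulNmx mulmxN opprK.
    congr (- _); have := pm 0 t.2 _ _ (Ep i j) Up; have := pm t.2 0 _ _ Up (Ep i j).
    by rewrite mul0n muln0 expr0 !scaleN1r (md_EU md) // => -> /oppr_inj.
  by exists 1; rewrite (pm 0 t.2) // !scale1r.
rewrite -[_ *: _]addr0; apply: hmGD; last exact: hmG0.
have hb i' j' : hmG T tE tU tg (tg i' + t.1 - tg j') (tE i' j' *m tU t).
  exact: (hmG_basis charF0 tmodel).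
by case: (e) => //; apply: hb.
Qed.

End NiceTransport.

End Transfer.

Section LinConj.
Variables (F : fieldType) (N : nat).

Lemma mul_vec_conj (P Q Z : 'M[F]_N) :
  mxvec Z *m lin_mx (mxconj P Q) = mxvec (P *m Z *m Q).
Proof. by rewrite mul_vec_lin. Qed.

Lemma lin_conj_eq (P Q P' Q' : 'M[F]_N) :
  (forall Z, P *m Z *m Q = P' *m Z *m Q') ->
  lin_mx (mxconj P Q) = lin_mx (mxconj P' Q').
Proof.
move=> E; apply/row_matrixP=> i; rewrite !rowE -(vec_mxK (delta_mx 0 i)).
by rewrite !mul_vec_conj E.
Qed.

Lemma lin_conj_mul (P Q P' Q' : 'M[F]_N) :
  lin_mx (mxconj P Q) *m lin_mx (mxconj P' Q') =
  lin_mx (mxconj (P' *m P) (Q *m Q')).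
Proof.
apply/row_matrixP=> i; rewrite !rowE mulmxA -(vec_mxK (delta_mx 0 i)).
by rewrite !mul_vec_conj !mulmxA.
Qed.

End LinConj.

Section Intertwiner.
Variables (F : fieldType) (charF0 : [pchar F] =i pred0) (eigF : has_eigen F).
Variables (G : zmodType) (n : nat).
Local Notation r := n.+1.
Local Notation M := 'M[F]_(n.+1 + n.+1).
Local Notation Gs := (G * 'Z_2)%type.
Local Notation par := (@mx_par F n.+1).

Section Models.
Variables (T : {fset Gs}) (beta : Gs -> Gs -> F) (k : nat).
Variables (E : 'I_k -> 'I_k -> M) (U : Gs -> M) (E' : 'I_k -> 'I_k -> M) (U' : Gs -> M).
Hypotheses (md : model T beta E U) (md' : model T beta E' U').

Let bc := md_bc md.

Lemma md_comm_inv s t : s \in T -> t \in T ->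
  invmx (U' s) *m invmx (U' t) = (beta t s)^-1 *: (invmx (U' t) *m invmx (U' s)).
Proof.
move=> sT tT; have us := md_unit md' sT; have ut := md_unit md' tT.
have ust : U' s *m U' t \in unitmx by rewrite unitmx_mul us.
have b0 := bc_neq0 bc tT sT.
have E1 : U' t *m U' s *m (invmx (U' s) *m invmx (U' t)) = 1%:M.
  by rewrite mulmxA mulmxK // mulmxV.
have E2 : U' s *m U' t *m (invmx (U' t) *m invmx (U' s)) = 1%:M.
  by rewrite mulmxA mulmxK // mulmxV.
have := E1; rewrite (md_comm md') // -scalemxAl => /(congr1 (fun Z => (beta t s)^-1 *: Z)).
rewrite scalerA mulVf // scale1r => E3.
rewrite -[LHS](mulKmx ust) E3 -E2 scalemxAr.
by rewrite mulKmx.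
Qed.

(* Since both models have the same [beta], the maps [Z |-> U t *m Z *m (U' t)^-1]
   commute; Y is built from a common eigenvector of them. *)
Lemma intertwiner : exists Y c, [/\ Y \in unitmx,
  forall i j, E i j *m Y = Y *m E' i j &
  forall t, t \in T -> c t != 0 /\ U t *m Y = c t *: (Y *m U' t)].
Proof.
pose i0 : 'I_k := Ordinal (md_k0 md).
pose A t := lin_mx (mxconj (U t) (invmx (U' t))).
(* The row space of V is the corner of the matrices E_00 Z E'_00, on which the operators A t act.
   Working there gives an eigenvector that can be spread by matrix units. *)
pose V := lin_mx (mxconj (E i0 i0) (E' i0 i0)).
have E0 : E i0 i0 != 0.
  apply/eqP=> E0; have := md_trE charF0 md i0 i0; rewrite E0 mxtrace0 eqxx => /esym/eqP.
  by apply/negP; apply: (md_lam_neq0 charF0 md).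
have E'0 : E' i0 i0 != 0.
  apply/eqP=> E0'; have := md_trE charF0 md' i0 i0; rewrite E0' mxtrace0 eqxx => /esym/eqP.
  by apply/negP; apply: (md_lam_neq0 charF0 md').
have V0 : V != 0.
  have [Z Z0] := mx_sandwich E0 E'0; apply: contra Z0 => /eqP V0.
  have := mul_vec_conj (E i0 i0) (E' i0 i0) Z; rewrite -/V V0 mulmx0 => /esym/eqP.
  by rewrite mxvec_eq0.
have stV B : B \in [seq A t | t <- T] -> (V *m B <= V)%MS.
  case/mapP=> t tT ->; have -> : V *m A t = A t *m V; last exact: submxMl.
  rewrite !lin_conj_mul; apply: lin_conj_eq => Z.
  by rewrite -(md_EU md) // -(md_invE md').
have comL : {in [seq A t | t <- T] &, forall B C, B *m C = C *m B}.
  move=> _ _ /mapP[s sT ->] /mapP[t tT ->]; rewrite !lin_conj_mul.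
  apply: lin_conj_eq => Z; rewrite (md_comm md) // md_comm_inv //.
  rewrite -scalemxAr -!scalemxAl scalerA mulVf ?scale1r //.
  exact: (bc_neq0 bc).
have [v [v0 vV vL]] := common_eigen eigF V0 stV comL.
pose Z := vec_mx v; have Z0 : Z != 0 by rewrite vec_mx_eq0.
have [Z1 ZE] : exists Z1, Z = E i0 i0 *m Z1 *m E' i0 i0.
  have /submxP[w wE] := vV; exists (vec_mx w).
  by rewrite /Z wE -{1}[w]vec_mxK mul_vec_conj mxvecK.
have EZ : E i0 i0 *m Z = Z by rewrite ZE !mulmxA (md_E md) eqxx.
have ZE' : Z *m E' i0 i0 = Z by rewrite ZE -!mulmxA (md_E md') eqxx.
have UZ t : t \in T -> exists a, U t *m Z = a *: (Z *m U' t).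
  move=> tT; have [|a aE] := vL (A t); first exact: map_f.
  exists a; move: aE; rewrite -{1}[v]vec_mxK mul_vec_conj => /(congr1 vec_mx).
  rewrite mxvecK linearZ /= -/Z => /(congr1 (mulmx^~ (U' t))).
  by rewrite mulmxKV ?(md_unit md') // -scalemxAl.
(* Copies of Z along the diagonal; by construction Y intertwines the two systems of matrix units. *)
pose Y := \sum_i E i i0 *m Z *m E' i0 i.
have EY i j : E i j *m Y = Y *m E' i j.
  rewrite mulmx_sumr mulmx_suml (bigD1 j) //= [X in _ + X]big1 ?addr0 => [|l lj].
    rewrite [RHS](bigD1 i) //= [X in _ = _ + X]big1 ?addr0 => [|l li].
      by rewrite !mulmxA (md_E md) eqxx -!mulmxA (md_E md') eqxx.
    by rewrite -!mulmxA (md_E md') (negPf li) !mulmx0.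
  by rewrite !mulmxA (md_E md) eq_sym (negPf lj) !mul0mx.
have Y0 : Y != 0.
  apply: contra Z0 => /eqP Y0; apply/eqP.
  have : E i0 i0 *m Y *m E' i0 i0 = Z.
    rewrite mulmx_sumr mulmx_suml (bigD1 i0) //= big1 ?addr0 => [|l l0].
      by rewrite !mulmxA (md_E md) eqxx EZ -!mulmxA (md_E md') eqxx ZE'.
    by rewrite !mulmxA (md_E md) eq_sym (negPf l0) !mul0mx.
  by rewrite Y0 mulmx0 mul0mx.
have UY t : t \in T -> exists a, U t *m Y = a *: (Y *m U' t).
  move=> tT; have [a aE] := UZ t tT; exists a.
  rewrite mulmx_sumr mulmx_suml scaler_sumr; apply: eq_bigr => i _.
  rewrite !mulmxA -(md_EU md) // -(mulmxA (E i i0)) aE -scalemxAr -scalemxAl.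
  by rewrite -!mulmxA (md_EU md').
(* Every Y B is some B' Y. If Y were singular, Y X K would therefore vanish for its cokernel K and
   all X, against primeness. *)
have Yu : Y \in unitmx.
  have YB B : exists B', Y *m B = B' *m Y.
    apply: (kap_ind charF0 md' (P := fun B => exists B', Y *m B = B' *m Y) (a := B)).
    - by exists 0; rewrite mulmx0 mul0mx.
    - move=> c x y [x' xE] [y' yE]; exists (c *: x' + y').
      by rewrite mulmxDr -scalemxAr xE yE mulmxDl -scalemxAl.
    move=> i j t tT _; have [a aE] := UY t tT; exists (a^-1 *: (E i j *m U t)).
    have a0 : a != 0.
      apply: contra Y0 => /eqP a0; move: aE; rewrite a0 scale0r => /(congr1 (mulmx (invmx (U t)))).
      by rewrite mulKmx ?(md_unit md) // mulmx0 => ->.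
    rewrite -scalemxAl -mulmxA aE -scalemxAr scalerA mulVf // scale1r.
    by rewrite !mulmxA EY.
  apply/negPn/negP=> nY; have K0 : cokermx Y != 0.
    by rewrite -mxrank_eq0 mxrank_coker subn_eq0 -ltnNge ltn_neqAle rank_leq_row andbT
      -[_ == _]/(row_free Y) row_free_unit.
  have [X] := mx_sandwich Y0 K0; have [X' ->] := YB X.
  by rewrite -mulmxA mulmx_coker mulmx0 eqxx.
have [p [q Ypq]] : exists p q, Y p q != 0 by apply: mx_neq0.
exists Y, (fun t => (U t *m Y *m invmx (U' t)) p q / Y p q); split=> // t tT.
have [a aE] := UY t tT.
have -> : (U t *m Y *m invmx (U' t)) p q / Y p q = a.
  by rewrite aE -scalemxAl mulmxK ?(md_unit md') // mxE mulfK.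
split=> //; apply: contra Y0 => /eqP a0; move: aE; rewrite a0 scale0r.
by move/(congr1 (mulmx (invmx (U t)))); rewrite mulKmx ?(md_unit md) // mulmx0 => ->.
Qed.

End Models.
End Intertwiner.

Section Equivalence.
Variables (F : fieldType) (charF0 : [pchar F] =i pred0) (eigF : has_eigen F).
Variables (G : zmodType) (n : nat).
Local Notation r := n.+1.
Local Notation M := 'M[F]_(n.+1 + n.+1).
Local Notation Gs := (G * 'Z_2)%type.
Local Notation par := (@mx_par F n.+1).

Section Models.
Variables (T : {fset Gs}) (beta : Gs -> Gs -> F) (k : nat).
Variables (E : 'I_k -> 'I_k -> M) (U : Gs -> M) (E' : 'I_k -> 'I_k -> M) (U' : Gs -> M).
Hypotheses (md : model T beta E U) (md' : model T beta E' U').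
Variables (g g' : 'I_k -> G).

Let bc := md_bc md.

(** Y identifies the models, and W, diagonal with entries U' (tau i), absorbs the differences g i -
    g' i: conjugation sends [E i j *m U t] to a multiple of [E' i j *m U' (tau i + t - tau j)].
    Parity is preserved since tau i has parity 0. *)
Lemma equiv_coset : (forall i, (g i - g' i, 0) \in T) -> exists Psi,
  nice false Psi /\ forall x a, hmG T E U g x a <-> hmG T E' U' g' x (Psi a).
Proof.
move=> tT; pose tau i : Gs := (g i - g' i, 0).
have tauT i : tau i \in T by apply: tT.
have [Y [c [Yu EY UY]]] := intertwiner charF0 eigF md md'.
pose W := \sum_i E' i i *m U' (tau i); pose W' := \sum_i E' i i *m invmx (U' (tau i)).
have WE i j : W *m E' i j = E' i j *m U' (tau i).
  rewrite mulmx_suml (bigD1 i) //= big1 ?addr0 => [|l li].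
    by rewrite -mulmxA -(md_EU md') // mulmxA (md_E md') eqxx.
  by rewrite -mulmxA -(md_EU md') // mulmxA (md_E md') (negPf li) mul0mx.
have EW i j : E' i j *m W' = E' i j *m invmx (U' (tau j)).
  rewrite mulmx_sumr (bigD1 j) //= big1 ?addr0 => [|l li].
    by rewrite mulmxA (md_E md') eqxx.
  by rewrite mulmxA (md_E md') eq_sym (negPf li) mul0mx.
have WW : W *m W' = 1%:M.
  rewrite mulmx_suml -(md_1 md'); apply: eq_bigr => i _.
  by rewrite -(WE i i) -mulmxA EW mulmxA WE mulmxK // (md_unit md').
pose P := W *m invmx Y; pose Q := Y *m W'.
have PQ : P *m Q = 1%:M by rewrite /P /Q mulmxA mulmxKV.
have PB i j t : t \in T -> exists a s, [/\ s \in T, s.2 = t.2,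
    g i + t.1 - g j = g' i + s.1 - g' j & lconj P Q (E i j *m U t) = a *: (E' i j *m U' s)].
  move=> tT'; have [c0 cE] := UY _ tT'.
  have [d d0 dE] := md_inv md' (tT j).
  have [e e0 eE] := md_UU md' tT' (bcN bc (tT j)).
  have [f f0 fE] := md_UU md' (tT i) (bcD bc tT' (bcN bc (tT j))).
  exists (c t * (d * (e * f))), (tau i + (t - tau j)); split.
  - by apply: (bcD bc (tT i)); apply: (bcD bc tT' (bcN bc (tT j))).
  - by rewrite /= subr0 add0r.
  - rewrite /= opprB -!addrA [RHS]addrCA; congr (_ + _).
    by rewrite [RHS]addrA subrr add0r; congr (_ + _); rewrite addrCA subrr addr0.
  rewrite lconjE /P /Q.
  have -> : W *m invmx Y *m (E i j *m U t) *m (Y *m W') =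
            c t *: (W *m (E' i j *m U' t) *m W').
    rewrite -!mulmxA [U t *m (Y *m W')]mulmxA cE -scalemxAl -!scalemxAr; congr (_ *: _).
    by congr (_ *m _); rewrite -!mulmxA [E i j *m (Y *m _)]mulmxA EY -!mulmxA mulKmx.
  rewrite mulmxA WE (md_EU md') // -[U' _ *m _ *m _]mulmxA (md_EU md') //.
  rewrite -[_ *m W']mulmxA -[_ *m _ *m W']mulmxA EW -(md_invE md') // dE.
  rewrite -scalemxAl -!scalemxAr scalerA !mulmxA.
  rewrite -[U' (tau i) *m _ *m _]mulmxA eE -scalemxAr -scalemxAl fE -scalemxAl.
  by rewrite !scalerA -(md_EU md') ?mulrA // (bcD bc) // (bcD bc) // (bcN bc).
exists (lconj P Q); split.
  apply: nice_lconj => // p x xp.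
  apply: (kap_ind charF0 md (P := fun x => lconj P Q x \in par p) (a := x)).
  - by rewrite linear0 mem0v.
  - by move=> d y z Py Pz; rewrite linearP rpredD ?rpredZ.
  move=> i j t t' kt; have tp := kap_par charF0 md xp t' kt.
  have [a [s [sT s2 _ ->]]] := PB i j t t'.
  by rewrite rpredZ // -tp -s2; apply: (md_par md').
apply: (hmG_mapE charF0 md md').
  exact: can_inj (lconjK PQ).
move=> i j t t'; have [a [s [sT s2 -> ->]]] := PB i j t t'.
rewrite -[_ *: _]addr0; apply: hmGD; last exact: hmG0.
by have := hmG_basis charF0 md' (g := g') (i := i) (j := j) sT.
Qed.

End Models.

Lemma equiv_perm T beta k E U E' U' (g g' : 'I_k -> G) (sg sg' : 'I_k -> 'I_k) g0 :
  cancel sg sg' -> cancel sg' sg -> model T beta E U -> model T beta E' U' ->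
  (forall i, (g0 + g i - g' (sg i), 0) \in T) -> exists Psi : 'End(M),
  nice false Psi /\ forall x a, hmG T E U g x a <-> hmG T E' U' g' x (Psi a).
Proof.
move=> sgK sgK' md md' gg'; pose E2 i j := E' (sg i) (sg j).
have md2 : model T beta E2 U'.
  have [bc mE m1 mEU mUU mc mU0 mEp mUp md3] := md'; split=> //.
  - by move=> i j l m; rewrite mE (can_eq sgK).
  - by rewrite -m1 [RHS](reindex sg) //; exists sg' => i _.
  - by move=> i j t tT; apply: mEU.
  - by move=> i j; apply: mEp.
have [Psi [nc PE]] := equiv_coset md md2 (g := fun i => g0 + g i) (g' := g' \o sg) gg'.
exists Psi; split=> // x a; rewrite (hmG_shift _ _ _ _ g0) PE.
split=> ha i j t tT ne; last exact: (ha (sg i) (sg j) t tT ne).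
by rewrite -[i]sgK' -[j]sgK' in ne *; exact: (ha _ _ t tT ne).
Qed.

End Equivalence.

Section InducedGradings.
Variables (F : fieldType) (charF0 : [pchar F] =i pred0) (eigF : has_eigen F).
Variables (G : zmodType) (n : nat).
Local Notation r := n.+1.
Local Notation M := 'M[F]_(n.+1 + n.+1).
Local Notation Gs := (G * 'Z_2)%type.
Local Notation par := (@mx_par F n.+1).
Local Notation sl := (sl F r).
Local Notation psl_pi := (psl_pi F r).

Lemma model_hmG T beta k E U (g : 'I_k -> G) (Gr : G -> {vspace M}) :
  model T beta E U -> M_grading Gr ->
  (forall i j t, t \in T -> E i j *m U t \in Gr (g i + t.1 - g j)) ->
  forall x a, a \in Gr x <-> hmG T E U g x a.
Proof.
move=> md [gr _] EU x a; have [s [p gp]] := is_grading_proj gr; split=> [ax|ha].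
  rewrite -(gp_id gp ax).
  apply: (kap_ind charF0 md (P := fun a => hmG T E U g x (p x a)) (a := a)).
  - by rewrite linear0; apply: hmG0.
  - by move=> c y z Py Pz; rewrite linearP; apply: hmGD.
  move=> i j t tT _; have [xE|xN] := eqVneq (g i + t.1 - g j) x.
    rewrite (gp_id gp); last by rewrite -xE EU.
    by rewrite -xE; have := hmG_basis charF0 md (g := g) (i := i) (j := j) tT.
  by rewrite (gp_0 gp (EU i j t tT) xN); apply: hmG0.
apply: (kap_ind charF0 md (P := fun a => a \in Gr x) (a := a)).
- exact: mem0v.
- by move=> c y z Py Pz; rewrite rpredD ?rpredZ.
move=> i j t tT kt; have <- : g i + t.1 - g j = x; last exact: EU.
by apply/eqP; apply: contraNT kt => ne; rewrite ha.
Qed.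

(** A representative b in [Gr x] differs from a by a scalar. For x = 0 scalars are homogeneous of
    that degree; otherwise b is traceless, like a, and the scalar is 0. *)
Lemma induced_inL T beta k E U (g : 'I_k -> G) (Gr : G -> {vspace M}) :
  model T beta E U -> (forall x a, a \in Gr x <-> hmG T E U g x a) ->
  forall x a, inL a -> psl_pi a \in induced Gr x <-> a \in Gr x.
Proof.
move=> md GrE x a [sa ta]; split=> [|ax]; last by apply: memv_img; rewrite memv_cap ax.
case/memv_imgP=> b /memv_capP[bx sb] ab.
have [c cE] := psl_piE sa sb ab.
have [x0|x0] := eqVneq x 0.
  rewrite cE rpredD // rpredZ // x0; apply/GrE; exact: (hmG1 charF0 md).
have tb : \tr b = 0.
  have [//|tb] := eqVneq (\tr b) 0.
  by case/eqP: x0; apply: (hmG_tr charF0 md) tb; apply/GrE.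
suff c0 : c = 0 by rewrite cE c0 scale0r addr0.
move: ta; rewrite cE mxtraceD tb add0r mxtraceZ mxtrace1 => /eqP.
by rewrite mulf_eq0 (natF_eq0 charF0) addnS orbF => /eqP.
Qed.

Lemma psl_iso_nice e (Psi : 'End(M)) (Gr Gr' : G -> {vspace M}) : nice e Psi ->
  (forall x a, a \in Gr x <-> Psi a \in Gr' x) ->
  psl_grading_iso (induced Gr) (induced Gr').
Proof.
move=> nc GrE; have [[pp _] p1 _ [Pi [PK PiK Pip]]] := nc.
have Psl := scomm_morph_sl (nc_scomm nc).
have Pisl : forall x, x \in sl -> Pi x \in sl.
  apply: scomm_morph_sl => a b; apply: (can_inj PK).
  by rewrite (nc_scomm nc) !PiK.
have [|f fE] := psl_lift Psl; first by exists ((-1) ^+ e).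
have rs (x : psl F r) : vsval (repr x) \in sl by apply: subvsP.
have img (V V' : {vspace M}) : (forall a, a \in V <-> Psi a \in V') ->
    (f @: (psl_pi @: (V :&: sl)) = psl_pi @: (V' :&: sl))%VS.
  move=> VV; apply/vspaceP=> y; apply/idP/idP.
    case/memv_imgP=> _ /memv_imgP[a /memv_capP[aV sa] ->] ->.
    by rewrite fE //; apply: memv_img; rewrite memv_cap Psl // andbT; apply/VV.
  case/memv_imgP=> b /memv_capP[bV sb] ->; rewrite -(PiK b) -fE ?Pisl //.
  apply: memv_img; apply: memv_img; rewrite memv_cap Pisl // andbT.
  by apply/VV; rewrite PiK.
exists f; split; last by move=> h; apply: img; apply: GrE.
split.
- apply/eqP; rewrite -subv0; apply/subvP=> x; rewrite memv_ker memv0.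
  have sx := rs x; have xE := psl_piK x; move: sx xE; set y := vsval _ => sx <-.
  rewrite (fE _ sx) => px; have := psl_pi_eq0 (Psl _ sx); rewrite px.
  move/esym/vlineP=> [c cE].
  have -> : y = (c * (-1) ^+ e) *: 1%:M.
    apply: (can_inj PK); rewrite cE linearZ /= p1 scalerA -mulrA -expr2 sqrr_sign.
    by rewrite mulr1.
  by rewrite psl_pi1.
- move=> x y; have sx := rs x; have sy := rs y.
  have xE := psl_piK x; have yE := psl_piK y; move: sx sy xE yE.
  set x' := vsval (repr x); set y' := vsval (repr y) => sx sy <- <-.
  rewrite -(psl_mulE sx sy) (fE _ sx) (fE _ sy) (fE _ (scomm_sl _ _)).
  by rewrite (nc_scomm nc) (psl_mulE (Psl _ sx) (Psl _ sy)).
move=> i; rewrite /psl_par ![(sl :&: _)%VS]capvC; apply: img => a.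
by split=> [|/Pip]; [apply: pp|rewrite PK].
Qed.

Lemma model_beta T beta beta' k (E : 'I_k -> 'I_k -> M) U :
  {in T &, beta =2 beta'} -> @model F G n T beta k E U -> model T beta' E U.
Proof.
move=> bb [bc mE m1 mEU mUU mc mU0 mEp mUp md3]; have [bg b0 bml bmr ba bn] := bc.
have bD u v : u \in T -> v \in T -> u + v \in T by apply: (bcD bc).
split=> //.
- split=> //.
  + by move=> u v uT vT; rewrite -bb // b0.
  + by move=> u v w uT vT wT; rewrite -!bb ?bD // bml.
  + by move=> u v w uT vT wT; rewrite -!bb ?bD // bmr.
  + by move=> u uT; rewrite -bb // ba.
  by move=> u uT u1; apply: bn => // v vT; rewrite bb // u1.
by move=> s t sT tT; rewrite -bb // mc.
Qed.

Lemma nice_exists e : exists Psi : 'End(M), nice e Psi.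
Proof.
case: e; first by exists (linfun (@nst F r)); apply: nice_nst.
exists (lconj 1%:M 1%:M); have p1 : (1%:M : M) \in par 0.
  by rewrite scalar_mx_block; apply: ev_par.
by apply: (nice_conj p1 p1); rewrite mulmx1.
Qed.

Lemma models_equiv e T beta beta' k E U E' U' (g g' : 'I_k -> G) sg sg' g0 :
  cancel sg sg' -> cancel sg' sg -> model T beta E U -> model T beta' E' U' ->
  {in T &, tbeta beta e =2 beta'} ->
  (forall i, (g0 + tg e g i - g' (sg i), 0) \in T) -> exists Psi : 'End(M),
  nice e Psi /\ forall x a, hmG T E U g x a <-> hmG T E' U' g' x (Psi a).
Proof.
move=> sgK sgK' md md' bb gT; have [Psi0 nc0] := nice_exists e.
have md1 := model_beta bb (tmodel md nc0).
have [Psi1 [nc1 PE]] := equiv_perm charF0 eigF sgK sgK' md1 md' gT.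
exists (Psi1 \o Psi0)%VF; split; first exact: (nice_comp nc0 nc1).
move=> x a; rewrite comp_lfunE; apply: iff_trans (PE x (Psi0 a)).
by apply: (tmodel_hmG charF0 md nc0).
Qed.

End InducedGradings.

(** * Recovering T, beta and the multiset of cosets *)

Section Uniqueness.
Variables (F : fieldType) (charF0 : [pchar F] =i pred0).
Variables (G : zmodType) (n : nat).
Local Notation r := n.+1.
Local Notation M := 'M[F]_(n.+1 + n.+1).
Local Notation Gs := (G * 'Z_2)%type.
Local Notation par := (@mx_par F n.+1).

Section Corner.
Variables (T : {fset Gs}) (beta : Gs -> Gs -> F) (k : nat).
Variables (E : 'I_k -> 'I_k -> M) (U : Gs -> M).
Hypothesis md : model T beta E U.
Variable g : 'I_k -> G.

Let bc := md_bc md.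

Lemma hmg_U t : t \in T -> hmg T E U g t (U t).
Proof.
move=> tT; rewrite -[U t]mul1mx -(md_1 md) mulmx_suml.
elim/big_ind: _ => [|a b ha hb|i _]; first exact: hmg0.
  by rewrite -[a]scale1r; apply: hmgD.
have := hmg_basis charF0 md (g := g) (i := i) (j := i) tT.
by rewrite /dg addrAC subrr add0r; case: (t).
Qed.

Lemma hmg_E i : hmg T E U g 0 (E i i).
Proof.
have := hmg_basis charF0 md (g := g) (i := i) (j := i) (bc0 bc).
by rewrite (md_U0 md) mulmx1 /dg /= addr0 subrr.
Qed.

Lemma md_E0 i : E i i != 0.
Proof.
apply/eqP=> E0; have := md_trE charF0 md i i; rewrite E0 mxtrace0 eqxx => /esym/eqP.
by apply/negP; apply: (md_lam_neq0 charF0 md).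
Qed.

Lemma basis_pick (A X B : M) : A *m X *m B != 0 ->
  exists i j t, t \in T /\ A *m (E i j *m U t) *m B != 0.
Proof.
move=> AXB; apply: NNPP => no; case/eqP: AXB.
apply: (kap_ind charF0 md (P := fun X => A *m X *m B = 0) (a := X)).
- by rewrite mulmx0 mul0mx.
- by move=> c y z Py Pz; rewrite mulmxDr mulmxDl -scalemxAr -scalemxAl Py Pz scaler0 addr0.
move=> i j t tT _; apply/eqP; apply: contraT => ne; case: no.
by exists i, j, t.
Qed.

Lemma hmg_corner i d a : hmg T E U g d a ->
  E i i *m a *m E i i =
  if d \in T then kap E U i i d a *: (E i i *m U d) else 0.
Proof.
move=> ha; apply: (kap_ind charF0 md (P := fun a => E i i *m a *m E i i =
  if d \in T then kap E U i i d a *: (E i i *m U d) else 0) (a := a)).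
- by rewrite mulmx0 mul0mx linear0; case: ifP; rewrite // scale0r.
- move=> c y z Py Pz; rewrite mulmxDr mulmxDl -scalemxAr -scalemxAl Py Pz.
  by case: ifP => _; rewrite ?scaler0 ?addr0 // linearP scalerDl scalerA.
move=> j l t tT kt.
have dE : dg g j l t = d by apply/eqP; apply: contraNT kt => ne; rewrite ha.
have -> : E i i *m (E j l *m U t) *m E i i =
          if (i == j) && (i == l) then E i i *m U t else 0.
  rewrite mulmxA -mulmxA -(md_EU md) // mulmxA !(md_E md).
  case: eqP => [->|_]; last by rewrite !mul0mx.
  by rewrite (md_E md) eq_sym; case: eqP => [->|_]; rewrite ?mul0mx.
have [dT|dT] := boolP (d \in T).
  rewrite (kapE charF0 md) // andbA; case: andP => [[/eqP ij /eqP il]|_]; last by rewrite scale0r.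
  have <- : t = d by rewrite -dE -ij -il /dg addrAC subrr add0r; case: (t).
  by rewrite eqxx scale1r.
case: andP => [[/eqP ij /eqP il]|//]; case/negP: dT.
by rewrite -dE -ij -il /dg addrAC subrr add0r -surjective_pairing.
Qed.

(** The only t for which [E i j *m U t] can have degree d. *)
Definition rdeg i j (d : Gs) : Gs := (d.1 - g i + g j, d.2).

Lemma hmg_row i d a : hmg T E U g d a ->
  E i i *m a = \sum_(j | rdeg i j d \in T)
    kap E U i j (rdeg i j d) a *: (E i j *m U (rdeg i j d)).
Proof.
move=> ha; apply: (kap_ind charF0 md (P := fun a => E i i *m a =
  \sum_(j | rdeg i j d \in T)
    kap E U i j (rdeg i j d) a *: (E i j *m U (rdeg i j d))) (a := a)).
- by rewrite mulmx0 big1 // => j _; rewrite linear0 scale0r.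
- move=> c y z Py Pz; rewrite mulmxDr -scalemxAr Py Pz scaler_sumr -big_split /=.
  by apply: eq_bigr => j _; rewrite linearP scalerDl scalerA.
move=> j l t tT kt.
have dE : dg g j l t = d by apply/eqP; apply: contraNT kt => ne; rewrite ha.
rewrite mulmxA (md_E md); case: (i =P j) => [ij|ij]; last first.
  rewrite mul0mx big1 // => m mT; rewrite (kapE charF0 md) //.
  by case: eqP => [//|_]; rewrite scale0r.
have tE : rdeg i l d = t.
  by rewrite -dE ij /rdeg /= addrAC addrNK addrAC subrr add0r; case: (t).
rewrite (bigD1 l) /=; last by rewrite tE.
rewrite big1 ?addr0 => [|m /andP[mT ml]].
  by rewrite tE (kapE charF0 md) // ij !eqxx scale1r.
by rewrite (kapE charF0 md) // (negPf ml) andbF scale0r.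
Qed.

End Corner.

Lemma dg_rdeg k (g : 'I_k -> G) i j d : dg g i j (rdeg g i j d) = d.
Proof.
rewrite /dg /rdeg /= [g i + _]addrC -[_ - g i + g j + g i]addrA [g j + g i]addrC addrA.
by rewrite addrNK addrK; case: d.
Qed.

(* Mutually inverse homogeneous elements [x] and [y] between the corners of
   [E i i] and [E' i' i']. *)
Record link (T : {fset Gs}) k (E : 'I_k -> 'I_k -> M) U (g : 'I_k -> G)
    (T' : {fset Gs}) k' (E' : 'I_k' -> 'I_k' -> M) U' (g' : 'I_k' -> G)
    (i : 'I_k) (i' : 'I_k') (h : Gs) (x y : M) : Prop := {
  lk_xy : x *m y = E i i;
  lk_yx : y *m x = E' i' i';
  lk_x : E i i *m x = x;
  lk_x' : x *m E' i' i' = x;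
  lk_y : E' i' i' *m y = y;
  lk_y' : y *m E i i = y;
  lk_hx : hmg T E U g h x;
  lk_hy : hmg T' E' U' g' (- h) y;
  lk_hE : forall d a, hmg T E U g d a <-> hmg T' E' U' g' d a }.

Section Two.
Variables (T T' : {fset Gs}) (beta beta' : Gs -> Gs -> F) (k k' : nat).
Variables (E : 'I_k -> 'I_k -> M) (U : Gs -> M).
Variables (E' : 'I_k' -> 'I_k' -> M) (U' : Gs -> M).
Hypothesis md : model T beta E U.
Hypothesis md' : model T' beta' E' U'.
Variables (g : 'I_k -> G) (g' : 'I_k' -> G) (i : 'I_k) (i' : 'I_k').

(** Primeness gives a homogeneous x between the corners and then y1 with x y1 a nonzero multiple of
    [E i i *m U d]; dividing by U d gives x y = E i i. Now y x is a nonzero idempotent of degree 0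
    in the corner of [E' i' i'], where degree 0 is a line, so it is [E' i' i']. *)
Lemma link_exists : (forall d a, hmg T E U g d a <-> hmg T' E' U' g' d a) ->
  exists h x y, link T E U g T' E' U' g' i i' h x y.
Proof.
move=> hE; have [X] := mx_sandwich (md_E0 md i) (md_E0 md' i').
case/(basis_pick md)=> a [b [t [tT]]]; set x0 := E a b *m U t.
set x := E i i *m x0 *m E' i' i' => x_0; pose h := dg g a b t.
have EE : E i i *m E i i = E i i by rewrite (md_E md) eqxx.
have EE' : E' i' i' *m E' i' i' = E' i' i' by rewrite (md_E md') eqxx.
have hx : hmg T E U g h x.
  rewrite -[h]addr0; apply: (hmgM charF0 md); last first.
    apply/hE; apply: (hmg_E md').
  rewrite -[h]add0r; apply: (hmgM charF0 md); first exact: (hmg_E md).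
  exact: (hmg_basis charF0 md).
have xE : E i i *m x = x by rewrite /x !mulmxA EE.
have xE' : x *m E' i' i' = x by rewrite /x -!mulmxA EE'.
have [X'] := mx_sandwich x_0 (md_E0 md i).
case/(basis_pick md)=> a' [b' [t' [t'T]]]; set y0 := E a' b' *m U t'.
move=> xy0; pose h' := dg g a' b' t'.
pose y1 := E' i' i' *m y0 *m E i i.
have hy1 : hmg T E U g h' y1.
  rewrite -[h']addr0; apply: (hmgM charF0 md); last exact: (hmg_E md).
  rewrite -[h']add0r; apply: (hmgM charF0 md); last exact: (hmg_basis charF0 md).
  by apply/hE; apply: (hmg_E md').
have xy1 : x *m y1 = x *m y0 *m E i i by rewrite /y1 !mulmxA xE'.
have := hmg_corner md i (hmgM charF0 md hx hy1).
rewrite mulmxA xE -[x *m y1 *m _]mulmxA.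
have -> : y1 *m E i i = y1 by rewrite /y1 -[_ *m E i i *m E i i]mulmxA EE.
case: ifP => [dT|_ xy]; last by rewrite -xy1 xy eqxx in xy0.
set c := kap _ _ _ _ _ _ => xy; set d := h + h' in dT c xy.
have c0 : c != 0.
  by apply: contra xy0 => /eqP c0; rewrite -xy1 xy c0 scale0r.
pose y := c^-1 *: (y1 *m invmx (U d)).
have Ud := md_unit md dT.
have xy_ : x *m y = E i i.
  rewrite /y -scalemxAr mulmxA xy -scalemxAl scalerA mulVf // scale1r.
  by rewrite mulmxK.
have hy : hmg T E U g (- h) y.
  have -> : - h = h' - d by rewrite /d opprD addrCA subrr addr0.
  apply: hmgZ; apply: (hmgM charF0 md) => //; have [e e0 ->] := md_inv md dT.
  by apply: hmgZ; apply: (hmg_U md); apply: (bcN (md_bc md)).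
have yE' : E' i' i' *m y = y by rewrite /y -scalemxAr /y1 !mulmxA EE'.
have yE : y *m E i i = y.
  by rewrite /y -scalemxAl -mulmxA (md_invE md) // mulmxA /y1 -[_ *m E i i *m E i i]mulmxA EE.
have yx0 : y *m x != 0.
  apply: contra x_0 => /eqP yx; apply/eqP.
  by rewrite -/x -xE -xy_ -mulmxA yx mulmx0.
have yxyx : y *m x *m (y *m x) = y *m x.
  by rewrite mulmxA -(mulmxA y) xy_ yE.
have hyx : hmg T' E' U' g' 0 (y *m x).
  by apply/hE; rewrite -[0](addNr h); apply: (hmgM charF0 md).
have := hmg_corner md' i' hyx.
rewrite (bc0 (md_bc md')) (md_U0 md') mulmx1.
rewrite [E' i' i' *m (y *m x)]mulmxA yE' -[y *m x *m _]mulmxA xE'.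
set e := kap _ _ _ _ _ _ => yxe.
have e0 : e != 0 by apply: contra yx0 => /eqP e0; rewrite yxe e0 scale0r.
have e1 : e = 1.
  move: yxyx; rewrite yxe -scalemxAl -scalemxAr EE' scalerA => /eqP.
  rewrite -subr_eq0 -scalerBl scaler_eq0 (negPf (md_E0 md' i')) orbF.
  by rewrite -[X in _ - X]mulr1 -mulrBr mulf_eq0 (negPf e0) subr_eq0 => /eqP.
exists h, x, y; split=> //; last by apply/hE.
by rewrite yxe e1 scale1r.
Qed.

Variables (h : Gs) (x y : M).
Hypothesis lk : link T E U g T' E' U' g' i i' h x y.

Lemma link_sym : link T' E' U' g' T E U g i' i (- h) y x.
Proof.
have [xy yx xE xE' yE' yE hx hy hE] := lk.
by split; rewrite ?opprK // => d a; rewrite hE.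
Qed.

(** The map a |-> y a x between the corners preserves degrees, as h and -h cancel, and is undone by
    a |-> x a y. *)
Lemma link_corner t : t \in T -> t \in T' /\
  exists2 c, c != 0 & y *m U t *m x = c *: (E' i' i' *m U' t).
Proof.
have [xy yx xE xE' yE' yE hx hy hE] := lk => tT.
have ht : hmg T' E' U' g' t (y *m U t *m x).
  suff : hmg T' E' U' g' (- h + t + h) (y *m U t *m x) by rewrite addrAC addNr add0r.
  apply: (hmgM charF0 md'); last by apply/hE.
  by apply: (hmgM charF0 md') => //; apply/hE; apply: (hmg_U md).
have := hmg_corner md' i' ht; rewrite !mulmxA yE' -[_ *m x *m _]mulmxA xE'.
have n0 : y *m U t *m x != 0.
  apply: contra (md_E0 md i) => /eqP yUx; apply/eqP.
  have : x *m (y *m U t *m x) *m y = E i i *m U t.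
    by rewrite !mulmxA xy -[_ *m x *m y]mulmxA xy (md_EU md) // -mulmxA (md_E md) eqxx.
  rewrite yUx mulmx0 mul0mx => /(congr1 (mulmx^~ (invmx (U t)))).
  by rewrite mul0mx mulmxK ?(md_unit md).
case: ifP => [tT' yU|_ yU]; last by rewrite yU eqxx in n0.
split=> //; exists (kap E' U' i' i' t (y *m U t *m x)) => //.
by apply: contra n0 => /eqP c0; rewrite yU c0 scale0r.
Qed.

Lemma link_beta : {in T &, beta =2 beta'}.
Proof.
have [xy yx xE xE' yE' yE hx hy hE] := lk => s t sT tT.
have [sT' [c c0 cE]] := link_corner sT; have [tT' [d d0 dE]] := link_corner tT.
pose V t := y *m U t *m x.
have VV s' t' : t' \in T -> V s' *m V t' = y *m (U s' *m U t') *m x.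
  move=> t'T; rewrite /V !mulmxA -[y *m U s' *m x *m y]mulmxA xy -!mulmxA.
  by rewrite [E i i *m (U t' *m _)]mulmxA (md_EU md) // -[U t' *m _ *m _]mulmxA xE.
have b1 : V s *m V t = beta s t *: (V t *m V s).
  by rewrite !VV // (md_comm md) // -scalemxAr -scalemxAl.
have EUU u v : u \in T' -> E' i' i' *m U' u *m (E' i' i' *m U' v) = E' i' i' *m (U' u *m U' v).
  by move=> uT; rewrite mulmxA -[_ *m U' u *m _]mulmxA -(md_EU md') // !mulmxA (md_E md') eqxx.
have b2 : V s *m V t = beta' s t *: (V t *m V s).
  rewrite /V cE dE -!scalemxAl -!scalemxAr !EUU // (md_comm md') //.
  by rewrite -scalemxAr !scalerA; congr (_ *: _); ring.
have n0 : V t *m V s != 0.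
  rewrite /V cE dE -!scalemxAl -!scalemxAr EUU // !scaler_eq0 (negPf c0) (negPf d0) /=.
  apply: contra (md_E0 md' i') => /eqP z; apply/eqP.
  have u : U' t *m U' s \in unitmx by rewrite unitmx_mul !(md_unit md').
  by rewrite -[LHS](mulmxK u) z mul0mx.
apply/eqP; rewrite -subr_eq0; move: n0; apply: contraR => bb.
by rewrite -[_ == 0]orFb -(negPf bb) -scaler_eq0 scalerBl -b1 -b2 subrr.
Qed.

(** Multiplication by y, with left inverse x, embeds the degree d part of the row of [E i i] into
    the degree d - h part of the row of [E' i' i']. Both have bases indexed by such j; [link_sym]
    gives the reverse inequality. *)
Lemma link_rows d : (#|[pred j | rdeg g i j d \in T]|
  <= #|[pred j | rdeg g' i' j (d - h)%R \in T']|)%N.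
Proof.
have [xy yx xE xE' yE' yE hx hy hE] := lk.
set J := [pred j | _]; set J' := [pred j | _].
pose v j := E i j *m U (rdeg g i j d).
pose v' j := E' i' j *m U' (rdeg g' i' j (d - h)).
pose C := \matrix_(a < #|J|, b < #|J'|)
  (kap E' U' i' (enum_val b) (rdeg g' i' (enum_val b) (d - h)) (y *m v (enum_val a)) : F).
pose C' := \matrix_(b < #|J'|, a < #|J|)
  (kap E U i (enum_val a) (rdeg g i (enum_val a) d) (x *m v' (enum_val b)) : F).
suff : C *m C' = 1%:M by apply: mulmx1_min.
have hv j : j \in J -> hmg T' E' U' g' (d - h) (y *m v j).
  move=> jJ; rewrite addrC; apply: (hmgM charF0 md') => //; apply/hE.
  by have := hmg_basis charF0 md (g := g) (i := i) (j := j) jJ; rewrite dg_rdeg.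
have hv' j : j \in J' -> hmg T E U g d (x *m v' j).
  move=> jJ; suff : hmg T E U g (h + (d - h)) (x *m v' j) by rewrite addrC addrNK.
  apply: (hmgM charF0 md) => //; apply/hE.
  by have := hmg_basis charF0 md' (g := g') (i := i') (j := j) jJ; rewrite dg_rdeg.
have yv j : j \in J -> y *m v j = \sum_(b < #|J'|)
    kap E' U' i' (enum_val b) (rdeg g' i' (enum_val b) (d - h)) (y *m v j) *: v' (enum_val b).
  move=> jJ; have := hmg_row md' i' (hv j jJ); rewrite mulmxA yE' => yvE.
  rewrite [LHS]yvE; set f := BIG_F; rewrite -(big_enum_val f).
  exact: eq_bigl.
apply/matrixP=> a a'; rewrite !mxE.
have aJ := enum_valP a; have a'J := enum_valP a'.
have := congr1 (kap E U i (enum_val a') (rdeg g i (enum_val a') d))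
  (congr1 (mulmx x) (yv _ aJ)).
rewrite mulmxA xy /v mulmxA (md_E md) eqxx (kapE charF0 md) // eqxx /=.
rewrite (inj_eq enum_val_inj) eq_sym => vE.
transitivity ((a == a')%:R : F); last by [].
have [aa|aa] := eqVneq a a'.
  move: vE; rewrite aa !eqxx /= => vE; rewrite [RHS]vE mulmx_sumr linear_sum.
  by apply: eq_bigr => b _; rewrite !mxE -scalemxAr linearZ.
move: vE; rewrite (negPf aa) /= => vE; rewrite [RHS]vE mulmx_sumr linear_sum.
by apply: eq_bigr => b _; rewrite !mxE -scalemxAr linearZ.
Qed.

End Two.

End Uniqueness.

Section Cosets.
Variables (G : zmodType) (T : {fset (G * 'Z_2)%type}).
Hypothesis T0 : 0 \in T.
Hypothesis TB : forall u v, u \in T -> v \in T -> u - v \in T.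

Lemma translateP a (C : {fset (G * 'Z_2)%type}) x : (x \in translate a C) = (x - (a, 0) \in C).
Proof.
apply/imfsetP/idP => [[y yC ->]|xC]; first by rewrite addrC addKr.
by exists (x - (a, 0)); rewrite // addrC subrK.
Qed.

Lemma translateD a b (C : {fset (G * 'Z_2)%type}) :
  translate a (translate b C) = translate (a + b) C.
Proof.
apply/fsetP=> x; rewrite !translateP; congr (_ \in C).
have -> : (a + b, 0) = (a, 0) + (b, 0) :> G * 'Z_2.
  by congr (_, _); rewrite /= addr0.
by rewrite opprD addrA.
Qed.

Lemma translate_eq a b : (translate a T == translate b T) = ((a - b, 0) \in T).
Proof.
have TD u v : u \in T -> v \in T -> u + v \in T.
  by move=> uT vT; rewrite -[v]opprK; apply: TB => //; rewrite -[- v]add0r; apply: TB.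
have abE : (a - b, 0) = (a, 0) - (b, 0) :> G * 'Z_2 by congr (_, _); rewrite /= subr0.
rewrite abE; apply/eqP/idP => [ab|ab].
  by rewrite -translateP -ab translateP subrr.
apply/fsetP=> x; rewrite !translateP; apply/idP/idP => xT.
  have -> : x - (b, 0) = (x - (a, 0)) + ((a, 0) - (b, 0)) by rewrite addrA subrK.
  exact: TD.
have -> : x - (a, 0) = (x - (b, 0)) - ((a, 0) - (b, 0)) by rewrite opprB addrA subrK.
exact: TB.
Qed.

End Cosets.

Section ModelsUnique.
Variables (F : fieldType) (charF0 : [pchar F] =i pred0).
Variables (G : zmodType) (n : nat).
Local Notation r := n.+1.
Local Notation M := 'M[F]_(n.+1 + n.+1).
Local Notation Gs := (G * 'Z_2)%type.

Lemma count_enum k (P : pred 'I_k) : count P (Finite.enum 'I_k) = #|P|.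
Proof. by rewrite cardE -size_filter; congr size; apply: eq_filter. Qed.

Variables (T T' : {fset Gs}) (beta beta' : Gs -> Gs -> F) (k k' : nat).
Variables (E : 'I_k -> 'I_k -> M) (U : Gs -> M).
Variables (E' : 'I_k' -> 'I_k' -> M) (U' : Gs -> M).
Hypothesis md : model T beta E U.
Hypothesis md' : model T' beta' E' U'.
Variables (g : 'I_k -> G) (g' : 'I_k' -> G).

Lemma models_unique t0 : t0 \in T -> t0.2 != 0 ->
  (forall x a, hmG T E U g x a <-> hmG T' E' U' g' x a) ->
  [/\ T = T', {in T &, beta =2 beta'} & exists g0,
    perm_eq [seq translate g0 C | C <- Xi T [seq g i | i <- enum 'I_k]]
            (Xi T' [seq g' i | i <- enum 'I_k'])].
Proof.
move=> t0T t02 hE; pose i : 'I_k := Ordinal (md_k0 md); pose i' : 'I_k' := Ordinal (md_k0 md').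
have hE2 d a : hmg T E U g d a <-> hmg T' E' U' g' d a.
  split.
    by case/(hmgP charF0 md) => a1 a2; apply/(hmgP charF0 md'); split=> //; apply/hE.
  by case/(hmgP charF0 md') => a1 a2; apply/(hmgP charF0 md); split=> //; apply/hE.
have [h [x [y lk]]] := link_exists charF0 md md' i i' hE2.
have lk' := link_sym lk; have bc := md_bc md.
have TT : T = T'.
  apply/fsetP=> t; apply/idP/idP => tT; first by have [] := link_corner charF0 md md' lk tT.
  by have [] := link_corner charF0 md' md lk' tT.
split=> //; first exact: (link_beta charF0 md md' lk).
(* The degree h may be odd; subtracting an element of T of the same parity moves it into G without
   changing cosets. *)
have [t tT th] : exists2 t, t \in T & t.2 = h.2.
  case: (Z2P h.2) => h2; first by exists 0; rewrite ?(bc0 bc).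
  exists t0 => //; rewrite h2; by case: (Z2P t0.2) t02 => -> //; rewrite eqxx.
pose g0 := g' i' - g i + h.1 - t.1; exists g0.
have [_ TB] := bc_group bc.
have cnt w : #|[pred j | (g0 + g j - w, 0) \in T]| = #|[pred j | (g' j - w, 0) \in T']|.
  (* Chosen so that [rdeg g i j d] is (g0 + g j - w, 0): the basis elements of degree d in row i
     then count the occurrences of the coset of w. *)
  pose d : Gs := (g i - w + g0, 0).
  have -> : #|[pred j | (g0 + g j - w, 0) \in T]| = #|[pred j | rdeg g i j d \in T]|.
    apply: eq_card => j; rewrite !inE; congr (_ \in T); rewrite /rdeg /=; congr (_, _).
    by rewrite -[_ - w + g0]addrA [g i + _]addrC addrK [- w + _]addrC addrAC.
  have -> : #|[pred j | (g' j - w, 0) \in T']| = #|[pred j | rdeg g' i' j (d - h)%R \in T']|.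
    apply: eq_card => j; rewrite !inE -TT.
    have -> : rdeg g' i' j (d - h) = (g' j - w, 0) - t.
      apply: injective_projections; rewrite /rdeg /= ?th ?sub0r //.
      rewrite !addrA [LHS](ACl (1*4*3*8*5*7*9*2*6)) /=.
      by do 3!rewrite subrr add0r.
    apply/idP/idP => jT; first exact: TB.
    by have := bcD bc jT tT; rewrite subrK.
  apply/eqP; rewrite eqn_leq (link_rows charF0 md md' lk) /=.
  by have := link_rows charF0 md' md lk' (d - h); rewrite opprK subrK.
have T'0 : 0 \in T' by rewrite -TT (bc0 bc).
have TB' u v : u \in T' -> v \in T' -> u - v \in T' by rewrite -TT; apply: TB.
have cmem w : count_mem (translate w T)
      [seq translate g0 C | C <- Xi T [seq g i | i <- enum 'I_k]] =
    count_mem (translate w T) (Xi T' [seq g' i | i <- enum 'I_k']).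
  rewrite /Xi -!map_comp !count_map.
  transitivity #|[pred j | (g0 + g j - w, 0) \in T]|; last rewrite cnt.
    apply: etrans (count_enum _) _.
    by apply: eq_card => j; rewrite !inE /= translateD translate_eq ?(bc0 bc).
  apply/esym; apply: etrans (count_enum _) _.
  by apply: eq_card => j; rewrite !inE /= TT translate_eq.
apply/allP=> C CC; have [w ->] : exists w, C = translate w T.
  move: CC; rewrite mem_cat /Xi -!map_comp => /orP[] /mapP[j _ ->] /=.
    by exists (g0 + g j); rewrite translateD.
  by exists (g' j); rewrite TT.
by apply/eqP; apply: cmem.
Qed.

End ModelsUnique.

(** * From isomorphisms of the induced gradings to isomorphisms of models *)

(** The eigenvalues of the 2 x 2 matrix A are the square roots of a. *)
Lemma has_eigen_sqrt (F : fieldType) (a : F) : has_eigen F -> exists l, l * l = a.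
Proof.
move=> eigF; pose A : 'M[F]_2 := \matrix_(i, j) (if i == j then 0 else if i == 0 then 1 else a).
have [l [w [wA w0]]] := eigF _ A isT; exists l.
have [E0 E1] : w 0 1 * a = l * w 0 0 /\ w 0 0 = l * w 0 1.
  split; [have := congr1 (fun v : 'rV_2 => v 0 0) wA|have := congr1 (fun v : 'rV_2 => v 0 1) wA];
  rewrite !mxE !big_ord_recl big_ord0 !mxE /=;
  by have -> : lift ord0 ord0 = 1 :> 'I_2 by [apply: val_inj];
    rewrite !(mulr0, mulr1, add0r, addr0).
have [w1|w1] := eqVneq (w 0 1) 0.
  case/eqP: w0; apply/rowP=> j; rewrite !mxE.
  by case: (I2P j) => -> //; rewrite E1 w1 mulr0.
by apply: (mulfI w1); rewrite E0 E1; ring.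
Qed.

Section IsoAuto.
Variables (F : fieldType) (charF0 : [pchar F] =i pred0) (G : zmodType) (n : nat).
Local Notation r := n.+1.
Local Notation M := 'M[F]_(n.+1 + n.+1).
Local Notation par := (@mx_par F n.+1).
Local Notation sl := (sl F r).
Local Notation psl_pi := (psl_pi F r).

HB.instance Definition _ := GRing.isLinear.Build F M M _ (@Lproj F r) (@Lproj_linear F r).

Lemma Lproj1 a : Lproj (a *: 1%:M : M) = 0.
Proof.
rewrite /Lproj mxtraceZ mxtrace1 mulfK ?subrr // natF_eq0 // addnS.
Qed.

Lemma Lproj_par i x : x \in par i -> Lproj x \in par i.
Proof.
have p1 : (1%:M : M) \in par 0 by rewrite scalar_mx_block ev_par.
case: (Z2P i) => -> xi; first by rewrite rpredB ?rpredZ.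
have [B [C xE]] := par1_od xi.
by rewrite Lproj_id // xE; have [] := inL_od B C.
Qed.

Lemma psl_pi_Lproj x : psl_pi (Lproj x) = psl_pi x.
Proof. by rewrite /Lproj linearB /= psl_pi1 subr0. Qed.

(** A section of [psl_pi] with values in L; it is linear because [Lproj] removes the dependence on
    the chosen representative. *)
Definition psl_sec (p : psl F r) : M := Lproj (vsval (repr p)).

Lemma psl_secE x : x \in sl -> psl_sec (psl_pi x) = Lproj x.
Proof.
move=> xs; have [|a aE] := psl_piE (subvsP (repr (psl_pi x))) xs.
  exact: psl_piK.
by rewrite /psl_sec aE linearD /= Lproj1 addr0.
Qed.

Lemma psl_sec_linear : linear psl_sec.
Proof.
move=> a p q; have rs (x : psl F r) : vsval (repr x) \in sl by apply: subvsP.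
rewrite -[RHS]linearP /= -[RHS]psl_secE ?rpredD ?rpredZ //.
by rewrite linearP /= !psl_piK.
Qed.

HB.instance Definition _ :=
  GRing.isLinear.Build F (psl F r) M _ psl_sec psl_sec_linear.

Lemma psl_secK p : psl_pi (psl_sec p) = p.
Proof. by rewrite psl_pi_Lproj psl_piK. Qed.

Lemma psl_sec_inL p : inL (psl_sec p).
Proof. by apply: (Lproj_inL charF0) => //; apply: subvsP. Qed.

Variable f : 'End(psl F r).

Definition iso_map (x : M) : M := psl_sec (f (psl_pi x)).

Lemma iso_map_linear : linear iso_map.
Proof. by move=> a x y; rewrite /iso_map !linearP. Qed.

HB.instance Definition _ := GRing.isLinear.Build F M M _ iso_map iso_map_linear.

Hypothesis fA : super_aut (@psl_mul F r) (@psl_par F r) f.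

Lemma psl_pi_par i x : inL x -> x \in par i -> psl_pi x \in psl_par F r i.
Proof. by case=> xs _ xi; apply: memv_img; rewrite memv_cap xs. Qed.

Lemma psl_par_sec i p : p \in psl_par F r i -> psl_sec p \in par i.
Proof.
case/memv_imgP=> b /memv_capP[bs bi] ->; rewrite psl_secE //.
exact: Lproj_par.
Qed.

Lemma psl_sec_id x : inL x -> psl_sec (psl_pi x) = x.
Proof. by case=> xs x0; rewrite psl_secE // Lproj_id. Qed.

Lemma iso_psl_auto : psl_auto iso_map.
Proof.
have [fker fmul fpar] := fA; split.
- by move=> x _; apply: psl_sec_inL.
- move=> i x xL xi; apply: psl_par_sec; rewrite -fpar; apply: memv_img.
  exact: psl_pi_par.
- move=> x y [xs x0] [ys y0]; rewrite /= /iso_map psl_pi_Lproj psl_mulE // fmul.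
  have [s1 _] := psl_sec_inL (f (psl_pi x)); have [s2 _] := psl_sec_inL (f (psl_pi y)).
  rewrite -[f (psl_pi x) in LHS]psl_secK -[f (psl_pi y) in LHS]psl_secK -psl_mulE //.
  by rewrite psl_secE ?scomm_sl.
- move=> x xL /(congr1 psl_pi); rewrite psl_secK linear0 => fx.
  have : psl_pi x \in lker f by rewrite memv_ker fx.
  by rewrite fker memv0 => /eqP px; rewrite -(psl_sec_id xL) px linear0.
move=> i y yL yi; have := psl_pi_par yL yi; rewrite -fpar.
case/memv_imgP=> p /psl_par_sec pp fp; exists (psl_sec p); split=> //.
  exact: psl_sec_inL.
by rewrite /= /iso_map psl_secK -fp psl_sec_id.
Qed.

Lemma iso_map_deg (Gr Gr' : G -> {vspace M}) x a :
  (f @: induced Gr x = induced Gr' x)%VS ->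
  (forall b, inL b -> psl_pi b \in induced Gr x <-> b \in Gr x) ->
  (forall b, inL b -> psl_pi b \in induced Gr' x <-> b \in Gr' x) ->
  inL a -> a \in Gr x <-> iso_map a \in Gr' x.
Proof.
move=> fx ind ind' aL; have [fker _ _] := fA.
apply: iff_trans (iff_sym (ind _ aL)) (iff_trans _ (ind' _ (psl_sec_inL _))).
rewrite psl_secK -fx; split=> [|/memv_imgP[b bx fab]]; first exact: memv_img.
suff -> : psl_pi a = b by [].
apply/eqP; rewrite -subr_eq0 -memv0 -fker memv_ker linearB /= fab subrr.
by [].
Qed.

End IsoAuto.

(** The opposite supertranspose followed by conjugation by diag(-b' J, J). The conjugation turns -
    X^T into X on traceless blocks, and b' c' = -1 makes Q the inverse of P. *)
Lemma theta_anti (F : fieldType) n (b' c' : F) : [pchar F] =i pred0 -> n = 1%N ->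
  b' * c' = -1 -> exists Theta : 'End('M[F]_(n.+1 + n.+1)), [/\ nice true Theta,
    forall X Y, \tr X = 0 -> \tr Y = 0 -> Theta (ev X Y) = ev X Y,
    Theta (Smx F n) = -1 *: Smx F n &
    forall B C, Theta (od B C) = od (b' *: star C) (c' *: star B)].
Proof.
move=> charF0 -> bc; have cb : - b' * c' = 1 by rewrite mulNr bc opprK.
pose J := Jmx F; have JJ' : J *m - J = 1%:M := JJ F.
pose P := ev ((- b') *: J) J; pose Q := ev (c' *: - J) (- J).
have nc : nice false (lconj P Q).
  apply: nice_ev_conj => //.
  by rewrite -scalemxAl -scalemxAr scalerA cb scale1r.
have PE Z : - b' *: J *m Z *m (c' *: - J) = J *m Z *m - J.
  by rewrite -!scalemxAl -scalemxAr scalerA cb scale1r.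
exists (lconj P Q \o linfun (@nst F 2))%VF; split.
- exact: (nice_comp (nice_nst F 2) nc).
- move=> X Y X0 Y0; rewrite comp_lfunE nstE nst_ev ev_conj PE.
  have sJ Z : \tr Z = 0 -> J *m - Z^T *m - J = Z.
    by move=> Z0; rewrite [J *m - _]mulmxN mulNmx -starJ star0 // opprK.
  by rewrite !sJ.
- rewrite comp_lfunE nstE nst_ev ev_conj PE.
  have -> : (- 1%:M)^T = - 1%:M :> 'M[F]_2 by rewrite raddfN /= tr_scalar_mx.
  rewrite opprK tr_scalar_mx.
  have JI : J *m 1%:M *m - J = 1%:M by rewrite mulmx1.
  have JN : J *m - 1%:M *m - J = - 1%:M by rewrite [J *m - _]mulmxN mulNmx JI.
  transitivity (ev (- 1%:M) 1%:M : 'M[F]_(2 + 2)); first by congr ev; [exact: JN|exact: JI].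
  by rewrite scaleN1r oppev opprK.
move=> B C; rewrite comp_lfunE nstE nst_od ev_conj_od !starJ; congr od.
  by rewrite -!scalemxAl scaleNr [J *m - _]mulmxN mulNmx scalerN opprK.
by rewrite -scalemxAr.
Qed.

Section Straighten.
Variables (F : fieldType) (charF0 : [pchar F] =i pred0) (eigF : has_eigen F).
Variables (G : zmodType) (n : nat) (n_gt0 : (0 < n)%N).
Local Notation r := n.+1.
Local Notation M := 'M[F]_(n.+1 + n.+1).
Local Notation Gs := (G * 'Z_2)%type.
Local Notation par := (@mx_par F n.+1).
Local Notation S := (Smx F n).

Lemma S_ev X Y : S *m ev X Y = ev X (- Y) :> M.
Proof. by rewrite mul_ev mul1mx mulNmx mul1mx. Qed.

Lemma S_od B C : S *m od B C = od B (- C) :> M.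
Proof. by rewrite mul_ev_od mul1mx mulNmx mul1mx. Qed.

Section Model.
Variables (T : {fset Gs}) (beta : Gs -> Gs -> F) (k : nat).
Variables (E : 'I_k -> 'I_k -> M) (U : Gs -> M).
Hypothesis md : model T beta E U.
Variable g : 'I_k -> G.

Let bc := md_bc md.

Lemma hmG_uniq x y a : hmG T E U g x a -> hmG T E U g y a -> a != 0 -> x = y.
Proof.
move=> hx hy; apply: contraNeq => xy; apply/eqP; apply: (kap_ext charF0 md) => i j t tT.
rewrite linear0; have [dx|dx] := eqVneq (g i + t.1 - g j) x; last exact: hx.
by apply: hy => //; rewrite dx.
Qed.

(** Otherwise k = 1 and every even basis element is proportional to 1 or S, so the even part would
    consist of diag(a, b) with scalar blocks, which fails for r > 1. *)
Lemma even_hom : exists i j t,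
  [/\ t \in T, t.2 = 0, \tr (E i j *m U t) = 0 & str (E i j *m U t) = 0].
Proof.
have [s [sT s2 ss Us]] := Smx_hom charF0 md; apply: NNPP => no.
have even_1 (i j : 'I_k) t : t \in T -> t.2 = 0 -> i = j /\ (t = 0 \/ t = s).
  move=> tT t2; apply: NNPP => nij; apply: no; exists i, j, t.
  have ijt : (i != j) || (t != 0) && (t != s).
    apply/negPn/negP; rewrite negb_or negb_and !negbK => /andP[/eqP ij ts].
    by apply: nij; split=> //; case/orP: ts => /eqP; [left|right].
  split=> //; last first.
    by apply: (md_str charF0 md sT ss Us tT); case/orP: ijt => [->|/andP[_ ->]]; rewrite ?orbT.
  have [t0|t0] := eqVneq t 0; last exact: (md_trU md).
  move: ijt; rewrite t0 eqxx orbF (md_U0 md) mulmx1 (md_trE charF0 md).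
  by move/negPf->.
pose i0 : 'I_k := Ordinal (md_k0 md).
have all0 i : i = i0 by have [] := even_1 i i0 0 (bc0 bc) erefl.
have E1 : E i0 i0 = 1%:M.
  rewrite -(md_1 md) (bigD1 i0) //= big1 ?addr0 // => i.
  by rewrite (all0 i) eqxx.
have scal (x : M) : x \in par 0 -> exists a b, x = ev a%:M b%:M.
  move=> x0; apply: (kap_ind charF0 md (P := fun x => exists a b, x = ev a%:M b%:M) (a := x)).
  - by exists 0, 0; rewrite !raddf0 ev0.
  - move=> c y z [a [b ->]] [a' [b' ->]]; exists (c * a + a'), (c * b + b').
    by rewrite -evD !raddfD /= !scale_scalar_mx.
  move=> i j t tT kt; have t2 := kap_par charF0 md x0 tT kt.
  have [_ ts] := even_1 i j t tT t2; rewrite (all0 i) (all0 j) E1 mul1mx.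
  case: ts => ->; first by exists 1, 1; rewrite (md_U0 md) ev_1.
  have [c _ ->] := Us; exists c, (- c); rewrite /Smx -[c *: _]addr0 -ev0 -evD !addr0.
  by rewrite scalerN !scale_scalar_mx mulr1 raddfN.
have [j j0] := exists_nz n_gt0.
have [a [b]] := scal _ (ev_par (delta_mx 0 j) 0).
case/ev_inj=> /matrixP/(_ 0 j); rewrite !mxE !eqxx /= eq_sym (negPf j0) mulr0n => /eqP.
by rewrite oner_eq0.
Qed.

End Model.

(* On odd elements [Fm] and its conjugate by S = diag(1, -1) respect degrees,
   hence so do the block diagonal part (b, c) of [Fm] and its antidiagonal part
   (b', c'); at least one of them extends to an automorphism of the matrix
   superalgebra or to the opposite of an antiautomorphism. *)
Lemma theta_exists (Fm : {linear M -> M}) b c b' c' :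
  b * c - b' * c' = 1 -> ((1 < n)%N -> b' = 0 /\ c' = 0) ->
  (forall B C, Fm (od B C) = od (b *: B + b' *: star C) (c' *: star B + c *: C)) ->
  exists e (Theta : 'End(M)) d l m, [/\ nice e Theta,
    forall X Y, \tr X = 0 -> \tr Y = 0 -> Theta (ev X Y) = ev X Y,
    Theta S = d *: S &
    forall B C, Theta (od B C) = l *: Fm (od B C) + m *: (S *m Fm (S *m od B C))].
Proof.
move=> det bc0 Fod.
have ZodD x y B C B' C' : x *: od B C + y *: od B' C' =
    od (x *: B + y *: B') (x *: C + y *: C') :> M.
  by rewrite odD; congr (_ + _); rewrite /od scale_block_mx !scaler0.
have SF B C : S *m Fm (S *m od B C) =
    od (b *: B - b' *: star C) (c *: C - c' *: star B).
  by rewrite S_od Fod S_od linearN /= !scalerN opprD opprK [_ + c *: C]addrC.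
have two : 2%:R != 0 :> F := natF2 charF0.
have [bc|bcN0] := eqVneq (b * c) 0.
  have bc' : b' * c' = -1 by rewrite -det bc sub0r opprK.
  have n1 : n = 1%N.
    apply/eqP; rewrite eqn_leq n_gt0 andbT leqNgt; apply/negP => /bc0[b'0 _].
    by move/eqP: bc'; rewrite b'0 mul0r eq_sym oppr_eq0 oner_eq0.
  have [Th [nc Tev TS Tod]] := theta_anti charF0 n1 bc'.
  (* Half the difference of Fm and its conjugate by S is the antidiagonal part. *)
  exists true, Th, (-1), (2%:R)^-1, (- (2%:R)^-1); split=> // B C.
  rewrite Tod SF Fod ZodD; congr od; apply/matrixP=> i j; rewrite !mxE; by field.
(* Conjugation by diag(al, 1) scales B by al and C by its inverse. With la^2 = 1 / (b c) and al = la
   b these are la b and la c, that is, la times the diagonal part of Fm. *)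
have [la laE] := has_eigen_sqrt (b * c)^-1 eigF.
have la0 : la != 0.
  by apply: contraNneq bcN0 => l0; rewrite -invr_eq0 -laE l0 mul0r.
have b0 : b != 0 by apply: contraNneq bcN0 => ->; rewrite mul0r.
pose al := la * b; have al0 : al != 0 by rewrite mulf_neq0.
have alV : al^-1 = la * c.
  apply: (mulfI al0); rewrite mulfV // /al mulrACA laE mulVf //.
exists false, (lconj (ev al%:M 1%:M) (ev al^-1%:M 1%:M)), 1, (la / 2%:R), (la / 2%:R); split.
- by apply: nice_ev_conj; [rewrite -scalar_mxM mulfV|rewrite mulmx1].
- move=> X Y _ _; rewrite ev_conj; congr ev; last by rewrite mul1mx mulmx1.
  by rewrite mul_scalar_mx mul_mx_scalar scalerA mulVf // scale1r.
- rewrite scale1r [LHS]ev_conj; congr ev; last by rewrite mul1mx mulmx1.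
  by rewrite mulmx1 -scalar_mxM mulfV.
move=> B C; rewrite ev_conj_od SF Fod ZodD; congr od;
  rewrite ?mul1mx ?mulmx1 ?mul_scalar_mx ?mul_mx_scalar ?alV /al;
  by apply/matrixP=> i j; rewrite !mxE; field.
Qed.

End Straighten.

Section Straighten.
Variables (F : fieldType) (charF0 : [pchar F] =i pred0) (eigF : has_eigen F).
Variables (G : zmodType) (n : nat) (n_gt0 : (0 < n)%N).
Local Notation r := n.+1.
Local Notation M := 'M[F]_(n.+1 + n.+1).
Local Notation Gs := (G * 'Z_2)%type.
Local Notation par := (@mx_par F n.+1).
Local Notation S := (Smx F n).

Lemma hmG_Smx (T : {fset Gs}) beta k (E : 'I_k -> 'I_k -> M) U (g : 'I_k -> G) s :
  model T beta E U -> s \in T -> s.2 = 0 -> (exists2 c, c != 0 & U s = c *: S) ->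
  hmG T E U g s.1 S /\
  forall p x a, a \in par p -> hmG T E U g x a -> hmG T E U g (s.1 + x) (S *m a).
Proof.
move=> md sT s2 [c c0 Us].
have hS : hmg T E U g s S.
  have -> : S = c^-1 *: U s by rewrite Us scalerA mulVf // scale1r.
  by apply: hmgZ; apply: (hmg_U charF0 md).
split=> [|p x a ap hx]; first by have /(hmgP charF0 md)[] := hS.
have ha : hmg T E U g (x, p) a by apply/(hmgP charF0 md).
by have /(hmgP charF0 md)[] := hmgM charF0 md hS ha.
Qed.

(** The comparison map is Theta followed by the inverse of Psi; it is kept as a relation between a
    and b so that each factor can be transported separately. *)
Lemma straighten (T T' : {fset Gs}) beta beta' k k' E U (g : 'I_k -> G)
    E' U' (g' : 'I_k' -> G) (Fm : {linear M -> M}) :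
  model T beta E U -> model T' beta' E' U' -> psl_auto Fm ->
  (forall x a, inL a -> hmG T E U g x a <-> hmG T' E' U' g' x (Fm a)) ->
  exists e1 (Theta : 'End(M)) e0 (Psi : 'End(M)), [/\ nice e1 Theta, nice e0 Psi &
    forall x a b, Theta a = Psi b -> hmG T E U g x a <-> hmG T' E' U' g' x b].
Proof.
move=> md md' pa hF; have [e0 [Psi [nc0 PF]]] := psl_auto_normalizable eigF charF0 n_gt0 pa.
pose F1 : {linear M -> M} := Psi \o Fm.
have pa1 : psl_auto F1 := psl_auto_comp nc0 pa.
pose E1 := tE E' e0 Psi; pose U1 := tU U' e0 Psi; pose g1 := tg e0 g'.
have md1 : model T' (tbeta beta' e0) E1 U1 := tmodel md' nc0.
have H1 x a : hmG T' E' U' g' x a <-> hmG T' E1 U1 g1 x (Psi a).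
  exact: (tmodel_hmG charF0 md' nc0).
have hF1 x a : inL a -> hmG T E U g x a <-> hmG T' E1 U1 g1 x (F1 a).
  by move=> aL; apply: iff_trans (hF x a aL) (H1 x _).
have F1ev X Y : \tr X = 0 -> \tr Y = 0 -> F1 (ev X Y) = ev X Y by apply: PF.
have [b [c [b' [c' [det bc0 Fod]]]]] := odd_part charF0 n_gt0 pa1 F1ev.
have [e1 [Th [d [l [m [nc1 Tev TS Tod]]]]]] := theta_exists charF0 eigF n_gt0 det bc0 Fod.
exists e1, Th, e0, Psi; split=> //.
suff main x a : hmG T E U g x a <-> hmG T' E1 U1 g1 x (Th a).
  by move=> x a a' Ea; apply: iff_trans (main x a) (iff_sym _); rewrite Ea.
move: x a.
have [s [sT s2 ss Us]] := Smx_hom charF0 md.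
have [s1 [s1T s12 ss1 Us1]] := Smx_hom charF0 md1.
have [hS SM] := hmG_Smx g md sT s2 Us; have [hS1 SM1] := hmG_Smx g1 md1 s1T s12 Us1.
have evh y X Y : \tr X = 0 -> \tr Y = 0 ->
    hmG T E U g y (ev X Y) -> hmG T' E1 U1 g1 y (ev X Y).
  by move=> X0 Y0 /(hF1 y (ev X Y)); rewrite F1ev //; apply; apply/inL_ev.
(* A homogeneous even element of L and its product with S are both fixed by F1, so they have the
   same degrees in both gradings. In each, the difference of the two is the degree of S. *)
have s_s1 : s.1 = s1.1.
  have [i [j [t [tT t2 tr0 str0]]]] := even_hom charF0 n_gt0 md.
  have hb := hmG_basis charF0 md (g := g) (i := i) (j := j) tT.
  have bp := md_par md i j tT; rewrite t2 in bp.
  have b0 : S *m (E i j *m U t) != 0.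
    apply/eqP=> Sb; have : E i j *m U t = 0 by rewrite -[LHS]mul1mx -SmxS -mulmxA Sb mulmx0.
    move/(congr1 (kap E U i j t)); rewrite linear0 (kapE charF0 md) // !eqxx /=.
    by apply/eqP; rewrite oner_eq0.
  have hSb := SM _ _ _ bp hb; have [X [Y bE]] := par0_ev bp.
  have [X0 Y0] : \tr X = 0 /\ \tr Y = 0.
    by apply/(inL_ev charF0); rewrite -bE; split=> //; apply/slP.
  rewrite bE in hb hSb b0 bp.
  have h1b := SM1 _ _ _ bp (evh _ _ _ X0 Y0 hb).
  move: hSb h1b b0; rewrite S_ev => hSb h1b b0.
  have nY0 : \tr (- Y) = 0 by rewrite linearN /= Y0 oppr0.
  by have /addIr := hmG_uniq charF0 md1 (evh _ _ _ X0 nY0 hSb) h1b b0.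
have odh y B C : hmG T E U g y (od B C) -> hmG T' E1 U1 g1 y (Th (od B C)).
  move=> hy; rewrite Tod; apply: hmGD; first by apply/hF1 => //; apply: inL_od.
  rewrite -[m *: _]addr0; apply: hmGD; last exact: hmG0.
  have := SM _ _ _ (od_par B C) hy; rewrite S_od => /(hF1 _ _ (inL_od _ _)) hSy.
  have := SM1 _ _ _ (pa_par pa1 (inL_od _ _) (od_par _ _)) hSy.
  rewrite addrA s_s1.
  have -> : s1.1 + s1.1 = 0 by have := congr1 fst ss1.
  by rewrite add0r.
have ev_h y X Y : hmG T E U g y (ev X Y) -> hmG T' E1 U1 g1 y (Th (ev X Y)).
  set a := ev X Y => ha.
  have r0 : r%:R != 0 :> F by rewrite natF_eq0.
  have rr0 : (r + r)%:R != 0 :> F by rewrite natF_eq0 // addnS.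
  have trS : \tr (S : M) = 0 by rewrite /Smx /ev mxtrace_block linearN subrr.
  have strS : str S = (r + r)%:R.
    by rewrite /str /Smx /ev !blockE linearN /= mxtrace1 opprK -natrD.
  (* Splits off the components of a along 1 and S, leaving a0 in L. A nonzero al forces y = 0 and a
     nonzero be forces y to be the degree of S, so all three terms are homogeneous of degree y. *)
  pose al := \tr a / (r + r)%:R; pose be := str a / (r + r)%:R.
  pose a0 := a - al *: 1%:M - be *: S.
  have aE : a = be *: S + (al *: 1%:M + a0).
    have dec (u v w : M) : u = w + (v + (u - v - w)).
      by rewrite [v + _]addrC addrAC subrK addrCA subrr addr0.
    exact: dec.
  have al0 : al = 0 \/ y = 0.
    have [tr0|trN] := eqVneq (\tr a) 0; first by left; rewrite /al tr0 mul0r.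
    by right; apply: (hmG_tr charF0 md ha).
  have be0 : be = 0 \/ y = s.1.
    have [st0|stN] := eqVneq (str a) 0; first by left; rewrite /be st0 mul0r.
    by right; apply: (hmG_str charF0 md sT ss Us ha).
  have hZ T2 k2 (E2 : 'I_k2 -> 'I_k2 -> M) U2 g2 z q : hmG T2 E2 U2 g2 y z ->
      hmG T2 E2 U2 g2 y (q *: z).
    by move=> hz; rewrite -[q *: z]addr0; apply: hmGD => //; apply: hmG0.
  have hA T2 k2 (E2 : 'I_k2 -> 'I_k2 -> M) U2 g2 z z' : hmG T2 E2 U2 g2 y z ->
      hmG T2 E2 U2 g2 y z' -> hmG T2 E2 U2 g2 y (z + z').
    by move=> hz hz'; rewrite -[z]scale1r; apply: hmGD.
  have a0h : hmG T E U g y a0.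
    have -> : a0 = -1 *: (al *: 1%:M) + (-1 *: (be *: S) + a).
      by rewrite /a0 !scaleN1r [RHS]addrC [- _ + a]addrC [RHS]addrAC.
    apply: (hA); last apply: (hA) => //; apply: (hZ _ _ _ _ _ (_ *: _)).
      case: al0 => [->|y0]; first by rewrite scale0r; apply: hmG0.
      by apply: (hZ); rewrite y0; apply: (hmG1 charF0 md).
    case: be0 => [->|ys]; first by rewrite scale0r; apply: hmG0.
    by apply: (hZ); rewrite ys.
  have [X0 [Y0 [a0E X00 Y00]]] : exists X0 Y0, [/\ a0 = ev X0 Y0, \tr X0 = 0 & \tr Y0 = 0].
    have ap : a0 \in par 0.
      rewrite /a0 !rpredB ?ev_par // rpredZ ?ev_par //.
      by rewrite -[1%:M]ev_1 ev_par.
    have [X0 [Y0 a0E]] := par0_ev ap; exists X0, Y0.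
    suff [? ?] : \tr X0 = 0 /\ \tr Y0 = 0 by split.
    apply/(inL_ev charF0); rewrite -a0E; split; last first.
      rewrite /a0 !linearB !linearZ /= mxtrace1 divfK //.
      by rewrite trS subrr mulr0 subr0.
    have strL (u z : M) q : str (u - q *: z) = str u - q * str z.
      by rewrite addrC -scaleNr linearP /= addrC -mulNr.
    apply/slP; rewrite /a0 !strL.
    have -> : str (1%:M : M) = 0 by apply/slP; apply: sl1.
    by rewrite strS mulr0 subr0 /be divfK // subrr.
  clearbody a0; rewrite aE !linearD !linearZ /= a0E Tev // TS (nc_1 nc1) -a0E.
  apply: (hA); last apply: (hA).
  - case: be0 => [->|yE]; first by rewrite scale0r; apply: hmG0.
    by apply: (hZ _ _ _ _ _ (d *: S)); apply: (hZ); rewrite yE s_s1.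
  - case: al0 => [->|yE]; first by rewrite scale0r; apply: hmG0.
    by apply: (hZ _ _ _ _ _ (_ *: 1%:M)); apply: (hZ); rewrite yE; apply: (hmG1 charF0 md1).
  by rewrite a0E; apply: evh; rewrite -?a0E.
apply: (hmG_mapE charF0 md md1 (nice_inj nc1)) => i j t tT.
have hb := hmG_basis charF0 md (g := g) (i := i) (j := j) tT.
case: (Z2P t.2) (md_par md i j tT) => ->.
  by case/par0_ev=> X [Y bE]; move: hb; rewrite bE; apply: ev_h.
by case/par1_od=> X [Y bE]; move: hb; rewrite bE; apply: odh.
Qed.

End Straighten.

Section ModelsIso.
Variables (F : fieldType) (charF0 : [pchar F] =i pred0) (eigF : has_eigen F).
Variables (G : zmodType) (n : nat) (n_gt0 : (0 < n)%N).
Local Notation r := n.+1.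
Local Notation M := 'M[F]_(n.+1 + n.+1).
Local Notation Gs := (G * 'Z_2)%type.

Lemma nice_surj e (Psi : 'End(M)) : nice e Psi -> forall y, exists x, Psi x = y.
Proof. by case=> _ _ _ [Pi [_ PiK _]] y; exists (Pi y). Qed.

Lemma models_iso (T T' : {fset Gs}) beta beta' k k' E U (g : 'I_k -> G)
    E' U' (g' : 'I_k' -> G) (Fm : {linear M -> M}) t0 :
  model T beta E U -> model T' beta' E' U' -> psl_auto Fm ->
  (forall x a, inL a -> hmG T E U g x a <-> hmG T' E' U' g' x (Fm a)) ->
  t0 \in T -> t0.2 != 0 ->
  exists e, [/\ T = T', {in T &, tbeta beta e =2 beta'} & exists g0,
    perm_eq [seq translate g0 C | C <- Xi T [seq tg e g i | i <- enum 'I_k]]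
            (Xi T' [seq g' i | i <- enum 'I_k'])].
Proof.
move=> md md' pa hF t0T t02.
have [e1 [Th [e0 [Psi [nc1 nc0 H]]]]] := straighten charF0 eigF n_gt0 md md' pa hF.
(* Composing both maps with one of the type of Psi makes the second an automorphism, so that beta'
   and g' remain unchanged and the sign falls entirely on the first model. *)
have [Xi0 ncX] := nice_exists F n e0.
have ncT := nice_comp nc1 ncX; have ncP := nice_comp nc0 ncX; rewrite addbb in ncP.
exists (e0 (+) e1); pose e := e0 (+) e1; rewrite -/e in ncT *.
apply: (models_unique charF0 (tmodel md ncT) (tmodel md' ncP)
  (g := tg e g) (g' := g') t0T t02) => x y.
have [a aE] := nice_surj ncT y; have [b bE] := nice_surj ncP y.
have := tmodel_hmG charF0 md ncT g x a; have := tmodel_hmG charF0 md' ncP g' x b.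
rewrite aE bE => Hb Ha; apply: iff_trans (iff_sym Ha) (iff_trans _ Hb).
apply: H; apply: (nice_inj ncX).
by rewrite -[LHS](comp_lfunE Xi0 Th) -[RHS](comp_lfunE Xi0 Psi) aE bE.
Qed.

End ModelsIso.

Theorem theorem5p8 (F : closedFieldType) (charF0 : [pchar F] =i pred0)
    (G : zmodType) (n : nat) (n_gt0 : (1 <= n)%N) :
  (forall Gr : G -> {vspace psl F n.+1},
     psl_grading Gr -> odd_type_I Gr ->
     exists (T : {fset G * 'Z_2}) (beta : G * 'Z_2 -> G * 'Z_2 -> F)
            (k : nat) (gamma : k.-tuple G) (Gr' : G -> {vspace psl F n.+1}),
       [/\ bicharacter_datum T beta, size_condition n T k,
           is_Gamma_A T beta gamma Gr' & psl_grading_iso Gr Gr'])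
  /\
  (forall (T T' : {fset G * 'Z_2}) (beta beta' : G * 'Z_2 -> G * 'Z_2 -> F)
          (k k' : nat) (gamma : k.-tuple G) (gamma' : k'.-tuple G)
          (Gr Gr' : G -> {vspace psl F n.+1}),
     bicharacter_datum T beta -> size_condition n T k ->
     bicharacter_datum T' beta' -> size_condition n T' k' ->
     is_Gamma_A T beta gamma Gr -> is_Gamma_A T' beta' gamma' Gr' ->
     (psl_grading_iso Gr Gr' <->
      T = T' /\
      exists (delta : int) (g : G),
        [/\ delta = 1 \/ delta = -1,
            {in T &, forall u v, beta u v ^ delta = beta' u v}
          & perm_eq
              [seq translate g C | C <- Xi T [seq x *~ delta | x <- gamma]]
              (Xi T' gamma')])).
Proof.
have eigF := @closed_has_eigen F.
split=> [Gr _ [[Gr0 [gr GrE]] nev]|T T' beta beta' k k' gamma gamma' Gr Gr' bd sz bd' sz'].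
  have [T [beta [k [m [Dc [V [W [g st]]]]]]]] := structure_exists gr.
  (* An odd element of T leads to a Gamma grading; without one the grading would be even. *)
  have [/hasP[t0 t0T t02]|/hasPn Tev] := boolP (has (fun t : G * 'Z_2 => t.2 != 0) T).
    have [bd sz [gamma isG]] := structure_gamma charF0 st gr t0T t02.
    exists T, beta, k, gamma, Gr; split=> //; first by exists Gr0.
    exists \1%VF; split; last by move=> h; rewrite lim1g.
    split; [|by move=> x y; rewrite !id_lfunE|by move=> i; rewrite lim1g].
    by apply/eqP; rewrite -subv0; apply/subvP=> x; rewrite memv_ker id_lfunE memv0.
  case: nev; have [_ ev] := structure_even charF0 st gr (fun t tT => eqP (negPn (Tev t tT))).
  split; first by exists Gr0.
  by move=> chi /ev[f [fa fi]]; exists f; split=> // x y; rewrite GrE; apply: fa.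
case=> Gr0 isG GrE [Gr0' isG' GrE'].
have [E [U [md EU]]] := gamma_model bd sz isG.
have [E' [U' [md' EU']]] := gamma_model bd' sz' isG'.
have hE := model_hmG charF0 md isG.1 EU; have hE' := model_hmG charF0 md' isG'.1 EU'.
split=> [[f [fA fGr]]|[TT [delta [g [dE bE pe]]]]].
  have pa := iso_psl_auto charF0 fA.
  have [t0 t0T t02] := bd_odd bd.
  have [|e [TT bb [g0 pe]]] := models_iso charF0 eigF n_gt0 (g := tnth gamma)
      (g' := tnth gamma') md md' pa _ t0T t02.
    move=> x a aL; apply: iff_trans (iff_sym (hE x a)) (iff_trans _ (hE' x _)).
    apply: (iso_map_deg charF0 fA) => //; first by rewrite -GrE -GrE'.
      by apply: (induced_inL charF0 md hE).
    by apply: (induced_inL charF0 md' hE').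
  split=> //; exists (if e then -1 else 1), g0; split.
  - by case: (e); [right|left].
  - by move=> u v uT vT; rewrite -bb // /tbeta; case: (e); rewrite ?exprN1 ?expr1z.
  move: pe; rewrite map_tnth_enum; congr (perm_eq [seq _ | C <- Xi T _] _).
  rewrite -[in RHS](map_tnth_enum gamma) -map_comp; apply: eq_map => i /=.
  by rewrite /tg; case: (e); rewrite ?mulrN1z ?mulr1z.
rewrite -TT in md' bd' sz' pe hE' EU' isG' *.
(* T determines l, and k l = k' l with l nonzero. Equal lengths allow the equality of multisets to
   be read as a permutation of indices. *)
have kk : k = k'.
  have [l lT kl] := sz; have [l' lT' kl'] := sz'.
  have ll : l = l' by apply/eqP; rewrite -eqn_sqr lT lT'.
  apply/eqP; rewrite -(@eqn_pmul2r l) ?kl ?ll ?kl' //.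
  by rewrite -ll lt0n; apply/eqP=> l0; move: kl; rewrite l0 muln0.
move: k' kk gamma' E' pe sz' isG' md' EU' hE' => _ <- gamma' E' pe sz' isG' md' EU' hE'.
have [e deltaE] : exists e : bool, delta = if e then -1 else 1.
  by case: dE => ->; [exists false|exists true].
have bb : {in T &, tbeta beta e =2 beta'}.
  by move=> u v uT vT; rewrite -bE // deltaE /tbeta; case: (e); rewrite ?exprN1 ?expr1z.
pose xi' := map_tuple (fun x => translate x T) gamma'.
have /tuple_permP[p pE] : perm_eq
    [seq translate g C | C <- Xi T [seq x *~ delta | x <- gamma]] xi' := pe.
have [p' pK pK'] : bijective p := injF_bij (@perm_inj _ p).
have [T0 TB] := bd_group bd.
have gT i : (g + tg e (tnth gamma) i - tnth gamma' (p i), 0) \in T.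
  rewrite -translate_eq // -translateD; apply/eqP.
  have := congr1 (fun s => nth T s i) pE.
  rewrite -[RHS]tnth_nth tnth_mktuple tnth_map => <-.
  rewrite /Xi -!map_comp (nth_map 0) ?size_tuple //= -tnth_nth deltaE /tg.
  by case: (e); rewrite ?mulrN1z ?mulr1z.
have [Psi [nc PE]] := models_equiv charF0 eigF pK pK' md md' bb gT.
have [|f [fA fGr]] := psl_iso_nice (Gr := Gr0) (Gr' := Gr0') nc.
  by move=> x a; apply: iff_trans (hE x a) (iff_trans (PE x a) (iff_sym (hE' x _))).
by exists f; split=> // h; rewrite GrE GrE' fGr.
Qed.
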